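(* There exist a stationary $1$-dependent $4$-coloring $X=(X_i)_{i\in\mathbb{Z}}$ of $\mathbb{Z}$ and a stationary $2$-dependent $3$-coloring $Y=(Y_i)_{i\in\mathbb{Z}}$ of $\mathbb{Z}$ with all of the following properties. (i) The processes are reversible and symmetric under permutations of the colors: $X$ is equal in law to $(X_{-i})_{i\in\mathbb{Z}}$, and to $(\sigma(X_i))_{i\in\mathbb{Z}}$ for any permutation $\sigma$ of $\{1,2,3,4\}$; and $Y$ is equal in law to $(Y_{-i})_{i\in\mathbb{Z}}$, and to $(\sigma(Y_i))_{i\in\mathbb{Z}}$ for any permutation $\sigma$ of $\{1,2,3\}$. (ii) The process $(\mathbf{1}[X_i=1])_{i\in\mathbb{Z}}$ is equal in law to $(\mathbf{1}[B_i>B_{i+1}])_{i\in\mathbb{Z}}$, where $(B_i)_{i\in\mathbb{Z}}$ are i.i.d. taking values $0,1$ with equal probabilities. (iii) The process $(\mathbf{1}[X_i\in\{1,2\}])_{i\in\mathbb{Z}}$ is equal in law to $(\mathbf{1}[U_i>U_{i+1}])_{i\in\mathbb{Z}}$, where $(U_i)_{i\in\mathbb{Z}}$ are i.i.d. uniform on $[0,1]$. (iv) The process $(\mathbf{1}[Y_i=1])_{i\in\mathbb{Z}}$ is equal in law to $(\mathbf{1}[U_{i-1}<U_i>U_{i+1}])_{i\in\mathbb{Z}}$, where $(U_i)_{i\in\mathbb{Z}}$ are i.i.d. uniform on $[0,1]$. (v) For every $n\ge 1$, the law of $(Y_1,\ldots,Y_n)$ is the conditional law of $(X_1,\ldots,X_n)$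 given that $X_i\neq 4$ for $i=1,\ldots,n$. Moreover, every stationary $1$-dependent $4$-coloring $X$ of $\mathbb{Z}$ satisfies property (ii).
   Context: A stochastic process $X=(X_i)_{i\in\mathbb{Z}}$ is $k$-dependent if the random sequences $(\ldots,X_{i-2},X_{i-1})$ and $(X_{i+k},X_{i+k+1},\ldots)$ are independent of each other, for each $i\in\mathbb{Z}$. It is stationary if $(X_i)_{i\in\mathbb{Z}}$ and $(X_{i+1})_{i\in\mathbb{Z}}$ are equal in law. It is a $q$-coloring (of $\mathbb{Z}$) if each $X_i$ takes values in $\{1,\ldots,q\}$ and almost surely $X_i\neq X_{i+1}$ for all $i\in\mathbb{Z}$. $\mathbf{1}[\,\cdot\,]$ denotes the indicator function of an event. *)

(* Defs.v *)
From HB Require Import structures.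
From mathcomp Require Import all_boot all_order all_algebra finmap.
From mathcomp Require Import all_classical all_reals all_analysis.

Set Implicit Arguments.
Unset Strict Implicit.
Unset Printing Implicit Defensive.

Import Order.TTheory GRing.Theory Num.Theory.
Import numFieldNormedType.Exports.

Local Open Scope classical_set_scope.
Local Open Scope ring_scope.

Definition sigma_generated (S : Type) (d : measure_display)
    (E : measurableType d) (X : int -> S -> E) (I : set int) : set (set S) :=
  <<s \bigcup_(j in I) preimage_set_system setT (X j) measurable >>.

Definition product_sigma (d : measure_display) (E : measurableType d) :
    set (set (int -> E)) :=
  sigma_generated (fun (i : int) (x : int -> E) => x i) setT.

(* Meaningful when all X i and X' i are measurable: then each event below is
   measurable. *)
Definition equal_in_law (R : realType) (d d' e : measure_display)
    (T : measurableType d) (T' : measurableType d') (E : measurableType e)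
    (P : probability T R) (X : int -> T -> E)
    (P' : probability T' R) (X' : int -> T' -> E) : Prop :=
  forall A : set (int -> E), product_sigma A ->
    P [set t | A (fun i => X i t)] = P' [set t | A (fun i => X' i t)].

Definition stationary (R : realType) (d e : measure_display)
    (T : measurableType d) (E : measurableType e)
    (P : probability T R) (X : int -> {RV P >-> E}) : Prop :=
  equal_in_law P X P (fun i => X (i + 1)).

Definition reversible (R : realType) (d e : measure_display)
    (T : measurableType d) (E : measurableType e)
    (P : probability T R) (X : int -> {RV P >-> E}) : Prop :=
  equal_in_law P X P (fun i => X (- i)).

Definition k_dependent (R : realType) (d e : measure_display)
    (T : measurableType d) (E : measurableType e)
    (P : probability T R) (k : nat) (X : int -> {RV P >-> E}) : Prop :=
  forall (i : int) (A B : set T),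
    sigma_generated X [set j | j < i] A ->
    sigma_generated X [set j | i + k%:Z <= j] B ->
    P (A `&` B) = (P A * P B)%E.

Definition palette (q : nat) : set nat := [set c | (1 <= c <= q)%N].

Definition coloring (R : realType) (d : measure_display)
    (T : measurableType d) (P : probability T R) (q : nat)
    (X : int -> {RV P >-> nat}) : Prop :=
  (forall i t, palette q (X i t)) /\
  {ae P, forall t, forall i, X i t <> X (i + 1) t}.

(* A permutation of the palette is represented by a map nat -> nat; its values
   outside the palette are irrelevant. *)
Definition color_symmetric (R : realType) (d : measure_display)
    (T : measurableType d) (P : probability T R) (q : nat)
    (X : int -> {RV P >-> nat}) : Prop :=
  forall s : nat -> nat, set_bij (palette q) (palette q) s ->
    equal_in_law P X P (fun i t => s (X i t)).

Definition iid_with_law (R : realType) (d e : measure_display)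
    (T : measurableType d) (E : measurableType e)
    (P : probability T R) (Z : int -> {RV P >-> E})
    (mu : set E -> \bar R) : Prop :=
  (forall (J : {fset int}) (A : int -> set E), (forall i, measurable (A i)) ->
     P (\bigcap_(i in [set` J]) (Z i @^-1` A i)) =
     (\prod_(i <- J) P (Z i @^-1` A i))%E) /\
  (forall (i : int) (A : set E), measurable A ->
     distribution P (Z i) A = mu A).

Definition iid_fair_bits (R : realType) (d : measure_display)
    (T : measurableType d) (P : probability T R)
    (B : int -> {RV P >-> bool}) : Prop :=
  iid_with_law B (bernoulli_prob (2^-1 : R)).

Definition iid_uniform01 (R : realType) (d : measure_display)
    (T : measurableType d) (P : probability T R)
    (U : int -> {RV P >-> R}) : Prop :=
  iid_with_law U (uniform_prob (@ltr01 R)).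

(* (X_1, ..., X_n) *)
Definition window (R : realType) (d : measure_display)
    (T : measurableType d) (P : probability T R)
    (X : int -> {RV P >-> nat}) (n : nat) (t : T) : n.-tuple nat :=
  [tuple X (i.+1 : int) t | i < n].

(* Inverse is total on \bar R (0^-1 = +oo); only used when P C > 0. *)
Definition cond_prob (R : realType) (d : measure_display)
    (T : measurableType d) (P : probability T R) (C A : set T) : \bar R :=
  (P (A `&` C) / P C)%E.

(* Main.v *)
From HB Require Import structures.
Require Import Defs.
From mathcomp Require Import all_boot all_order all_algebra finmap.
From mathcomp Require Import all_classical all_reals all_analysis.
From mathcomp Require Import measurable_realfun.
From mathcomp Require Import zify ring lra.
Import Order.TTheory GRing.Theory Num.Theory.
Import numFieldNormedType.Exports.
Local Open Scope classical_set_scope.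
Local Open Scope ring_scope.

(** Both processes come from one counting function.  For a proper word x (no two
    equal neighbours), [buildings x] counts the orders in which x can be built
    letter by letter with every intermediate word proper, so it satisfies
    buildings x = sum over the one-letter deletions y of x of buildings y.  The
    law of X (resp. Y) on a window is proportional to [buildings] over 4 (resp. 3)
    letters; [weight] is the normalized function.

    Three identities, each proved by induction through the deletion recursion,
    carry the construction.  Summing over one appended letter multiplies
    [buildings x] by n (q - 2) + q ([sum_buildings_rcons]), so the window laws are
    consistent.  For q = 4, summing over one letter inserted between x and y gives
    a constant times buildings x * buildings y ([sum_buildings_gap1]), which is
    1-dependence; for q = 3, summing over two inserted letters does the same
    ([sum_buildings_gap2]), which is 2-dependence.  Reversal and permutation of the
    letters preserve [buildings], hence (i); and for a word over 3 letters the two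
    weights differ by a factor depending only on its length, hence (v).

    The processes live on the unit interval: a consistent weight on words splits
    it into nested subintervals of prescribed lengths, and the successive choices
    of subinterval spell a random word ([digits_word]).  Letters are pairs, so that
    one step extends the window at both ends ([word_law_exists]).  Weights 2^-n give
    fair bits, and regrouping these bits gives i.i.d. uniform variables.

    Properties (ii)-(iv) compare two 0/1 processes.  The law of such a process is
    determined by the probabilities that it equals 1 on a finite set, and when it is
    k-dependent these factor over clusters with gaps at most k
    ([cluster_law_unique]), so only the clusters have to be computed.
    - (ii): a cluster of two adjacent sites has probability 0 on both sides, so only
      the density matters.  In a 1-dependent process without adjacent ones the
      probability u_n of no one among n sites satisfies u_(n+2) = u_(n+1) - p u_n,
      which stays nonnegative only if p <= 1/4 ([density_le_quarter]); four colors
      whose densities add up to 1 must then all have density 1/4.  The argument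
      applies to every stationary 1-dependent 4-coloring, which is the last claim.
    - (iii): a run of n sites has probability 1/(n+1)! on both sides; for X the sum
      over words in two letters is the appending identity with q = 2.
    - (iv): the clusters are k sites at distance 2, and both probabilities solve
      (2k + 1) t_k = sum over i + j = k - 1 of t_i t_j with t_0 = 1: for Y one
      deletes one of the letters 1 and uses 2-dependence ([peak_weightS]); for the
      uniform variables one conditions on the position of the maximum
      ([probability_zigzagS]). *)

Set Implicit Arguments.
Unset Strict Implicit.
Unset Printing Implicit Defensive.

(** * Counting buildings of a word *)

Section Words.
Local Open Scope nat_scope.

Definition proper_word (x : seq nat) : bool := sorted (fun a b => a != b) x.

Fixpoint deletions (T : Type) (x : seq T) : seq (seq T) :=
  if x is a :: x' then x' :: map (cons a) (deletions x') else [::].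

Fixpoint buildings_rec (n : nat) (x : seq nat) : nat :=
  if n is m.+1 then
    if proper_word x then \sum_(y <- deletions x) buildings_rec m y else 0
  else 1.

Definition buildings (x : seq nat) : nat := buildings_rec (size x) x.

Lemma size_deletions (T : eqType) (x y : seq T) :
  y \in deletions x -> (size y).+1 = size x.
Proof.
elim: x y => [//|a x IH] y /=; rewrite inE => /orP[/eqP -> //|].
by case/mapP => z /IH <- ->.
Qed.

Lemma deletions_subset (T : eqType) (x y : seq T) :
  y \in deletions x -> {subset y <= x}.
Proof.
elim: x y => [//|a x IHx] y /=; rewrite inE => /orP[/eqP ->|].
  by move=> z zx; rewrite inE zx orbT.
by case/mapP => z /IHx zx -> w; rewrite !inE => /orP[->//|/zx ->]; rewrite orbT.
Qed.

Lemma buildings_recS (n : nat) (x : seq nat) : buildings_rec n.+1 x =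
  if proper_word x then \sum_(y <- deletions x) buildings_rec n y else 0.
Proof. by []. Qed.

Lemma buildings_nil : buildings [::] = 1. Proof. by []. Qed.

Lemma buildings_proper (x : seq nat) : x != [::] -> proper_word x ->
  buildings x = \sum_(y <- deletions x) buildings y.
Proof.
case: x => [//|a x] _ px; rewrite /buildings buildings_recS px.
rewrite big_seq [RHS]big_seq; apply: eq_bigr => y /size_deletions [->] //.
Qed.

Lemma buildings1 (a : nat) : buildings [:: a] = 1.
Proof. by rewrite /buildings /= big_seq1. Qed.

Lemma buildings_improper (x : seq nat) : ~~ proper_word x -> buildings x = 0.
Proof. by case: x => [//|a x] /negbTE px; rewrite /buildings buildings_recS px. Qed.

Lemma proper_word_cat (u v : seq nat) (c : nat) :
  proper_word (u ++ c :: v) = proper_word (rcons u c) && proper_word (c :: v).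
Proof.
rewrite /proper_word; case: u => [//|b u] /=.
by rewrite cat_path rcons_path /= andbA.
Qed.

Lemma proper_word_glue (u v : seq nat) (c d : nat) :
  proper_word (rcons u c ++ d :: v) =
  [&& proper_word (rcons u c), c != d & proper_word (d :: v)].
Proof. by rewrite cat_rcons proper_word_cat. Qed.

Lemma buildings_repeat (u v : seq nat) (c : nat) :
  buildings (u ++ c :: c :: v) = 0.
Proof.
by rewrite buildings_improper // proper_word_cat /= eqxx andbF.
Qed.

Lemma buildings_repeat_rcons (u v : seq nat) (c : nat) :
  buildings (rcons u c ++ c :: v) = 0.
Proof. by rewrite cat_rcons buildings_repeat. Qed.

Arguments deletions : simpl never.

Lemma deletions_cons (T : Type) (a : T) (x : seq T) :
  deletions (a :: x) = x :: map (cons a) (deletions x).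
Proof. by []. Qed.

Section DeletionSums.
Variables (T : Type).
Implicit Types (x y : seq T) (f : seq T -> nat).

Lemma sum_deletions_cons a x f : \sum_(z <- deletions (a :: x)) f z =
  f x + \sum_(z <- deletions x) f (a :: z).
Proof. by rewrite /deletions big_cons big_map. Qed.

Lemma sum_deletions_cat x y f : \sum_(z <- deletions (x ++ y)) f z =
  \sum_(z <- deletions x) f (z ++ y) + \sum_(z <- deletions y) f (x ++ z).
Proof.
elim: x f => [|a x IH] f /=; first by rewrite big_nil.
by rewrite !sum_deletions_cons IH addnA.
Qed.

Lemma sum_deletions_rcons x a f : \sum_(z <- deletions (rcons x a)) f z =
  \sum_(z <- deletions x) f (rcons z a) + f x.
Proof.
rewrite -cats1 sum_deletions_cat /= big_seq1 cats0; congr (_ + _).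
by apply: eq_bigr => z _; rewrite cats1.
Qed.

Lemma sum_deletions_rev x f :
  \sum_(z <- deletions (rev x)) f z = \sum_(z <- deletions x) f (rev z).
Proof.
elim: x f => [|a x IH] f; first by rewrite !big_nil.
rewrite rev_cons sum_deletions_rcons sum_deletions_cons IH addnC; congr (_ + _).
by apply: eq_bigr => z _; rewrite rev_cons.
Qed.

End DeletionSums.

Lemma deletions_map (T T' : Type) (s : T -> T') (x : seq T) :
  deletions (map s x) = map (map s) (deletions x).
Proof.
elim: x => [//|a x IH]; rewrite /deletions /= -/deletions IH -!map_comp; congr (_ :: _).
Qed.

Lemma proper_word_rev (x : seq nat) : proper_word (rev x) = proper_word x.
Proof.
by rewrite /proper_word rev_sorted; apply: eq_sorted => a b; rewrite eq_sym.
Qed.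

Lemma buildings_rev (x : seq nat) : buildings (rev x) = buildings x.
Proof.
move: {2}(size x) (erefl (size x)) => n; elim: n x => [[|? ?] //|n IH] x sx.
have [px|px] := boolP (proper_word x); last first.
  by rewrite !buildings_improper // proper_word_rev.
rewrite !buildings_proper ?proper_word_rev //; first last.
- by rewrite -size_eq0 size_rev sx.
- by rewrite -size_eq0 sx.
rewrite sum_deletions_rev big_seq [RHS]big_seq; apply: eq_bigr => y /size_deletions.
by rewrite sx => -[/IH].
Qed.

Lemma buildings_map (s : nat -> nat) (x : seq nat) :
  {in x &, injective s} -> buildings (map s x) = buildings x.
Proof.
move: {2}(size x) (erefl (size x)) => n; elim: n x => [[|? ?] //|n IH] x sx sI.
have pE : proper_word (map s x) = proper_word x.
  rewrite /proper_word sorted_map; apply: (@eq_in_sorted _ (mem x)); last exact/allP.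
  by move=> a b ax bx /=; rewrite (inj_in_eq sI).
have [px|px] := boolP (proper_word x); last by rewrite !buildings_improper ?pE.
rewrite !buildings_proper ?pE //; first last.
- by rewrite -size_eq0 size_map sx.
- by rewrite -size_eq0 sx.
rewrite deletions_map big_map big_seq [RHS]big_seq; apply: eq_bigr => y yx.
apply: IH; first by move/size_deletions: (yx); rewrite sx => -[].
by move=> a b /(deletions_subset yx) ax /(deletions_subset yx) bx; exact: sI.
Qed.

Definition letters (q : nat) : seq nat := iota 1 q.

Lemma sum_letters_eq (q c : nat) (k : nat) : c \in letters q ->
  \sum_(a <- letters q) k * (a == c) = k.
Proof.
move=> cq; rewrite -big_distrr /= (_ : \sum_(a <- _) _ = 1) ?muln1 //.
rewrite (bigD1_seq c) //= ?iota_uniq // eqxx big1 //.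
by move=> i /negbTE ->.
Qed.

Lemma sum_letters_const (q : nat) (k : nat) : \sum_(a <- letters q) k = q * k.
Proof. by rewrite big_const_seq count_predT size_iota iter_addn_0 mulnC. Qed.

Lemma sum_deletions_congr (q : nat) (x : seq nat) (f : seq nat -> nat) g:
  {in deletions x, forall y, all (mem (letters q)) y -> f y = g y} ->
  all (mem (letters q)) x ->
  \sum_(y <- deletions x) f y = \sum_(y <- deletions x) g y.
Proof.
move=> fg xq; rewrite big_seq [RHS]big_seq; apply: eq_bigr => y yx; apply: fg => //.
by apply/allP => a /(deletions_subset yx); exact/allP.
Qed.

(** Holds for every a, also when x a is improper: if a = c the left side is
    2 buildings x, and on the right the only surviving deletion is that of the last
    letter of x, which restores x.  The correction term lets one sum over all a. *)
Lemma buildings_rcons_pointwise (u : seq nat) (c a : nat) :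
  let x := rcons u c in proper_word x ->
  buildings (rcons x a) + 2 * buildings x * (a == c) =
  buildings x + \sum_(y <- deletions x) buildings (rcons y a).
Proof.
move=> x px; have [->|ac] := eqVneq a c; last first.
  rewrite muln0 addn0 buildings_proper.
  - by rewrite sum_deletions_rcons addnC.
  - by rewrite -size_eq0 size_rcons.
  - by rewrite -cats1 proper_word_glue px eq_sym ac.
rewrite -{1}cats1 buildings_repeat_rcons muln1 mul2n -addnn.
rewrite sum_deletions_rcons big1 // => y _.
by rewrite -cats1 buildings_repeat_rcons.
Qed.

(** Number by which appending a letter to a word of length n multiplies
    the count. *)
Definition growth (q n : nat) : nat := n * (q - 2) + q.

(** Summing the pointwise identity over a: deleting a letter of x first
    leaves the same kind of sum for a shorter word, and the correction takes away
    2 buildings x. *)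
Lemma sum_buildings_rcons (q : nat) (x : seq nat) : 2 <= q ->
  all (mem (letters q)) x ->
  \sum_(a <- letters q) buildings (rcons x a) = growth q (size x) * buildings x.
Proof.
move=> q2.
move: {2}(size x) (erefl (size x)) => n; elim: n x => [|n IH] x sx xq.
  move/eqP: sx; rewrite size_eq0 => /eqP ->; rewrite /growth mul0n add0n muln1.
  under eq_bigr do rewrite /= buildings1.
  by rewrite sum_letters_const muln1.
have [px|px] := boolP (proper_word x); last first.
  rewrite [X in _ * X]buildings_improper // muln0 big1 // => a _.
  apply: buildings_improper; apply: contra px.
  by case: (x) => [//|b y]; rewrite /proper_word /= rcons_path => /andP[].
case/lastP: x sx px xq => [//|u c] sx px xq.
set x := rcons u c in sx px xq *.
have cq : c \in letters q by move/allP: xq; apply; rewrite mem_rcons mem_head.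
(* The correction is added to both sides, to use the identity for every a. *)
apply: (@addIn (2 * buildings x)).
rewrite -{1}(@sum_letters_eq q c (2 * buildings x)) // -big_split /=.
rewrite (eq_bigr (fun a => buildings x +
   \sum_(y <- deletions x) buildings (rcons y a))); last first.
  by move=> a _; exact: buildings_rcons_pointwise.
rewrite big_split /= sum_letters_const exchange_big /=.
rewrite (sum_deletions_congr (q := q) (g := fun y => growth q n * buildings y)) //; last first.
  by move=> y /size_deletions; rewrite sx => -[sy] yq; rewrite (IH _ sy yq) sy.
rewrite -big_distrr /= -buildings_proper //; last by rewrite -size_eq0 sx.
rewrite /growth; nia.
Qed.

Lemma sum_buildings_cons (q : nat) (x : seq nat) : 2 <= q ->
  all (mem (letters q)) x ->
  \sum_(a <- letters q) buildings (a :: x) = growth q (size x) * buildings x.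
Proof.
move=> q2 xq; rewrite -size_rev -(buildings_rev x) -(@sum_buildings_rcons q) ?all_rev //.
by apply: eq_bigr => a _; rewrite -rev_cons buildings_rev.
Qed.

(** Same mechanism as for appending: a letter a equal to c or d makes the
    word improper, and then exactly two deletions, both leaving x y, survive on the
    right.  If c = d, then x y is improper as well and everything vanishes. *)
Lemma buildings_gap1_pointwise (u v : seq nat) (c d a : nat) :
  let x := rcons u c in let y := d :: v in
  proper_word x -> proper_word y ->
  buildings (x ++ a :: y) + 2 * buildings (x ++ y) * (a == c)
                          + 2 * buildings (x ++ y) * (a == d) =
  buildings (x ++ y) + \sum_(z <- deletions x) buildings (z ++ a :: y)
                     + \sum_(z <- deletions y) buildings (x ++ a :: z).
Proof.
move=> x y px py.
have [->|ac] := eqVneq a c.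
  rewrite buildings_repeat_rcons sum_deletions_rcons big1; last first.
    by move=> z _; rewrite buildings_repeat_rcons.
  rewrite [X in _ = _ + X]big1; last by move=> z _; rewrite buildings_repeat_rcons.
  rewrite /x cat_rcons /y; case: (eqVneq c d) => [->|_].
    by rewrite buildings_repeat; lia.
  by rewrite muln1 muln0; lia.
have [->|ad] := eqVneq a d.
  have -> : buildings (x ++ d :: y) = 0 by rewrite buildings_repeat.
  rewrite big1; last by move=> z _; rewrite buildings_repeat.
  rewrite sum_deletions_cons big1; last by move=> z _; rewrite buildings_repeat.
  rewrite /x cat_rcons /y; have [<-|_] := eqVneq d c; first by rewrite buildings_repeat; lia.
  by rewrite muln1 muln0; lia.
rewrite buildings_proper ?sum_deletions_cat ?sum_deletions_cons //.
- by rewrite ?muln0; lia.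
- by rewrite -size_eq0 size_cat /= addnS.
- by rewrite proper_word_glue px eq_sym ac /= ad.
Qed.

(** With four letters the corrections cancel the sum of buildings (x y) over
    the inserted letter, and the two deletion sums follow the Pascal rule. *)
Lemma sum_buildings_gap1 (x y : seq nat) :
  all (mem (letters 4)) x -> all (mem (letters 4)) y ->
  \sum_(a <- letters 4) buildings (x ++ a :: y) =
  2 * 'C(size x + size y + 2, (size x).+1) * (buildings x * buildings y).
Proof.
have [n] := ubnP (size x + size y); elim: n x y => // n IH x y.
case/lastP: x => [|u c] lt_n xq yq.
  rewrite sum_buildings_cons // /growth /= buildings_nil bin1; lia.
case: y lt_n yq => [|d v] lt_n yq.
  under eq_bigr => a _ do rewrite cats1.
  rewrite sum_buildings_rcons // /growth /= addn0 buildings_nil addn2 binSn.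
  lia.
set x := rcons u c in lt_n xq *; set y := d :: v in lt_n yq *.
have [px|px] := boolP (proper_word x); last first.
  rewrite (buildings_improper px) mul0n muln0 big1 // => a _.
  by apply: buildings_improper; rewrite proper_word_glue (negbTE px).
have [py|py] := boolP (proper_word y); last first.
  rewrite (buildings_improper py) !muln0 big1 // => a _.
  rewrite buildings_improper // proper_word_cat negb_and; apply/orP; right.
  by apply: contra py => /= /andP[].
have cq : c \in letters 4 by move/allP: xq; apply; rewrite mem_rcons mem_head.
have dq : d \in letters 4 by move/allP: yq; apply; rewrite mem_head.
set b := buildings (x ++ y).
apply: (@addIn (2 * b + 2 * b)).
have E2 : \sum_(a <- letters 4) 2 * b * (a == c)
          + \sum_(a <- letters 4) 2 * b * (a == d) = 2 * b + 2 * b.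
  by rewrite !sum_letters_eq.
rewrite -{1}E2 -!big_split /=.
rewrite (eq_bigr (fun a => b + \sum_(z <- deletions x) buildings (z ++ a :: y)
   + \sum_(z <- deletions y) buildings (x ++ a :: z))); last first.
  by move=> a _; rewrite addnA; exact: buildings_gap1_pointwise.
rewrite !big_split /= sum_letters_const [X in _ + X + _]exchange_big /=.
rewrite [X in _ + X = _]exchange_big /=.
have sx : size x = (size u).+1 by rewrite size_rcons.
rewrite (sum_deletions_congr (q := 4) (g := fun z =>
    2 * 'C(size u + size y + 2, (size u).+1) * (buildings z * buildings y))) //;
  last first.
  move=> z zx zq; move/size_deletions: zx; rewrite sx => -[sz].
  by rewrite IH ?sz //; move: lt_n; rewrite sx; lia.
rewrite [X in _ + X = _](sum_deletions_congr (q := 4) (g := fun z =>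
    2 * 'C(size x + size v + 2, (size x).+1) * (buildings x * buildings z))) //;
  last first.
  move=> z zx zq; move/size_deletions: zx => -[sz].
  by rewrite IH ?sz //; move: lt_n => /=; lia.
rewrite -big_distrr -big_distrl /= -buildings_proper //; last by rewrite -size_eq0 sx.
rewrite -!big_distrr /= -buildings_proper // sx.
rewrite (_ : (size u).+1 + (size v).+1 + 2 = (size u + (size v).+1 + 2).+1); last lia.
rewrite binS (_ : (size u).+1 + size v = size u + (size v).+1); last lia.
lia.
Qed.

(** Each of the coincidences a = b, a = c, b = d makes x a b y improper, and
    then two deletions leaving the same word survive; when two of them hold at once
    every term is zero. *)
Lemma buildings_gap2_pointwise (u v : seq nat) (c d a b : nat) :
  let x := rcons u c in let y := d :: v in
  proper_word x -> proper_word y ->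
  buildings (x ++ a :: b :: y) + 2 * buildings (x ++ a :: y) * (b == a)
    + 2 * buildings (x ++ b :: y) * (a == c)
    + 2 * buildings (x ++ a :: y) * (b == d) =
  buildings (x ++ b :: y) + buildings (x ++ a :: y)
    + \sum_(z <- deletions x) buildings (z ++ a :: b :: y)
    + \sum_(z <- deletions y) buildings (x ++ a :: b :: z).
Proof.
move=> x y px py.
have [->{b}|ab] := eqVneq b a.
  rewrite buildings_repeat.
  rewrite big1; last by move=> z _; rewrite buildings_repeat.
  rewrite big1; last by move=> z _; rewrite buildings_repeat.
  case: (eqVneq a c) => [->|_]; first by rewrite buildings_repeat_rcons.
  case: (eqVneq a d) => [->|_]; first by rewrite buildings_repeat; lia.
  lia.
have [eac|ac] := eqVneq a c.
  rewrite eac in ab *; rewrite !buildings_repeat_rcons.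
  rewrite [X in _ = _ + X]big1; last by move=> z _; rewrite buildings_repeat_rcons.
  rewrite sum_deletions_rcons big1; last by move=> z _; rewrite buildings_repeat_rcons.
  have -> : u ++ c :: b :: y = x ++ b :: y by rewrite /x cat_rcons.
  lia.
have [ebd|bd] := eqVneq b d.
  rewrite ebd in ab *.
  have r z w : buildings (z ++ a :: d :: d :: w) = 0.
    by rewrite -cat_rcons buildings_repeat.
  rewrite r buildings_repeat big1; last by move=> z _; rewrite r.
  by rewrite sum_deletions_cons big1 /y; [lia|move=> z _; rewrite r].
rewrite buildings_proper ?sum_deletions_cat ?sum_deletions_cons //.
- by rewrite ?muln0; lia.
- by rewrite -size_eq0 size_cat /= addnS.
- by rewrite proper_word_glue px eq_sym ac /= bd eq_sym ab.
Qed.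

(** With three letters the corrections cancel the two sums in which one
    inserted letter is deleted, and the rest is again the Pascal rule. *)
Lemma sum_buildings_gap2 (x y : seq nat) :
  all (mem (letters 3)) x -> all (mem (letters 3)) y ->
  \sum_(a <- letters 3) \sum_(b <- letters 3) buildings (x ++ a :: b :: y) =
  2 * 'C(size x + size y + 4, (size x).+2) * (buildings x * buildings y).
Proof.
have [n] := ubnP (size x + size y); elim: n x y => // n IH x y.
have binS2 m : 2 * 'C(m + 4, 2) = (m + 4) * (m + 3).
  by rewrite -mul_bin_diag !addnS addn0 bin1.
case/lastP: x => [|u c] lt_n xq yq.
  rewrite exchange_big /=.
  under eq_big_seq => b bq.
    rewrite sum_buildings_cons //=; last by rewrite bq yq.
    over.
  rewrite -big_distrr /= sum_buildings_cons // /growth add0n binS2 buildings_nil.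
  lia.
case: y lt_n yq => [|d v] lt_n yq.
  under eq_big_seq => a aq.
    under eq_bigr => b _ do rewrite -cat_rcons cats1.
    rewrite sum_buildings_rcons //; last by rewrite all_rcons /= aq xq.
    rewrite size_rcons; over.
  rewrite -big_distrr /= sum_buildings_rcons // /growth /= addn0 buildings_nil.
  set m := size _; have -> : 'C(m + 4, m.+2) = 'C(m + 4, 2).
    by rewrite -bin_sub; [congr ('C(_, _)); lia|lia].
  by rewrite binS2; lia.
set x := rcons u c in lt_n xq *; set y := d :: v in lt_n yq *.
have [px|px] := boolP (proper_word x); last first.
  rewrite (buildings_improper px) mul0n muln0 big1 // => a _; rewrite big1 // => b _.
  by apply: buildings_improper; rewrite proper_word_glue (negbTE px).
have [py|py] := boolP (proper_word y); last first.
  rewrite (buildings_improper py) !muln0 big1 // => a _; rewrite big1 // => b _.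
  rewrite buildings_improper // proper_word_cat negb_and; apply/orP; right.
  by apply: contra py => /= /andP[_ /andP[]].
have cq : c \in letters 3 by move/allP: xq; apply; rewrite mem_rcons mem_head.
have dq : d \in letters 3 by move/allP: yq; apply; rewrite mem_head.
set S := \sum_(a <- letters 3) buildings (x ++ a :: y).
have S1 : \sum_(a <- letters 3) \sum_(b <- letters 3)
    2 * buildings (x ++ a :: y) * (b == a) = 2 * S.
  rewrite /S big_distrr; apply: eq_big_seq => a aq /=.
  by rewrite sum_letters_eq.
have S2 : \sum_(a <- letters 3) \sum_(b <- letters 3)
    2 * buildings (x ++ b :: y) * (a == c) = 2 * S.
  rewrite exchange_big /S big_distrr; apply: eq_big_seq => a aq /=.
  by rewrite sum_letters_eq.
have S3 : \sum_(a <- letters 3) \sum_(b <- letters 3)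
    2 * buildings (x ++ a :: y) * (b == d) = 2 * S.
  rewrite /S big_distrr; apply: eq_big_seq => a aq /=.
  by rewrite sum_letters_eq.
apply: (@addIn (2 * S + 2 * S + 2 * S)).
have E3 := congr2 addn (congr2 addn S1 S2) S3.
rewrite -{1}E3 -!big_split /=.
rewrite (eq_bigr (fun a => \sum_(b <- letters 3) (buildings (x ++ b :: y)
    + buildings (x ++ a :: y)
    + \sum_(z <- deletions x) buildings (z ++ a :: b :: y)
    + \sum_(z <- deletions y) buildings (x ++ a :: b :: z)))); last first.
  move=> a _; rewrite -!big_split /=; apply: eq_bigr => b _; rewrite !addnA.
  exact: buildings_gap2_pointwise.
under eq_bigr do rewrite !big_split /= sum_letters_const.
rewrite !big_split /= sum_letters_const -/S big1_eq.
under [X in _ + X + _]eq_bigr do rewrite exchange_big /=.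
under [X in _ + X = _]eq_bigr do rewrite exchange_big /=.
rewrite [X in _ + X + _]exchange_big [X in _ + X = _]exchange_big /=.
have sx : size x = (size u).+1 by rewrite size_rcons.
rewrite (sum_deletions_congr (q := 3) (g := fun z =>
    2 * 'C(size u + size y + 4, (size u).+2) * (buildings z * buildings y))) //;
  last first.
  move=> z zx zq; move/size_deletions: zx; rewrite sx => -[sz].
  by rewrite IH ?sz //; move: lt_n; rewrite sx; lia.
rewrite [X in _ + X = _](sum_deletions_congr (q := 3) (g := fun z =>
    2 * 'C(size x + size v + 4, (size x).+2) * (buildings x * buildings z))) //;
  last first.
  move=> z zx zq; move/size_deletions: zx => -[sz].
  by rewrite IH ?sz //; move: lt_n => /=; lia.
rewrite -big_distrr -big_distrl /= -buildings_proper //; last by rewrite -size_eq0 sx.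
rewrite -!big_distrr /= -buildings_proper // sx.
rewrite (_ : (size u).+1 + (size v).+1 + 4 = (size u + (size v).+1 + 4).+1); last lia.
rewrite binS (_ : (size u).+1 + size v = size u + (size v).+1); last lia.
lia.
Qed.

(** * Sums over words and normalized weights *)

Fixpoint words (A : Type) (s : seq A) (n : nat) : seq (seq A) :=
  if n is m.+1 then [seq a :: x | a <- s, x <- words s m] else [:: [::]].

Lemma mem_words (A : eqType) (s : seq A) (n : nat) (x : seq A) :
  (x \in words s n) = (size x == n) && all (mem s) x.
Proof.
elim: n x => [|n IH] [|a x] //=; first by apply/allpairsP => -[[]] ? ? [].
rewrite eqSS; apply/allpairsP/idP => [[[b y] /= [bs]]|].
  by rewrite IH => /andP[sy ys] [-> ->]; rewrite sy bs ys.
by case/and3P => sx ax xs; exists (a, x); rewrite /= IH sx.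
Qed.

Lemma words_uniq (A : eqType) (s : seq A) (n : nat) : uniq s -> uniq (words s n).
Proof.
move=> us; elim: n => [//|n IH] /=.
by apply: allpairs_uniq => // -[a x] [b y] _ _ /= [-> ->].
Qed.

Arguments words : simpl never.

Section SumWords.
Variables (A : Type) (s : seq A) (V : nmodType).
Implicit Types (f : seq A -> V).
Local Open Scope ring_scope.

Lemma sum_wordsS n f :
  \sum_(x <- words s n.+1) f x = \sum_(a <- s) \sum_(x <- words s n) f (a :: x).
Proof. by rewrite big_allpairs_dep. Qed.

Lemma sum_words0 f : \sum_(x <- words s 0) f x = f [::].
Proof. exact: big_seq1. Qed.

Lemma sum_words_cat m n f : \sum_(x <- words s (m + n)) f x =
  \sum_(x <- words s m) \sum_(y <- words s n) f (x ++ y).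
Proof.
elim: m f => [|m IH] f; first by rewrite sum_words0.
rewrite addSn !sum_wordsS; apply: eq_bigr => a _; exact: IH.
Qed.

Lemma sum_words_rcons n f :
  \sum_(x <- words s n.+1) f x = \sum_(x <- words s n) \sum_(a <- s) f (rcons x a).
Proof.
rewrite -addn1 sum_words_cat; apply: eq_bigr => x _.
by rewrite sum_wordsS; apply: eq_bigr => a _; rewrite sum_words0 cats1.
Qed.

End SumWords.

(** Total number of buildings of all words of length n over q letters. *)
Definition total_buildings (q n : nat) : nat := \prod_(m < n) growth q m.

Lemma growth2 n : growth 2 n = 2. Proof. by rewrite /growth muln0. Qed.
Lemma growth3 n : growth 3 n = n + 3. Proof. by rewrite /growth muln1. Qed.
Lemma growth4 n : growth 4 n = 2 * n.+2. Proof. by rewrite /growth; lia. Qed.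

Lemma total_buildings_gt0 (q n : nat) : 0 < q -> 0 < total_buildings q n.
Proof. by move=> q0; apply: prodn_gt0 => i; rewrite /growth addn_gt0 q0 orbT. Qed.

Lemma total_buildingsS (q n : nat) : total_buildings q n.+1 = total_buildings q n * growth q n.
Proof. by rewrite /total_buildings big_ord_recr. Qed.

Lemma total_buildings2 (n : nat) : total_buildings 2 n = 2 ^ n.
Proof.
elim: n => [|n IH]; first by rewrite /total_buildings big_ord0.
by rewrite total_buildingsS IH expnS growth2 mulnC.
Qed.

Lemma total_buildings4 (n : nat) : total_buildings 4 n = 2 ^ n * (n.+1)`!.
Proof.
elim: n => [|n IH]; first by rewrite /total_buildings big_ord0.
by rewrite total_buildingsS IH expnS [in RHS]factS growth4; lia.
Qed.

Lemma total_buildings3 (n : nat) : 2 * total_buildings 3 n = (n.+2)`!.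
Proof.
elim: n => [|n IH]; first by rewrite /total_buildings big_ord0.
by rewrite total_buildingsS mulnA IH [in RHS]factS growth3; lia.
Qed.

Lemma letters_uniq (q : nat) : uniq (letters q). Proof. exact: iota_uniq. Qed.

Section Weight.
Variable R : numFieldType.
Local Open Scope ring_scope.

Definition weight (q : nat) (x : seq nat) : R :=
  if all (mem (letters q)) x then (buildings x)%:R / (total_buildings q (size x))%:R
  else 0.

Lemma total_buildings_neq0 q n : (0 < q)%N -> (total_buildings q n)%:R != 0 :> R.
Proof. by move=> q0; rewrite pnatr_eq0 -lt0n total_buildings_gt0. Qed.

Lemma weight_ge0 q x : 0 <= weight q x.
Proof. by rewrite /weight; case: ifP => // _; rewrite divr_ge0. Qed.

Lemma weight_nil q : weight q [::] = 1.
Proof. by rewrite /weight /= /total_buildings big_ord0 divr1. Qed.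

Lemma weight_repeat q u c v : weight q (u ++ c :: c :: v) = 0.
Proof. by rewrite /weight buildings_repeat mul0r; case: ifP. Qed.

Lemma weight_outside q x : ~~ all (mem (letters q)) x -> weight q x = 0.
Proof. by rewrite /weight => /negbTE ->. Qed.

Lemma weight_rev q x : weight q (rev x) = weight q x.
Proof. by rewrite /weight all_rev size_rev buildings_rev. Qed.

Lemma weight_map q s x : {in letters q &, injective s} ->
  {in letters q, forall a, s a \in letters q} ->
  all (mem (letters q)) x -> weight q (map s x) = weight q x.
Proof.
move=> sI sq xq; rewrite /weight all_map size_map xq.
have -> : all (preim s (mem (letters q))) x.
  by apply/allP => a ax; apply: sq; exact: (allP xq).
by rewrite buildings_map // => a b /(allP xq) aq /(allP xq) bq; exact: sI.
Qed.

Lemma sum_weight_rcons q x : (2 <= q)%N ->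
  \sum_(a <- letters q) weight q (rcons x a) = weight q x.
Proof.
move=> q2; have [xq|xq] := boolP (all (mem (letters q)) x); last first.
  rewrite weight_outside // big1 // => a _; rewrite weight_outside //.
  by rewrite all_rcons negb_and xq orbT.
have g0 : (growth q (size x))%:R != 0 :> R.
  by rewrite pnatr_eq0 -lt0n /growth addn_gt0 orbC (ltnW q2).
have n0 : (total_buildings q (size x))%:R != 0 :> R.
  by apply: total_buildings_neq0; lia.
rewrite {2}/weight xq.
transitivity ((\sum_(a <- letters q) buildings (rcons x a))%:R /
              (total_buildings q (size x).+1)%:R : R).
  rewrite natr_sum mulr_suml; apply: eq_big_seq => a aq.
  by rewrite /weight all_rcons /= aq xq size_rcons.
rewrite sum_buildings_rcons // total_buildingsS !natrM; field.
by rewrite n0 g0.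
Qed.

Lemma sum_weight_cons q x : (2 <= q)%N ->
  \sum_(a <- letters q) weight q (a :: x) = weight q x.
Proof.
move=> q2; rewrite -weight_rev -(sum_weight_rcons _ q2).
by apply: eq_bigr => a _; rewrite -rev_cons weight_rev.
Qed.

Lemma sum_weight_words q n : (2 <= q)%N ->
  \sum_(x <- words (letters q) n) weight q x = 1.
Proof.
move=> q2; elim: n => [|n IH]; first by rewrite sum_words0 weight_nil.
by rewrite sum_words_rcons -[RHS]IH; apply: eq_bigr => x _; exact: sum_weight_rcons.
Qed.

Lemma letters_sub p q a : (p <= q)%N -> a \in letters p -> a \in letters q.
Proof. by rewrite !mem_iota; lia. Qed.

(** Since [buildings] does not know the alphabet, weights over two alphabets
    differ by a factor depending only on the length. *)
Lemma weight_change p q x : (0 < p <= q)%N -> all (mem (letters p)) x ->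
  weight q x = (total_buildings p (size x))%:R / (total_buildings q (size x))%:R * weight p x.
Proof.
move=> /andP[p0 pq] xp; rewrite /weight xp.
have -> : all (mem (letters q)) x.
  by apply: sub_all xp => a; exact: letters_sub.
have np := total_buildings_neq0 (size x) p0.
have nq : (total_buildings q (size x))%:R != 0 :> R.
  by apply: total_buildings_neq0; lia.
by field; rewrite np nq.
Qed.

Lemma sum_weight_sub p q n : (2 <= p <= q)%N ->
  \sum_(x <- words (letters p) n) weight q x =
    (total_buildings p n)%:R / (total_buildings q n)%:R.
Proof.
move=> /andP[p2 pq].
rewrite -[RHS]mulr1 -[X in _ = _ * X](sum_weight_words n p2) mulr_sumr.
apply: eq_big_seq => x.
rewrite mem_words => /andP[/eqP sx xp]; have p0q : (0 < p <= q)%N by rewrite pq (ltnW p2).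
by rewrite (weight_change p0q xp) sx.
Qed.

(** The count over words in two letters is the appending identity with
    q = 2, whose factor is 2 at every step. *)
Lemma sum_weight_two_letters n :
  \sum_(x <- words (letters 2) n) weight 4 x = (n.+1)`!%:R^-1.
Proof.
rewrite sum_weight_sub // total_buildings2 total_buildings4 natrM.
have f0 : (n.+1)`!%:R != 0 :> R by rewrite pnatr_eq0 -lt0n fact_gt0.
have e0 : (2 ^ n)%:R != 0 :> R by rewrite pnatr_eq0 expn_eq0.
by field; rewrite f0.
Qed.

Lemma sum_weight_gap1 x y :
  \sum_(a <- letters 4) weight 4 (x ++ a :: y) = weight 4 x * weight 4 y.
Proof.
have [xq|xq] := boolP (all (mem (letters 4)) x); last first.
  rewrite (weight_outside xq) mul0r big1 // => a _; rewrite weight_outside //.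
  by rewrite all_cat negb_and xq.
have [yq|yq] := boolP (all (mem (letters 4)) y); last first.
  rewrite (weight_outside yq) mulr0 big1 // => a _; rewrite weight_outside //.
  by rewrite all_cat /= !negb_and yq !orbT.
transitivity ((\sum_(a <- letters 4) buildings (x ++ a :: y))%:R /
              (total_buildings 4 (size x + size y).+1)%:R : R).
  rewrite natr_sum mulr_suml; apply: eq_big_seq => a aq.
  by rewrite /weight all_cat /= aq xq yq size_cat /= addnS.
rewrite sum_buildings_gap1 // /weight xq yq.
have := @bin_fact (size x + size y + 2) (size x).+1.
rewrite (_ : _ - _ = (size y).+1)%N; last by lia.
move=> /(_ ltac:(lia)) E.
have E1 : (total_buildings 4 (size x + size y).+1 =
   2 * 'C(size x + size y + 2, (size x).+1) *
   (total_buildings 4 (size x) * total_buildings 4 (size y)))%N.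
  rewrite !total_buildings4 -(_ : size x + size y + 2 = (size x + size y).+2)%N; last by lia.
  rewrite -{}E expnS expnD; lia.
rewrite E1 !natrM.
have C0 : 'C(size x + size y + 2, (size x).+1)%:R != 0 :> R.
  by rewrite pnatr_eq0 -lt0n bin_gt0; lia.
have nx := total_buildings_neq0 (size x) (isT : (0 < 4)%N).
have ny := total_buildings_neq0 (size y) (isT : (0 < 4)%N).
by field; rewrite C0 nx ny.
Qed.

Lemma sum_weight_gap2 x y :
  \sum_(a <- letters 3) \sum_(b <- letters 3) weight 3 (x ++ a :: b :: y) =
  weight 3 x * weight 3 y.
Proof.
have [xq|xq] := boolP (all (mem (letters 3)) x); last first.
  rewrite (weight_outside xq) mul0r big1 // => a _; rewrite big1 // => b _.
  by rewrite weight_outside // all_cat negb_and xq.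
have [yq|yq] := boolP (all (mem (letters 3)) y); last first.
  rewrite (weight_outside yq) mulr0 big1 // => a _; rewrite big1 // => b _.
  by rewrite weight_outside // all_cat /= !negb_and yq !orbT.
transitivity ((\sum_(a <- letters 3) \sum_(b <- letters 3)
    buildings (x ++ a :: b :: y))%:R / (total_buildings 3 (size x + size y).+2)%:R : R).
  rewrite natr_sum mulr_suml; apply: eq_big_seq => a aq.
  rewrite natr_sum mulr_suml; apply: eq_big_seq => b bq.
  by rewrite /weight all_cat /= aq bq xq yq size_cat /= !addnS.
rewrite sum_buildings_gap2 // /weight xq yq.
have := @bin_fact (size x + size y + 4) (size x).+2.
rewrite (_ : _ - _ = (size y).+2)%N; last by lia.
move=> /(_ ltac:(lia)) E.
have E1 : (total_buildings 3 (size x + size y).+2 =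
   2 * 'C(size x + size y + 4, (size x).+2) *
   (total_buildings 3 (size x) * total_buildings 3 (size y)))%N.
  have := total_buildings3 (size x + size y).+2.
  rewrite -(_ : size x + size y + 4 = (size x + size y).+4)%N; last by lia.
  rewrite -{}E -!total_buildings3; lia.
rewrite E1 !natrM.
have C0 : 'C(size x + size y + 4, (size x).+2)%:R != 0 :> R.
  by rewrite pnatr_eq0 -lt0n bin_gt0; lia.
have nx := total_buildings_neq0 (size x) (isT : (0 < 3)%N).
have ny := total_buildings_neq0 (size y) (isT : (0 < 3)%N).
by field; rewrite C0 nx ny.
Qed.

End Weight.

(** * Words in which every other letter is 1 *)

(** [ones_before b] is 1 b_1 1 b_2 ... 1 b_k and [ones_after b] is
    b_1 1 b_2 1 ... b_k 1, so that 1 :: ones_after b is the word with k + 1 letters 1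
    separated by the letters of b. *)
Fixpoint ones_before (b : seq nat) : seq nat :=
  if b is c :: b' then [:: 1, c & ones_before b'] else [::].

Fixpoint ones_after (b : seq nat) : seq nat :=
  if b is c :: b' then [:: c, 1 & ones_after b'] else [::].

Lemma ones_before_rcons (b : seq nat) (c : nat) :
  ones_before (rcons b c) = rcons (1 :: ones_after b) c.
Proof. by elim: b => [//|d b /= ->]. Qed.

Lemma rcons_ones_before (b : seq nat) : rcons (ones_before b) 1 = 1 :: ones_after b.
Proof. by elim: b => [//|d b /= ->]. Qed.

Lemma size_ones_after (b : seq nat) : size (ones_after b) = (size b).*2.
Proof. by elim: b => [//|d b /= ->]. Qed.

Lemma proper_word_ones_after (b : seq nat) :
  all (mem [:: 2; 3]) b -> proper_word (1 :: ones_after b).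
Proof.
rewrite /proper_word /=; elim: b => [//|c b IH] /= /andP[cs /IH ->].
by move: cs; rewrite !inE => /orP[] /eqP ->.
Qed.

Lemma letters_ones_after (b : seq nat) :
  all (mem [:: 2; 3]) b -> all (mem (letters 3)) (1 :: ones_after b).
Proof.
elim: b => [//|c b IH] /= /andP[cs /IH /= ->].
by move: cs; rewrite !inE => /orP[] /eqP ->.
Qed.

Section AlternatingWeight.
Variable R : numFieldType.
Local Open Scope ring_scope.
Notation weight := (@weight R).

Lemma weight_deletions q x : x != [::] -> proper_word x ->
  all (mem (letters q)) x ->
  (growth q (size x).-1)%:R * weight q x = \sum_(y <- deletions x) weight q y.
Proof.
case: x => [//|a x'] _; set x := a :: x' => px xq.
have q0 : (0 < q)%N.
  by case/andP: xq => aq _; move: aq; rewrite /= mem_iota; lia.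
have g0 : (growth q (size x').-1.+1)%:R != 0 :> R.
  by rewrite pnatr_eq0 -lt0n /growth addn_gt0 q0 orbT.
have g0' : (growth q (size x'))%:R != 0 :> R.
  by rewrite pnatr_eq0 -lt0n /growth addn_gt0 q0 orbT.
have n0 := total_buildings_neq0 R (size x') q0.
rewrite /weight xq [size x]/= total_buildingsS natrM [(size x').+1.-1]/= buildings_proper //.
transitivity ((\sum_(y <- deletions x) buildings y)%:R / (total_buildings q (size x'))%:R : R).
  by field; rewrite n0 g0'.
rewrite natr_sum mulr_suml; apply: eq_big_seq => y yx.
have -> : all (mem (letters q)) y.
  by apply/allP => b /(deletions_subset yx); exact/allP.
by move/size_deletions: yx => /= -[->].
Qed.

(** Deleting a separator puts two letters 1 side by side, so only the
    deletions of a letter 1 contribute; an interior one leaves two separators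
    adjacent. *)
Lemma sum_deletions_ones_after (f : seq nat -> R) (u b : seq nat) :
  (forall v w, f (v ++ [:: 1, 1 & w]%N) = 0) ->
  \sum_(y <- deletions (1 :: ones_after b)%N) f (u ++ y) =
  \sum_(i < (size b).+1) f (u ++ ones_before (take i b) ++ ones_after (drop i b)).
Proof.
move=> f11; elim: b u => [|c b IH] u.
  by rewrite big_ord_recl big_ord0 addr0 /deletions /= big_seq1.
rewrite big_ord_recl take0 drop0 /= !deletions_cons big_cons; congr (_ + _).
rewrite big_map big_cons f11 add0r !big_map.
transitivity (\sum_(y <- deletions (1 :: ones_after b)%N)
   f ((u ++ [:: 1; c]%N) ++ y)); first by apply: eq_bigr => y _; rewrite -catA.
by rewrite IH; apply: eq_bigr => i _; rewrite -catA.
Qed.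

(** Probability, under the 3-letter weight, of the letter 1 at k positions
    of consecutive distance 2. *)
Definition peak_weight (k : nat) : R :=
  if k is m.+1 then \sum_(b <- words [:: 2; 3]%N m) weight 3 (1%N :: ones_after b)
  else 1.

Lemma sum_colors23 (f : nat -> R) : f 1%N = 0 ->
  \sum_(c <- [:: 2; 3]%N) f c = \sum_(c <- letters 3) f c.
Proof. by move=> f1; rewrite [in RHS]big_cons f1 add0r. Qed.

(** The separators next to the deleted 1 may range over all three letters,
    since the letter 1 gives weight zero; the gap identity then separates both sides. *)
Lemma sum_weight_split i j :
  \sum_(b1 <- words [:: 2; 3]%N i) \sum_(b2 <- words [:: 2; 3]%N j)
    weight 3 (ones_before b1 ++ ones_after b2) = peak_weight i * peak_weight j.
Proof.
case: i => [|i]; case: j => [|j]; rewrite [peak_weight _]/= [X in _ * X]/=.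
- by rewrite !sum_words0 weight_nil mulr1.
- rewrite sum_words0 mul1r sum_wordsS exchange_big /=; apply: eq_bigr => b _.
  rewrite sum_colors23 ?sum_weight_cons //; exact: (weight_repeat R 3 [::]).
- rewrite mulr1 sum_words_rcons; apply: eq_bigr => b _.
  under eq_bigr do rewrite sum_words0 ones_before_rcons cats0.
  rewrite sum_colors23 ?sum_weight_rcons //.
  by rewrite -rcons_ones_before -cats1 cat_rcons weight_repeat.
rewrite sum_words_rcons mulr_suml; apply: eq_bigr => b1 _.
rewrite mulr_sumr exchange_big /= sum_wordsS exchange_big /=; apply: eq_bigr => b2 _.
rewrite -sum_weight_gap2 -(rcons_ones_before b1); set x := rcons _ _.
transitivity (\sum_(c' <- [:: 2; 3]%N) \sum_(c <- letters 3)
    weight 3 (x ++ [:: c, c', 1 & ones_after b2]%N)).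
  apply: eq_bigr => c' _; rewrite -sum_colors23; last first.
    by rewrite /x cat_rcons weight_repeat.
  apply: eq_bigr => c _.
  by rewrite ones_before_rcons -(rcons_ones_before b1) -/x cat_rcons.
rewrite [RHS]exchange_big sum_colors23 //.
by apply: big1 => a _; rewrite -cat_rcons weight_repeat.
Qed.

(** Recursion of the tangent numbers divided by factorials, obtained here by
    deleting one of the letters 1. *)
Lemma peak_weightS k : (2 * k.+1 + 1)%:R * peak_weight k.+1 =
  \sum_(i < k.+1) peak_weight i * peak_weight (k - i).
Proof.
rewrite /= mulr_sumr.
transitivity (\sum_(b <- words [:: 2; 3]%N k) \sum_(i < k.+1)
    weight 3 (ones_before (take i b) ++ ones_after (drop i b))).
  apply: eq_big_seq => b; rewrite mem_words => /andP[/eqP sb b23].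
  have E := @sum_deletions_ones_after (weight 3) [::] b (fun v w => weight_repeat R 3 v 1 w).
  rewrite sb /= in E; rewrite -E -weight_deletions //; first last.
  - exact: letters_ones_after.
  - exact: proper_word_ones_after.
  by congr (_%:R * _); rewrite /= size_ones_after sb growth3; lia.
rewrite exchange_big /=; apply: eq_bigr => i _.
rewrite -sum_weight_split -{1}(@subnKC i k) -1?ltnS // sum_words_cat.
apply: eq_big_seq => b1; rewrite mem_words => /andP[/eqP sb1 _].
by apply: eq_bigr => b2 _; rewrite -sb1 take_size_cat // drop_size_cat.
Qed.

Lemma sum_weight_peaks (k : nat) (u : seq nat) :
  \sum_(x <- words (letters 3) k.*2.+1 |
        all (fun j => nth 0%N x j.*2 == 1%N) (iota 0 k.+1)) weight 3 (u ++ x) =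
  \sum_(b <- words [:: 2; 3]%N k) weight 3 (u ++ 1%N :: ones_after b).
Proof.
elim: k u => [|k IH] u.
  by rewrite big_mkcond sum_wordsS !big_cons !big_nil /= !(addr0, add0r).
set Q := fun k (x : seq nat) => all (fun j => nth 0%N x j.*2 == 1%N) (iota 0 k.+1).
have QE a b x : Q k.+1 [:: a, b & x] = (a == 1%N) && Q k x.
  rewrite {1}/Q -[k.+2]add1n iotaD all_cat (iotaDl 1 0) all_map.
  by congr (_ && _); rewrite /= andbT.
rewrite (eq_bigl (Q k.+1)) // big_mkcond doubleS sum_wordsS.
under eq_bigr do rewrite sum_wordsS.
rewrite (bigD1_seq 1%N) ?letters_uniq // -[RHS]addr0; congr (_ + _); last first.
  apply: big1 => a /negbTE a1; apply: big1 => b _; apply: big1 => x _.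
  by rewrite QE a1.
rewrite sum_wordsS -sum_colors23; last first.
  by apply: big1 => x _; rewrite weight_repeat; case: ifP.
apply: eq_bigr => c _; transitivity (\sum_(x <- words (letters 3) k.*2.+1 | Q k x)
    weight 3 ((u ++ [:: 1; c]%N) ++ x)).
  by rewrite [RHS]big_mkcond; apply: eq_bigr => x _; rewrite QE eqxx -catA.
by rewrite IH; apply: eq_bigr => b _; rewrite -catA.
Qed.

End AlternatingWeight.

End Words.

(** * Uniqueness of laws and independence of generated sigma-algebras *)

(** Same as [sigma_generated], for an arbitrary index type: bits of a uniform
    variable are indexed by nat, and finite subfamilies by ordinals. *)
Definition generated_by (K S : Type) (d : measure_display)
    (E : measurableType d) (X : K -> S -> E) (I : set K) : set (set S) :=
  <<s \bigcup_(j in I) preimage_set_system setT (X j) measurable >>.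

Section Generated.
Context (K S : Type) (d : measure_display) (E : measurableType d).
Variable X : K -> S -> E.

Lemma generated_by_coordinate (I : set K) (j : K) (C : set E) :
  I j -> measurable C -> generated_by X I (X j @^-1` C).
Proof.
move=> Ij mC; apply: sub_sigma_algebra; exists j => //; exists C => //.
by rewrite setTI.
Qed.

Lemma generated_by_sub (I : set K) (G : set (set S)) :
  sigma_algebra setT G ->
  (forall j C, I j -> measurable C -> G (X j @^-1` C)) ->
  generated_by X I `<=` G.
Proof.
move=> sG GX; apply: smallest_sub => // A [j Ij [C mC <-]].
by rewrite setTI; exact: GX.
Qed.

Lemma generated_by_subset (I J : set K) : I `<=` J ->
  generated_by X I `<=` generated_by X J.
Proof.
move=> IJ; apply: generated_by_sub; first exact: smallest_sigma_algebra.
by move=> j C Ij mC; apply: generated_by_coordinate => //; exact: IJ.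
Qed.

End Generated.

Section GeneratedPointed.
Context (K : Type) (S : pointedType) (d : measure_display) (E : measurableType d).
Variables (X : K -> S -> E) (I : set K).

Let generatedType := g_sigma_algebraType
  (\bigcup_(j in I) preimage_set_system setT (X j) measurable).

Lemma generated_by_set0 : generated_by X I set0.
Proof. exact: (@measurable0 _ generatedType). Qed.

Lemma generated_by_setT : generated_by X I setT.
Proof. exact: (@measurableT _ generatedType). Qed.

Lemma generated_by_setI (A B : set S) :
  generated_by X I A -> generated_by X I B -> generated_by X I (A `&` B).
Proof. exact: (@measurableI _ generatedType). Qed.

End GeneratedPointed.

Lemma generated_by_measurable (K : Type) (d e : measure_display)
    (T : measurableType d) (E : measurableType e) (X : K -> T -> E) (I : set K) :
  (forall k, measurable_fun setT (X k)) -> generated_by X I `<=` measurable.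
Proof.
move=> mX; apply: generated_by_sub; first exact: sigma_algebra_measurable.
by move=> j C _ mC; rewrite -[_ @^-1` _]setTI; exact: mX.
Qed.

Section Unique.
Context (R : realType) (d d' : measure_display)
  (T : measurableType d) (T' : measurableType d').
Variables (P : probability T R) (P' : probability T' R).

(** Pi-lambda theorem, applied to the two image measures on the space of
    trajectories. *)
Lemma law_unique (K : Type) (e : measure_display) (E : measurableType e)
    (X : K -> T -> E) (X' : K -> T' -> E) (G : set (set (K -> E))) :
  (forall k, measurable_fun setT (X k)) ->
  (forall k, measurable_fun setT (X' k)) ->
  let coord := fun (k : K) (x : K -> E) => x k in
  G `<=` generated_by coord setT -> setI_closed G -> G setT ->
  (forall k C, measurable C -> <<s G >> (coord k @^-1` C)) ->
  (forall A, G A -> P [set t | A (X ^~ t)] = P' [set t | A (X' ^~ t)]) ->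
  forall A, generated_by coord setT A ->
    P [set t | A (X ^~ t)] = P' [set t | A (X' ^~ t)].
Proof.
move=> mX mX' coord GS GI GT Ggen PG A SA.
pose gens := \bigcup_(j in setT) preimage_set_system setT (coord j) (@measurable _ E).
pose W : measurableType _ := g_sigma_algebraType gens.
have mphi : measurable_fun setT ((fun t => X ^~ t) : T -> W).
  apply: (@measurability _ _ T W setT _ gens) => //.
  move=> _ [B [j _ [C mC <-]] <-]; rewrite !setTI.
  by rewrite -[X in measurable X]setTI; exact: mX.
have mphi' : measurable_fun setT ((fun t => X' ^~ t) : T' -> W).
  apply: (@measurability _ _ T' W setT _ gens) => //.
  move=> _ [B [j _ [C mC <-]] <-]; rewrite !setTI.
  by rewrite -[X in measurable X]setTI; exact: mX'.
pose f : {mfun T >-> W} := mfun_Sub (mem_set mphi).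
pose f' : {mfun T' >-> W} := mfun_Sub (mem_set mphi').
apply: (@g_sigma_algebra_measure_unique _ R W G _ (fun=> setT) _ _
  (pushforward P f) (pushforward P' f')) => //.
- by rewrite bigcup_const //; exists 0%N.
- by move=> _; change (P setT < +oo)%E; rewrite probability_setT ltry.
- move: A SA; apply: generated_by_sub; first exact: smallest_sigma_algebra.
  by move=> j C _; exact: Ggen.
Qed.

(** Pi-lambda theorem applied twice, once for each factor: A |-> P (A `&` B)
    and A |-> P A * P B are finite measures. *)
Lemma indep_unique (G1 G2 : set (set T)) :
  G1 `<=` measurable -> G2 `<=` measurable ->
  setI_closed G1 -> setI_closed G2 -> G1 setT -> G2 setT ->
  (forall A B, G1 A -> G2 B -> P (A `&` B) = P A * P B)%E ->
  forall A B, <<s G1 >> A -> <<s G2 >> B -> (P (A `&` B) = P A * P B)%E.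
Proof.
have half (H : set (set T)) (B : set T) : measurable B ->
    H `<=` measurable -> setI_closed H -> H setT ->
    (forall A, H A -> P (A `&` B) = P A * P B)%E ->
    forall A, <<s H >> A -> (P (A `&` B) = P A * P B)%E.
  move=> mB mH HI HT HP A sA.
  have PBE : P B = (fine (P B))%:E by rewrite fineK // fin_num_measure.
  have PB0 : 0 <= fine (P B) by rewrite fine_ge0.
  have E C : mscale (NngNum PB0) P C = (P C * P B)%E.
    by rewrite muleC [in RHS]PBE.
  rewrite -E; change (P (A `&` B)) with (mrestr P mB A).
  apply: (@g_sigma_algebra_measure_unique _ R T H mH (fun=> setT) (fun=> HT) _
    (mrestr P mB) (mscale (NngNum PB0) P) HI _ _ A sA).
  - by rewrite bigcup_const //; exists 0%N.
  - by move=> C HC; exact: etrans (HP C HC) (esym (E C)).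
  - move=> _; change (P (setT `&` B) < +oo)%E.
    by rewrite setTI; rewrite PBE ltry.
move=> mG1 mG2 I1 I2 T1 T2 HP A B sA sB.
have sm (H : set (set T)) : H `<=` measurable -> <<s H >> `<=` measurable.
  by move=> mH; apply: smallest_sub => //; exact: sigma_algebra_measurable.
apply: (half G1 B) => // [|C GC]; first exact: (sm G2).
rewrite setIC muleC; apply: (half G2 C) => //; first exact: mG1.
by move=> D GD; rewrite setIC muleC; exact: HP.
Qed.

End Unique.

Section Cylinders.
Context (K : eqType) (d e : measure_display) (T : measurableType d)
  (E : measurableType e).

Definition cylinder (S : Type) (X : K -> S -> E) (J : seq K) (A : K -> set E) : set S :=
  [set t | forall k, k \in J -> A k (X k t)].

Lemma cylinder_nil S (X : K -> S -> E) A : cylinder X [::] A = setT.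
Proof. by apply/seteqP; split. Qed.

Lemma cylinder_cons S (X : K -> S -> E) k J A :
  cylinder X (k :: J) A = X k @^-1` A k `&` cylinder X J A.
Proof.
apply/seteqP; split => [t tJ|t [tk tJ] j].
  by split => [|j jJ]; apply: tJ; rewrite inE ?eqxx // jJ orbT.
by rewrite inE => /orP[/eqP -> //|]; exact: tJ.
Qed.

Lemma cylinder_generated (S : pointedType) (X : K -> S -> E) (I : set K) J A :
  (forall k, measurable (A k)) -> (forall k, k \in J -> I k) ->
  generated_by X I (cylinder X J A).
Proof.
move=> mA; elim: J => [|k J IH] JI.
  rewrite cylinder_nil; exact: generated_by_setT.
rewrite cylinder_cons; apply: generated_by_setI.
  by apply: generated_by_coordinate => //; apply: JI; rewrite mem_head.
by apply: IH => j jJ; apply: JI; rewrite inE jJ orbT.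
Qed.

Definition cylinders (S : Type) (X : K -> S -> E) (I : set K) : set (set S) :=
  [set C | exists J A, [/\ forall k, measurable (A k), forall k, k \in J -> I k &
     C = cylinder X J A]].

Lemma cylinders_setI S (X : K -> S -> E) (I : set K) :
  setI_closed (cylinders X I).
Proof.
move=> _ _ [J1 [A1 [mA1 J1I ->]]] [J2 [A2 [mA2 J2I ->]]].
exists (J1 ++ J2), (fun k => (if k \in J1 then A1 k else setT) `&`
                             (if k \in J2 then A2 k else setT)); split.
- by move=> k; apply: measurableI; case: ifP.
- by move=> k; rewrite mem_cat => /orP[/J1I|/J2I].
apply/seteqP; split => [t [t1 t2] k _|t tJ].
  by split; case: ifP => // kJ; [exact: t1|exact: t2].
split=> k kJ; have := tJ k; rewrite mem_cat kJ ?orbT => /(_ isT).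
  by case.
by case=> _.
Qed.

Lemma cylinders_setT S (X : K -> S -> E) (I : set K) : cylinders X I setT.
Proof. by exists [::], (fun=> setT); split => //; rewrite cylinder_nil. Qed.

Lemma cylinders_generate S (X : K -> S -> E) (I : set K) :
  generated_by X I `<=` <<s cylinders X I >>.
Proof.
apply: generated_by_sub; first exact: smallest_sigma_algebra.
move=> j C Ij mC; apply: sub_sigma_algebra; exists [:: j], (fun=> C); split => //.
  by move=> k; rewrite inE => /eqP ->.
by rewrite cylinder_cons cylinder_nil setIT.
Qed.

Lemma cylinders_sub (S : pointedType) (X : K -> S -> E) (I : set K) :
  cylinders X I `<=` generated_by X I.
Proof. by move=> _ [J [A [mA JI ->]]]; exact: cylinder_generated. Qed.

End Cylinders.

Section CylinderLaw.
Context (R : realType) (K : eqType) (d d' e : measure_display)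
  (T : measurableType d) (T' : measurableType d') (E : measurableType e).
Variables (P : probability T R) (P' : probability T' R).

Lemma law_unique_cylinder (X : K -> T -> E) (X' : K -> T' -> E) :
  (forall k, measurable_fun setT (X k)) ->
  (forall k, measurable_fun setT (X' k)) ->
  (forall J A, uniq J -> (forall k, measurable (A k)) ->
     P (cylinder X J A) = P' (cylinder X' J A)) ->
  forall A, generated_by (fun (k : K) (x : K -> E) => x k) setT A ->
    P [set t | A (X ^~ t)] = P' [set t | A (X' ^~ t)].
Proof.
move=> mX mX' PX; pose G := cylinders (fun (k : K) (x : K -> E) => x k) setT.
apply: (law_unique (G := G)) => //.
- exact: cylinders_sub.
- exact: cylinders_setI.
- exact: cylinders_setT.
- move=> k C mC; apply: cylinders_generate; exact: generated_by_coordinate.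
move=> _ [J [A [mA _ ->]]].
have E1 S (Y : K -> S -> E) : [set t | cylinder (fun (k : K) (x : K -> E) => x k) J A (Y^~ t)]
   = cylinder Y (undup J) A.
  by apply/seteqP; split => t tJ k kJ; apply: tJ; rewrite ?mem_undup // -mem_undup.
by rewrite !E1; apply: PX => //; exact: undup_uniq.
Qed.

Lemma indep_cylinder (X : K -> T -> E) (I1 I2 : set K) :
  (forall k, measurable_fun setT (X k)) ->
  (forall J A, uniq J -> (forall k, measurable (A k)) ->
     P (cylinder X J A) = \prod_(k <- J) P (X k @^-1` A k))%E ->
  (forall k, I1 k -> I2 k -> False) ->
  forall A B, generated_by X I1 A -> generated_by X I2 B ->
    (P (A `&` B) = P A * P B)%E.
Proof.
move=> mX PX I12 A B A1 B2.
have cm I : cylinders X I `<=` measurable.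
  by apply: subset_trans (@cylinders_sub _ _ _ _ _ _) _; exact: generated_by_measurable.
apply: (@indep_unique _ _ _ _ (cylinders X I1) (cylinders X I2)) => //.
- exact: cylinders_setI.
- exact: cylinders_setI.
- exact: cylinders_setT.
- exact: cylinders_setT.
- move=> _ _ [J1 [A1' [mA1 J1I ->]]] [J2 [A2' [mA2 J2I ->]]].
  pose C k := if k \in J1 then A1' k else A2' k.
  have E0 J D : cylinder X J D = cylinder X (undup J) D.
    by apply/seteqP; split => t tJ k kJ; apply: tJ; rewrite ?mem_undup // -mem_undup.
  have N k : k \in J2 -> (k \in J1) = false.
    by move=> k2; apply/negP => k1; exact: (I12 k (J1I _ k1) (J2I _ k2)).
  have -> : cylinder X J1 A1' `&` cylinder X J2 A2' =
            cylinder X (undup J1 ++ undup J2) C.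
    apply/seteqP; split => [t [t1 t2] k|t tJ].
      rewrite mem_cat !mem_undup /C => /orP[k1|k2]; first by rewrite k1; exact: t1.
      by rewrite N //; exact: t2.
    split=> k kJ; have := tJ k; rewrite mem_cat !mem_undup kJ ?orbT /C => /(_ isT).
      by rewrite kJ.
    by rewrite N.
  have u12 : uniq (undup J1 ++ undup J2).
    rewrite cat_uniq !undup_uniq andbT /=; apply/hasPn => k; rewrite !mem_undup.
    by move=> k2; apply/negbT; exact: N.
  have mC k : measurable (C k) by rewrite /C; case: ifP.
  rewrite (E0 J1) (E0 J2) !PX ?undup_uniq //.
  rewrite big_cat /=; congr (_ * _)%E; apply: eq_big_seq => k; rewrite mem_undup => kJ.
    by rewrite /C kJ.
  by rewrite /C N.
- exact: cylinders_generate.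
- exact: cylinders_generate.
Qed.

End CylinderLaw.

Lemma probability_setI_full (R : realType) (d : measure_display)
    (T : measurableType d) (P : probability T R) (D F : set T) :
  measurable D -> measurable F -> P F = 1%E -> P (D `&` F) = P D.
Proof.
move=> mD mF PF; rewrite -[in RHS](setIT D) -(setUv F) setIUr measureU; first last.
- by rewrite setIACA setICr setI0.
- by apply: measurableI => //; exact: measurableC.
- exact: measurableI.
rewrite [X in (_ + X)%E](_ : _ = 0%E) ?adde0 //.
apply/eqP; rewrite -measure_le0 -[leRHS](_ : P (~` F) = 0%E).
  by apply: le_measure; rewrite ?inE; [apply: measurableI => //|..|exact: subIsetr];
    exact: measurableC.
by rewrite probability_setC // PF subee.
Qed.

(** * Random words from nested subintervals *)

Section UniformInterval.
Variable R : realType.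

Definition unit_prob : probability (measurableTypeR R) R := uniform_prob (@ltr01 R).

Lemma unit_prob_itv (l w : R) : 0 <= l -> 0 <= w -> l + w <= 1 ->
  unit_prob `[l, (l + w)[%classic = w%:E.
Proof.
move=> l0 w0 lw1; rewrite /unit_prob /= /uniform_prob.
rewrite (eq_integral (fun=> 1%:E)); last first.
  move=> x; rewrite inE /= in_itv /= => /andP[lx xw]; congr (_%:E).
  rewrite /uniform_pdf ifT ?subr0 ?invr1 //.
  by apply/andP; split; lra.
rewrite integral_cst //= mul1e lebesgue_measure_itv /= lte_fin.
case: ltP => [_|h]; first by rewrite -EFinB; congr (_%:E); lra.
by congr (_%:E); lra.
Qed.

(** Digits are only meaningful on the half-open interval. *)
Lemma unit_prob_restrict (A : set (measurableTypeR R)) : measurable A ->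
  unit_prob A = unit_prob (A `&` `[0, 1[%classic).
Proof.
move=> mA; rewrite probability_setI_full //.
by have := @unit_prob_itv 0 1 (lexx _) ler01; rewrite add0r; apply.
Qed.

End UniformInterval.

Section Digits.
Variables (R : realType) (A : eqType) (s : seq A) (dflt : A) (w : seq A -> R).
Hypothesis uniq_s : uniq s.
Hypothesis dflt_s : dflt \in s.
Hypothesis w_ge0 : forall x, 0 <= w x.
Hypothesis w_nil : w [::] = 1.
Hypothesis w_rcons : forall x, \sum_(a <- s) w (rcons x a) = w x.

(** Cuts an interval of length w x into pieces of lengths w (rcons x a), in
    the order of l, and returns the letter of the piece containing v together with
    the position of v inside that piece. *)
Fixpoint scan (x l : seq A) (v : R) : A * R :=
  if l is a :: l' then
    if v < w (rcons x a) then (a, v) else scan x l' (v - w (rcons x a))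
  else (dflt, v).

Fixpoint expansion (n : nat) (x : seq A) (v : R) : seq A :=
  if n is m.+1 then
    (scan x s v).1 :: expansion m (rcons x (scan x s v).1) (scan x s v).2
  else [::].

Definition digit (n : nat) (u : R) : A :=
  if 0 <= u < 1 then nth dflt (expansion n.+1 [::] u) n else dflt.

Definition offset (x l : seq A) (a : A) : R :=
  \sum_(b <- take (index a l) l) w (rcons x b).

Lemma offset_ge0 x l a : 0 <= offset x l a.
Proof. exact: sumr_ge0. Qed.

Lemma offset_cons x b l a : offset x (b :: l) a =
  if b == a then 0 else w (rcons x b) + offset x l a.
Proof.
by rewrite /offset /=; case: eqP => _; rewrite ?take0 ?big_nil //= big_cons.
Qed.

Lemma scan_in x l a v : a \in l ->
  offset x l a <= v < offset x l a + w (rcons x a) ->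
  scan x l v = (a, v - offset x l a).
Proof.
elim: l v => [//|b l IH] v; rewrite inE offset_cons eq_sym /=.
case: eqVneq => [->|ba] /= al; first by rewrite add0r subr0 => /andP[_ ->].
move=> /andP[v1 v2]; have o0 := offset_ge0 x l a.
rewrite ltNge (_ : _ <= _) /=; last by lra.
rewrite IH //; last by apply/andP; split; lra.
by congr pair; ring.
Qed.

Lemma scan_out x l v (p := scan x l v) : uniq l ->
  0 <= v < \sum_(b <- l) w (rcons x b) ->
  [/\ p.1 \in l, offset x l p.1 <= v < offset x l p.1 + w (rcons x p.1) &
      p.2 = v - offset x l p.1].
Proof.
rewrite {}/p; elim: l v => [|b l IH] v; first by rewrite big_nil; case: ltgtP.
rewrite big_cons /= => /andP[bl ul] /andP[v0 v1].
have [vb|vb] := ltP v (w (rcons x b)).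
  by rewrite /= offset_cons eqxx add0r subr0 mem_head v0 vb.
have [//||pl /andP[p1 p2] p3] := IH (v - w (rcons x b)).
  by apply/andP; split; lra.
set p := scan _ _ _ in pl p1 p2 p3 *.
have bp : b != p.1 by apply: contraNneq bl => ->.
rewrite inE pl orbT offset_cons (negbTE bp).
by split=> //; [apply/andP; split; lra|rewrite p3; ring].
Qed.

Lemma offset_le x l a : a \in l ->
  offset x l a + w (rcons x a) <= \sum_(b <- l) w (rcons x b).
Proof.
elim: l => [//|b l IH]; rewrite inE big_cons offset_cons eq_sym.
case: eqVneq => [->|_] /= al.
  by rewrite add0r lerDl sumr_ge0.
by rewrite -addrA lerD2l IH.
Qed.

(** By induction on y: the step of [scan] shifts the chosen piece to start
    at 0, so the interval found for the remaining letters is shifted back. *)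
Lemma expansion_interval x y : all (mem s) y -> exists l, [/\ 0 <= l,
  l + w (x ++ y) <= w x &
  forall v, 0 <= v < w x -> (expansion (size y) x v == y) = (l <= v < l + w (x ++ y))].
Proof.
elim: y x => [|a y IH] x /=.
  by exists 0; rewrite cats0 add0r lexx; split=> // v ->.
move=> /andP[ays /(IH (rcons x a))[l [l0 l1 lP]]]; rewrite cat_rcons in l1 lP.
exists (offset x s a + l); have o0 := offset_ge0 x s a.
have o1 := offset_le x ays; rewrite w_rcons in o1.
split; [exact: addr_ge0|lra|] => v v01.
rewrite eqseq_cons; apply/andP/idP => [[/eqP pa]|/andP[v1 v2]].
  have := @scan_out x s v uniq_s; rewrite w_rcons pa => /(_ v01)[_ /andP[v1 v2] ->].
  rewrite lP; last by apply/andP; split; lra.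
  by move=> /andP[v3 v4]; apply/andP; split; lra.
rewrite (scan_in ays) /=; last by apply/andP; split; have := w_ge0 (x ++ a :: y); lra.
by split; rewrite ?eqxx // lP; apply/andP; split; lra.
Qed.

Lemma size_expansion n x v : size (expansion n x v) = n.
Proof. by elim: n x v => [//|n IH] x v /=; rewrite IH. Qed.

Lemma scan_mem x l v : {subset l <= s} -> (scan x l v).1 \in s.
Proof.
elim: l v => [//|a l IH] v ls /=; case: ifP => _; first by apply: ls; rewrite mem_head.
by apply: IH => b bl; apply: ls; rewrite inE bl orbT.
Qed.

Lemma expansion_all n x v : all (mem s) (expansion n x v).
Proof. by elim: n x v => [//|n IH] x v /=; rewrite IH andbT; exact: scan_mem. Qed.

Lemma digit_mem n u : digit n u \in s.
Proof.
rewrite /digit; case: ifP => // _.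
by apply: (allP (expansion_all n.+1 [::] u)); rewrite mem_nth // size_expansion.
Qed.

Lemma nth_expansion m n x v i : (i < m)%N -> (i < n)%N ->
  nth dflt (expansion m x v) i = nth dflt (expansion n x v) i.
Proof.
elim: m n x v i => [//|m IH] [//|n] x v [//|i] /=; exact: IH.
Qed.

Lemma digits_expansion n u : 0 <= u < 1 -> mkseq (digit^~ u) n = expansion n [::] u.
Proof.
move=> u01; apply: (@eq_from_nth _ dflt); rewrite size_mkseq ?size_expansion //.
move=> i ltin; rewrite nth_mkseq // /digit u01.
exact: nth_expansion.
Qed.

Lemma digits_word y : all (mem s) y ->
  measurable [set u : measurableTypeR R | mkseq (digit^~ u) (size y) = y] /\
  unit_prob R [set u | mkseq (digit^~ u) (size y) = y] = (w y)%:E.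
Proof.
move=> ys; have [l [l0 l1 lP]] := expansion_interval [::] ys.
rewrite w_nil /= in l1 lP.
set D := [set u | _].
have mI : measurable (`[0, 1[%classic : set (measurableTypeR R)) by exact: measurable_itv.
have DI : D `&` `[0, 1[%classic = `[l, (l + w y)[%classic.
  apply/seteqP; split => [u [Du]|u] /=; rewrite !in_itv /=.
    by move=> u01; rewrite -lP // -digits_expansion // Du.
  move=> lu; have u01 : 0 <= u < 1 by move: lu => /andP[? ?]; apply/andP; split; lra.
  by split=> //; rewrite /D /= digits_expansion //; apply/eqP; rewrite lP.
(* Outside the unit interval all digits are the default letter, so there the
   event holds everywhere or nowhere. *)
have DC : D `&` ~` `[0, 1[%classic = ~` `[0, 1[%classic \/ D `&` ~` `[0, 1[%classic = set0.
  have dE u : (~` `[0, 1[%classic) u -> mkseq (digit^~ u) (size y) = nseq (size y) dflt.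
    rewrite /= in_itv /= => /negP/negbTE u01.
    apply: (@eq_from_nth _ dflt); rewrite size_mkseq ?size_nseq // => i iy.
    by rewrite nth_mkseq // nth_nseq iy /digit u01.
  have [E|E] := eqVneq (nseq (size y) dflt) y; [left|right].
    apply/seteqP; split => [u []//|u nu]; split => //.
    by rewrite /D /= dE.
  by apply/seteqP; split => // u [Du /dE]; rewrite Du => E'; rewrite -E' eqxx in E.
have mD : measurable (D : set (measurableTypeR R)).
  rewrite -(setIT D) -(setUv `[0, 1[%classic) setIUr DI; apply: measurableU.
    exact: measurable_itv.
  by case: DC => ->; [apply: measurableC|].
by split=> //; rewrite unit_prob_restrict // DI unit_prob_itv.
Qed.

(** A digit event is a finite union of word events, whatever the type of
    letters. *)
Lemma digit_measurable n (B : set A) :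
  measurable [set u : measurableTypeR R | B (digit n u)].
Proof.
pose W := words s n.+1.
have -> : [set u | B (digit n u)] = \bigcup_(y in [set` W] `&` [set y | B (nth dflt y n)])
    [set u | mkseq (digit^~ u) (size y) = y].
  apply/seteqP; split => [u Bu|u [y [yW By] /= yE]].
    exists (mkseq (digit^~ u) n.+1); last by rewrite /mkset size_mkseq.
    split; rewrite /mkset.
      rewrite /W mem_words size_mkseq eqxx; apply/allP => _ /mapP[i _ ->].
      exact: digit_mem.
    by rewrite nth_mkseq.
  move: yW By; rewrite /= mem_words => /andP[/eqP sy _].
  by rewrite -yE sy nth_mkseq.
apply: fin_bigcup_measurable.
  by apply: finite_setIl; exact: finite_seq.
move=> y [yW _]; apply: (digits_word _).1.
by move: yW; rewrite /= mem_words => /andP[].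
Qed.

End Digits.

(** * Processes with prescribed word probabilities *)

(** Law of total probability.  Disjointness is asked of the listed indices
    only, because words of different lengths may be read at the same place. *)
Lemma measure_partition (R : realType) (d : measure_display)
    (T : measurableType d) (P : probability T R) (I : eqType) (r : seq I)
    (F : I -> set T) (D : set T) :
  uniq r -> measurable D -> (forall i, measurable (F i)) ->
  (forall i j t, i \in r -> j \in r -> F i t -> F j t -> i = j) ->
  (forall t, D t -> exists2 i, i \in r & F i t) ->
  P D = (\sum_(i <- r) P (D `&` F i))%E.
Proof.
move=> + + mF; elim: r D => [|i r IH] /= D => [_ _ _ cov|/andP[ir ur] mD dF cov].
  rewrite big_nil (_ : D = set0) ?measure0 //.
  by apply/seteqP; split => // t /cov[].
rewrite big_cons -{1}(setIT D) -(setUv (F i)) setIUr measureU; first last.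
- by rewrite setIACA setICr setI0.
- by apply: measurableI => //; exact: measurableC.
- exact: measurableI.
congr (_ + _)%E; rewrite -/(P (D `&` ~` F i)).
have E j t : j \in r -> F j t -> ~ F i t.
  move=> jr Fj Fi; move: ir; rewrite (dF i j t) ?mem_head ?jr //.
  by rewrite inE jr orbT.
apply: etrans (IH _ ur _ _ _) _.
- by apply: measurableI => //; exact: measurableC.
- by move=> j k t jr kr; apply: dF; rewrite inE ?jr ?kr orbT.
- move=> t [/cov[j]]; rewrite inE => /orP[/eqP -> //|jr Fj _].
  by exists j.
apply: eq_big_seq => j jr; congr (P _); apply/seteqP; split=> [t [[Dt _] Fj]//|t [Dt Fj]].
by split=> //; split=> //; exact: E Fj.
Qed.

Definition factor (S : Type) (X : int -> S -> nat) (a : int) (n : nat) (t : S) : seq nat :=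
  mkseq (fun k => X (a + k%:Z) t) n.

Definition reads (S : Type) (X : int -> S -> nat) (a : int) (x : seq nat) : set S :=
  [set t | factor X a (size x) t = x].

Section Factors.
Variables (S : Type) (X : int -> S -> nat).

Lemma size_factor a n t : size (factor X a n t) = n.
Proof. exact: size_mkseq. Qed.

Lemma factor_cat a m n t :
  factor X a (m + n) t = factor X a m t ++ factor X (a + m%:Z) n t.
Proof.
rewrite /factor /mkseq iotaD map_cat; congr (_ ++ _).
rewrite -[(0 + m)%N]addnC iotaDl -map_comp; apply: eq_map => k /=.
by rewrite PoszD addrA.
Qed.

Lemma reads_cat a x y :
  reads X a (x ++ y) = reads X a x `&` reads X (a + (size x)%:Z) y.
Proof.
apply/seteqP; split => [t|t []]; rewrite /reads /= size_cat factor_cat.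
  by move/eqP; rewrite eqseq_cat ?size_factor // => /andP[/eqP ? /eqP ?].
by move=> -> ->.
Qed.

Lemma factor1 a t : factor X a 1 t = [:: X a t].
Proof. by rewrite /factor /mkseq /=; congr [:: X _ t]; exact: addr0. Qed.

Lemma reads_nil a : reads X a [::] = setT.
Proof. by apply/seteqP; split. Qed.

Lemma nth_factor a n t k : (k < n)%N -> nth 0%N (factor X a n t) k = X (a + k%:Z) t.
Proof. by move=> kn; rewrite nth_mkseq. Qed.

End Factors.

(** Events fixing the content of one of a nested sequence of windows: being
    nested, two of them are either disjoint or one contains the other, so they form a
    pi-system. *)
Section Windows.
Variables (S : pointedType) (X : int -> S -> nat).
Variables (a : nat -> int) (len : nat -> nat).
Hypothesis nested : forall m n, (m <= n)%N ->
  exists2 o : nat, a m = a n + o%:Z & (o + len m <= len n)%N.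

Definition window_events : set (set S) :=
  [set C | C = set0 \/ exists n, exists2 x, size x = len n & C = reads X (a n) x].

Lemma window_events_setI : setI_closed window_events.
Proof.
have wlog_case m n x y : (m <= n)%N -> size x = len m -> size y = len n ->
    window_events (reads X (a m) x `&` reads X (a n) y).
  move=> mn sx sy; have [h ah leh] := nested mn.
  have E t : factor X (a m) (len m) t = take (len m) (drop h (factor X (a n) (len n) t)).
    rewrite -(subnKC leh) -addnA factor_cat drop_size_cat ?size_factor //.
    by rewrite factor_cat take_size_cat ?size_factor // ah.
  have [e|e] := eqVneq (take (len m) (drop h y)) x.
    right; exists n, y => //; apply/seteqP; split=> [t []//|t ty]; split => //.
    by rewrite /reads /= sx E -sy ty.
  left; apply/seteqP; split => // t [/= tx ty]; move/eqP: e; apply.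
  by move: tx; rewrite /reads /= sx E -sy ty.
move=> C D [->|[m [x sx ->]]]; first by rewrite set0I; left.
move=> [->|[n [y sy ->]]]; first by rewrite setI0; left.
have [mn|/ltnW nm] := leqP m n; first exact: wlog_case.
by rewrite setIC; exact: wlog_case.
Qed.

Lemma window_events_generate (I : set int) :
  (forall j, I j -> exists n, exists2 k : nat, j = a n + k%:Z & (k < len n)%N) ->
  generated_by X I `<=` <<s window_events >>.
Proof.
move=> cover; apply: generated_by_sub; first exact: smallest_sigma_algebra.
move=> j C /cover[n [k -> kn]] _.
(* The words of the window are enumerated through their codes. *)
pose F (i : nat) : set S := if @choice.unpickle (seq nat) i is Some x then
  (if (size x == len n) && `[< C (nth 0%N x k) >] then reads X (a n) x else set0)
  else set0.
have -> : X (a n + k%:Z) @^-1` C = \bigcup_i F i.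
  apply/seteqP; split => [t Ct|t [i _]]; rewrite /F.
    exists (choice.pickle (factor X (a n) (len n) t)) => //.
    rewrite choice.pickleK size_factor eqxx /= nth_factor // ifT ?/reads /= ?size_factor //.
    exact/asboolP.
  case: choice.unpickle => // x; case: ifP => // /andP[/eqP sx /asboolP Cx].
  by rewrite /reads /= sx => tx; move: Cx; rewrite -tx nth_factor.
apply: (@bigcupT_measurable _ (g_sigma_algebraType window_events)) => i.
apply: sub_sigma_algebra; rewrite /F.
case: choice.unpickle => [x|]; last by left.
by case: ifP => [/andP[/eqP sx _]|_]; [right; exists n, x|left].
Qed.

Lemma window_events_sub (I : set int) :
  (forall n k, (k < len n)%N -> I (a n + k%:Z)) ->
  window_events `<=` generated_by X I.
Proof.
move=> sub _ [->|[n [x sx ->]]].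
  exact: generated_by_set0.
have -> : reads X (a n) x =
    cylinder X [seq a n + k%:Z | k <- iota 0 (size x)]
       (fun j => [set nth 0%N x (absz (j - a n))]).
  apply/seteqP; split => [t tx j|t tc].
    case/mapP => k; rewrite mem_iota /= add0n => kx -> /=.
    by rewrite -[in RHS]tx addrC addKr nth_factor.
  apply: (@eq_from_nth _ 0%N); rewrite ?size_factor // => k kx.
  rewrite nth_factor //; have := tc (a n + k%:Z).
  rewrite [_ - a n]addrC addKr; apply.
  by apply/mapP; exists k => //; rewrite mem_iota.
apply: cylinder_generated => // j /mapP[k]; rewrite mem_iota /= add0n => kx ->.
by apply: sub; rewrite -sx.
Qed.

End Windows.

Definition word_law (R : realType) (p : seq nat -> R) (d : measure_display)
    (T : measurableType d) (P : probability T R) (X : int -> T -> nat) : Prop :=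
  forall a x, P (reads X a x) = (p x)%:E.

Lemma word_law_unique (R : realType) (p : seq nat -> R)
    (d d' : measure_display) (T : measurableType d)
    (T' : measurableType d') (P : probability T R) (P' : probability T' R)
    (X : int -> T -> nat) (X' : int -> T' -> nat) :
  (forall i, measurable_fun setT (X i)) ->
  (forall i, measurable_fun setT (X' i)) ->
  word_law p P X -> word_law p P' X' -> equal_in_law P X P' X'.
Proof.
move=> mX mX' law law'.
pose coord := fun (k : int) (x : int -> nat) => x k.
pose G := window_events coord (fun n => - n%:Z) double.
have nest m n : (m <= n)%N -> exists2 o : nat, - m%:Z = - n%:Z + o%:Z & (o + m.*2 <= n.*2)%N.
  by move=> mn; exists (n - m)%N; lia.
apply: (@law_unique _ _ _ _ _ _ _ _ _ _ _ _ G) => //.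
- by apply: window_events_sub.
- exact: window_events_setI.
- by right; exists 0%N, [::]; rewrite ?reads_nil.
- move=> k C mC; apply: (window_events_generate (I := setT)) => //.
    by move=> j _; exists (absz j).+1, (absz (j + (absz j).+1%:Z)); lia.
  exact: generated_by_coordinate.
move=> _ [->|[n [x sx ->]]]; first by rewrite !measure0.
by have := law (- n%:Z) x; rewrite -(law' (- n%:Z) x).
Qed.

Section OneProcess.
Context (R : realType) (s : seq nat) (p : seq nat -> R).
Hypothesis uniq_s : uniq s.

Context (d : measure_display) (T : measurableType d) (P : probability T R).
Variable X : int -> T -> nat.
Hypothesis mX : forall i, measurable_fun setT (X i).
Hypothesis X_s : forall i t, X i t \in s.

Lemma reads_measurable a x : measurable (reads X a x).
Proof.
elim: x a => [|c x IH] a; first by rewrite reads_nil.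
rewrite -cat1s reads_cat; apply: measurableI => //.
have -> : reads X a [:: c] = X a @^-1` [set c].
  by apply/seteqP; split => t; rewrite /reads /= factor1; [case|move=> ->].
by rewrite -[_ @^-1` _]setTI; exact: mX.
Qed.

Lemma total_probability (D : set T) a n : measurable D ->
  P D = (\sum_(z <- words s n) P (D `&` reads X a z))%E.
Proof.
move=> mD; apply: measure_partition => //.
- exact: words_uniq.
- exact: reads_measurable.
- move=> x y t; rewrite !mem_words => /andP[/eqP sx _] /andP[/eqP sy _].
  by rewrite /reads /= sx sy => -> ->.
move=> t _; exists (factor X a n t); last by rewrite /reads /= size_factor.
rewrite mem_words size_factor eqxx; apply/allP => _ /mapP[i _ ->].
exact: X_s.
Qed.

Lemma reads_outside a x : ~~ all (mem s) x -> P (reads X a x) = 0%E.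
Proof.
move=> xs; rewrite (_ : reads X a x = set0) ?measure0 //.
apply/seteqP; split=> // t; rewrite /reads /= => tx; move/negP: xs; apply.
by rewrite -tx; apply/allP => _ /mapP[i _ ->]; exact: X_s.
Qed.

Lemma probability_factor a n (Q : pred (seq nat)) :
  (forall x, size x = n -> P (reads X a x) = (p x)%:E) ->
  measurable [set t | Q (factor X a n t)] /\
  P [set t | Q (factor X a n t)] = (\sum_(x <- words s n | Q x) p x)%:E.
Proof.
move=> law; have mQ : measurable [set t | Q (factor X a n t)].
  have -> : [set t | Q (factor X a n t)] =
      \bigcup_(x in [set` words s n] `&` [set x | Q x]) reads X a x.
    apply/seteqP; split => [t Qt|t [x [/= xs Qx] tx]].
      exists (factor X a n t); last by rewrite /reads /= size_factor.
      split => //=; rewrite mem_words size_factor eqxx; apply/allP => _ /mapP[i _ ->].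
      exact: X_s.
    move: xs; rewrite mem_words => /andP[/eqP sx _].
    by move: tx Qx; rewrite /reads /= sx => ->.
  apply: fin_bigcup_measurable; first by apply: finite_setIl; exact: finite_seq.
  by move=> x _; exact: reads_measurable.
split=> //; rewrite (total_probability a n mQ) -sumEFin [RHS]big_mkcond /=.
apply: eq_big_seq => x; rewrite mem_words => /andP[/eqP sx _].
have [Qx|Qx] := boolP (Q x).
  rewrite -(law x sx); congr (P _); apply/seteqP; split=> [t []//|t tx]; split=> //.
  by move: tx; rewrite /reads /= sx => ->.
rewrite (_ : _ `&` _ = set0) ?measure0 //; apply/seteqP; split => // t [] /=.
by rewrite /reads /= sx => + tx; rewrite tx (negbTE Qx).
Qed.

Hypothesis p_rcons : forall x, \sum_(a <- s) p (rcons x a) = p x.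
Hypothesis p_cons : forall x, \sum_(a <- s) p (a :: x) = p x.

Lemma reads_drop_last a n : 
  (forall x, size x = n.+1 -> P (reads X a x) = (p x)%:E) ->
  forall x, size x = n -> P (reads X a x) = (p x)%:E.
Proof.
move=> law x sx; rewrite (total_probability (a + n%:Z) 1); last exact: reads_measurable.
rewrite sum_wordsS -p_rcons -sumEFin; apply: eq_bigr => c _.
by rewrite sum_words0 -sx -reads_cat cats1 law // size_rcons sx.
Qed.

Lemma reads_drop_first a n : 
  (forall x, size x = n.+1 -> P (reads X a x) = (p x)%:E) ->
  forall x, size x = n -> P (reads X (a + 1) x) = (p x)%:E.
Proof.
move=> law x sx; rewrite (total_probability a 1); last exact: reads_measurable.
rewrite sum_wordsS -p_cons -sumEFin; apply: eq_bigr => c _.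
by rewrite sum_words0 setIC -(reads_cat X a [:: c]) /= law //= sx.
Qed.

(** Every window lies in a centered one, and consistency allows to forget
    letters at either end. *)
Lemma word_law_extend :
  (forall n x, size x = n.*2 -> P (reads X (- n%:Z) x) = (p x)%:E) ->
  word_law p P X.
Proof.
move=> law a x; pose N := (`|a| + size x)%N.
(* Letters are dropped at the left end, then at the right end. *)
have H1 i : (i <= N.*2)%N -> forall x, size x = (N.*2 - i)%N ->
    P (reads X (- N%:Z + i%:Z) x) = (p x)%:E.
  elim: i => [|i IH] iN; first by rewrite subn0 addr0; exact: law.
  rewrite -addn1 PoszD addrA; apply: reads_drop_first => y sy; apply: IH; lia.
pose i := absz (a + N%:Z).
have iN : (i <= N.*2)%N by rewrite /i /N; lia.
have aE : - N%:Z + i%:Z = a by rewrite /i /N; lia.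
have xN : (size x <= N.*2 - i)%N by rewrite /i /N; lia.
rewrite -aE; move: i iN xN {aE} => i iN xN.
have H2 k : forall m, (N.*2 - i - m)%N = k -> (m <= N.*2 - i)%N ->
    forall x, size x = m -> P (reads X (- N%:Z + i%:Z) x) = (p x)%:E.
  elim: k => [|k IH] m mk mN y sy; first by apply: H1 => //; lia.
  by apply: (@reads_drop_last _ m) => // z sz; apply: (IH m.+1) => //; lia.
exact: (H2 _ (size x) erefl).
Qed.

(** The gap condition is independence of past and future windows of any
    length; such windows generate the past and the future. *)
Lemma word_law_k_dependent (k : nat) (i : int) (A B : set T) :
  word_law p P X ->
  (forall x y, \sum_(z <- words s k) p (x ++ z ++ y) = p x * p y) ->
  generated_by X [set j | j < i] A ->
  generated_by X [set j | i + k%:Z <= j] B ->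
  P (A `&` B) = (P A * P B)%E.
Proof.
move=> law gap sA sB.
pose G1 := window_events X (fun n => i - n%:Z) id.
pose G2 := window_events X (fun=> i + k%:Z) id.
have n1 m n : (m <= n)%N -> exists2 o : nat, i - m%:Z = i - n%:Z + o%:Z & (o + m <= n)%N.
  by move=> mn; exists (n - m)%N; lia.
have n2 m n : (m <= n)%N -> exists2 o : nat, i + k%:Z = i + k%:Z + o%:Z & (o + m <= n)%N.
  by move=> mn; exists 0%N; lia.
have wm a len : window_events X a len `<=` measurable.
  by move=> _ [->|[n [x _ ->]]]; [exact: measurable0|exact: reads_measurable].
apply: (@indep_unique _ _ _ _ G1 G2) => //.
- exact: wm.
- exact: wm.
- exact: window_events_setI.
- exact: window_events_setI.
- by right; exists 0%N, [::]; rewrite ?reads_nil.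
- by right; exists 0%N, [::]; rewrite ?reads_nil.
- move=> C D [->|[m [x sx ->]]]; first by rewrite set0I measure0 mul0e.
  move=> [->|[n [y sy ->]]]; first by rewrite setI0 measure0 mule0.
  rewrite (total_probability i k); last by apply: measurableI; exact: reads_measurable.
  rewrite !law -EFinM -gap -sumEFin; apply: eq_big_seq => z.
  rewrite mem_words => /andP[/eqP sz _].
  by rewrite -(law (i - m%:Z)) !reads_cat sx sz subrK setIAC setIA.
- move: sA; apply: window_events_generate => j /= ji.
  by exists (absz (i - j)), 0%N; lia.
- move: sB; apply: window_events_generate => j /= ji.
  by exists (absz (j - (i + k%:Z)%R)).+1, (absz (j - (i + k%:Z)%R)); lia.
Qed.

End OneProcess.

(** * Existence of two-sided processes *)

(** A letter of the one-sided construction is a pair (left, right); its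
    n-th occurrence provides positions -(n+1) and n, which are [Negz n] and [Posz n]. *)
Section TwoSided.
Variables (R : realType) (s : seq nat) (dflt : nat) (p : seq nat -> R).
Hypothesis uniq_s : uniq s.
Hypothesis dflt_s : dflt \in s.
Hypothesis p_ge0 : forall x, 0 <= p x.
Hypothesis p_nil : p [::] = 1.
Hypothesis p_rcons : forall x, \sum_(a <- s) p (rcons x a) = p x.
Hypothesis p_cons : forall x, \sum_(a <- s) p (a :: x) = p x.
Hypothesis p_outside : forall x, ~~ all (mem s) x -> p x = 0.

Let pairs : seq (nat * nat) := [seq (a, b) | a <- s, b <- s].
Let unfold_pairs (z : seq (nat * nat)) : seq nat := rev (map fst z) ++ map snd z.
Let w z := p (unfold_pairs z).

Let pairs_uniq : uniq pairs. Proof. by apply: allpairs_uniq => // -[? ?] [? ?]. Qed.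
Let dflt_pairs : (dflt, dflt) \in pairs.
Proof. by apply/allpairsP; exists (dflt, dflt). Qed.
Let w_rcons z : \sum_(c <- pairs) w (rcons z c) = w z.
Proof.
rewrite big_allpairs_dep /= /w -p_cons; apply: eq_bigr => a _.
rewrite -p_rcons; apply: eq_bigr => b _; congr p.
by rewrite /unfold_pairs !map_rcons rev_rcons /= rcons_cat.
Qed.

Let Z := digit pairs (dflt, dflt) w.

Let X0 (i : int) (u : measurableTypeR R) : nat :=
  match i with Posz n => (Z n u).2 | Negz n => (Z n u).1 end.

Let Z_pairs n u : Z n u \in pairs. Proof. exact: digit_mem. Qed.

Let X0_s i u : X0 i u \in s.
Proof.
by case: i => n /=; have /allpairsP[[a b] /= [? ? ->]] := Z_pairs n u.
Qed.

Let mX0 i : measurable_fun setT (X0 i).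
Proof.
move=> _ B mB; rewrite setTI.
case: i => n.
  exact: (@digit_measurable R _ pairs (dflt, dflt) w pairs_uniq dflt_pairs
    (fun z => p_ge0 _) p_nil w_rcons n [set c | B c.2]).
exact: (@digit_measurable R _ pairs (dflt, dflt) w pairs_uniq dflt_pairs
    (fun z => p_ge0 _) p_nil w_rcons n [set c | B c.1]).
Qed.

Let factor_X0 n u : factor X0 (- n%:Z) n.*2 u = unfold_pairs (mkseq (Z^~ u) n).
Proof.
rewrite -addnn factor_cat addNr /unfold_pairs; congr (_ ++ _).
  apply: (@eq_from_nth _ 0%N); rewrite ?(size_rev, size_factor, size_map, size_iota) //.
  move=> k kn; rewrite nth_factor // nth_rev !size_map ?size_iota //.
  rewrite (nth_map (dflt, dflt)) ?size_mkseq; last by lia.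
  rewrite nth_mkseq; last by lia.
  by rewrite (_ : - n%:Z + k%:Z = Negz (n - k.+1)%N) //; lia.
rewrite /factor /mkseq -map_comp; apply: eq_map => k.
by rewrite /comp add0r.
Qed.

Lemma word_law_exists : exists X : int -> {RV (unit_prob R) >-> nat},
  (forall i t, X i t \in s) /\ word_law p (unit_prob R) X.
Proof.
pose X (i : int) : {RV (unit_prob R) >-> nat} := mfun_Sub (mem_set (mX0 i)).
exists X; split; first by move=> i t; exact: X0_s.
apply: (word_law_extend uniq_s mX0 X0_s p_rcons p_cons).
move=> n x sx; have [xs|xs] := boolP (all (mem s) x); last first.
  by rewrite p_outside // (reads_outside _ X0_s).
pose z := zip (rev (take n x)) (drop n x).
have s1 : size (take n x) = n by rewrite size_takel // sx; lia.
have s2 : size (drop n x) = n by rewrite size_drop sx; lia.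
have zx : unfold_pairs z = x.
  rewrite /unfold_pairs /z -/unzip1 -/unzip2 unzip1_zip ?unzip2_zip ?size_rev ?s1 ?s2 //.
  by rewrite revK cat_take_drop.
have sz : size z = n by rewrite size_zip size_rev s1 s2 minnn.
have zs : all (mem pairs) z.
  apply/allP => -[a b] abz; apply/allpairsP; exists (a, b); split => //=.
    apply: (allP xs); apply: (@mem_take n); rewrite -mem_rev.
    rewrite -[rev _](@unzip1_zip _ _ _ (drop n x)) ?size_rev ?s1 ?s2 //.
    by apply/mapP; exists (a, b).
  apply: (allP xs); apply: (@mem_drop n).
  rewrite -[drop _ _](@unzip2_zip _ _ (rev (take n x))) ?size_rev ?s1 ?s2 //.
  by apply/mapP; exists (a, b).
have [_] := @digits_word R _ pairs (dflt, dflt) w pairs_uniq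
    (fun z => p_ge0 _) p_nil w_rcons z zs.
rewrite /w zx => <-; congr (unit_prob R _).
apply/seteqP; split => u; rewrite /reads /= sx sz.
  change (factor X0 (- n%:Z) n.*2 u = x -> mkseq (Z^~ u) n = z).
  rewrite factor_X0 -zx => /eqP; rewrite eqseq_cat; last first.
    by rewrite !size_rev !size_map size_iota sz.
  move=> /andP[/eqP/(congr1 rev)]; rewrite !revK => E1 /eqP E2.
  rewrite -[LHS](zip_unzip) -[RHS]zip_unzip /unzip1 /unzip2.
  by rewrite E1 E2.
change (mkseq (Z^~ u) n = z -> factor X0 (- n%:Z) n.*2 u = x).
by rewrite factor_X0 => ->.
Qed.

End TwoSided.

(** * Independent families and fair bits *)

Section Independent.
Context (R : realType) (d e : measure_display) (T : measurableType d)
  (E : measurableType e) (P : probability T R).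

(** Finite subfamilies are duplicate-free sequences, so that the index type can
    be arbitrary. *)
Definition independent (K : eqType) (X : K -> T -> E) : Prop :=
  forall J A, uniq J -> (forall k, measurable (A k)) ->
    P (cylinder X J A) = (\prod_(k <- J) P (X k @^-1` A k))%E.

Lemma independent_reindex (K K' : eqType) (X : K -> T -> E) (c : K' -> K) :
  injective c -> independent X -> independent (fun k => X (c k)).
Proof.
move=> cI indX J A uJ mA.
(* A' is A pushed forward along c, and the whole space off the image of c. *)
pose A' k := [set x | forall k', c k' = k -> A k' x].
have A'E k : A' (c k) = A k.
  by apply/seteqP; split => x; [exact|move=> Ax k' /cI ->].
have mA' k : measurable (A' k).
  have [[k' <-]|nk] := pselect (exists k', c k' = k); first by rewrite A'E.
  rewrite (_ : A' k = setT) //; apply/seteqP; split => // x _ k' ck'.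
  by exfalso; apply: nk; exists k'.
have -> : cylinder (fun k => X (c k)) J A = cylinder X (map c J) A'.
  apply/seteqP; split => [t tJ _ /mapP[k kJ ->]|t tJ k kJ].
    by rewrite A'E; exact: tJ.
  by rewrite -A'E; apply: tJ; exact: map_f.
rewrite indX ?map_inj_uniq // big_map; apply: eq_bigr => k _.
by rewrite A'E.
Qed.

Lemma iid_independent (X : int -> {RV P >-> E}) mu :
  iid_with_law X mu -> independent (fun i => X i : T -> E).
Proof.
move=> [indX _] J A uJ mA.
have pJ : perm_eq (enum_fset [fset x in J]%fset) J.
  by apply: uniq_perm => // x; rewrite inE.
rewrite -(perm_big _ pJ) /= -indX //; congr (P _); apply/seteqP; split => t tJ k.
  by move=> /=; rewrite inE => kJ; exact: tJ.
by move=> kJ; apply: tJ; rewrite /= inE.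
Qed.

Lemma independent_iid (X : int -> {RV P >-> E}) mu :
  independent (fun i => X i : T -> E) ->
  (forall i A, measurable A -> P (X i @^-1` A) = mu A) -> iid_with_law X mu.
Proof.
move=> indX lawX; split; last by move=> i A mA; rewrite -(lawX i).
move=> J A mA; apply: etrans (indX (enum_fset J) A (fset_uniq J) mA).
by congr (P _); apply/seteqP; split => t tJ k kJ; apply: tJ.
Qed.

End Independent.

(** Functions of disjoint blocks of an independent family are independent;
    one block is split off at a time. *)
Lemma independent_blocks (R : realType) (d e : measure_display)
    (T : measurableType d) (E : measurableType e) (P : probability T R)
    (K : eqType) (X : K -> T -> E) :
  (forall k, measurable_fun setT (X k)) -> independent P X ->
  forall (e' : measure_display) (F : measurableType e') (I : eqType)
    (Y : I -> T -> F) (block : I -> set K),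
  (forall i j k, block i k -> block j k -> i = j) ->
  (forall i A, measurable A -> generated_by X (block i) (Y i @^-1` A)) ->
  independent P Y.
Proof.
move=> mX indX e' F I Y block disj YX J A uJ mA.
elim: J uJ => [_|i J IH /= /andP[iJ uJ]].
  by rewrite cylinder_nil big_nil probability_setT.
rewrite cylinder_cons big_cons -(IH uJ).
apply: (indep_cylinder (I1 := block i) (I2 := [set k | exists2 j, j \in J & block j k]) mX indX).
- move=> k ik [j jJ jk]; move: iJ; rewrite (disj _ _ _ ik jk).
  by rewrite jJ.
- exact: YX.
elim: J {IH uJ iJ} => [|j J IH].
  rewrite cylinder_nil; exact: generated_by_setT.
rewrite cylinder_cons; apply: generated_by_setI.
  apply: (generated_by_subset _ (YX j _ (mA j))) => k jk.
  by exists j => //; exact: mem_head.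
apply: (generated_by_subset _ IH) => k [j' j'J j'k].
by exists j' => //; rewrite inE j'J orbT.
Qed.

Section FairBits.
Variable R : realType.

Let fair (z : seq bool) : R := 2^-1 ^+ size z.

Let fair_rcons z : \sum_(a <- [:: false; true]) fair (rcons z a) = fair z.
Proof.
rewrite !big_cons big_nil /fair !size_rcons exprS; set y := _ ^+ _; lra.
Qed.

Let fair_ge0 z : 0 <= fair z. Proof. by rewrite /fair exprn_ge0 // invr_ge0. Qed.

Definition binary_digit (n : nat) (u : measurableTypeR R) : bool :=
  digit [:: false; true] false fair n u.

Lemma binary_digit_measurable n : measurable_fun setT (binary_digit n).
Proof.
move=> _ B mB; rewrite setTI.
exact: (@digit_measurable R _ [:: false; true] false fair isT isT
    fair_ge0 erefl fair_rcons n B).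
Qed.

Let half_mass (B : set bool) : R := \sum_(a <- [:: false; true]) 2^-1 * (`[< B a >])%:R.

Lemma sum_words_prod (A : eqType) (s : seq A) (a0 : A) (g : nat -> A -> R) n :
  \sum_(y <- words s n) \prod_(k < n) g k (nth a0 y k) =
  \prod_(k < n) \sum_(a <- s) g k a.
Proof.
elim: n g => [|n IH] g; first by rewrite sum_words0 !big_ord0.
rewrite sum_wordsS big_ord_recl mulr_suml; apply: eq_bigr => a _.
rewrite -(IH (fun k => g k.+1)) mulr_sumr; apply: eq_bigr => y _.
by rewrite big_ord_recl.
Qed.

(** Summing the weights 2^-n of the words allowed by B is a product of sums. *)
Let binary_cylinder n (B : nat -> set bool) :
  unit_prob R [set u | forall k, (k < n)%N -> B k (binary_digit k u)] =
  (\prod_(k < n) half_mass (B k))%:E.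
Proof.
pose F (y : seq bool) := [set u : measurableTypeR R | mkseq (binary_digit^~ u) (size y) = y].
have FP y : measurable (F y) /\ unit_prob R (F y) = (fair y)%:E.
  have ys : all (mem [:: false; true]) y by apply/allP => -[].
  exact: (@digits_word R _ [:: false; true] false fair isT fair_ge0 erefl fair_rcons y ys).
set D := [set u | _].
have mD : measurable (D : set (measurableTypeR R)).
  rewrite (_ : D = cylinder binary_digit (iota 0 n) B).
    apply: (@generated_by_measurable _ _ _ _ _ binary_digit setT).
      exact: binary_digit_measurable.
    by apply: cylinder_generated.
  apply/seteqP; split => t tD k; first by rewrite mem_iota add0n => /tD.
  by move=> kn; apply: tD; rewrite mem_iota.
rewrite (@measure_partition _ _ _ (unit_prob R) _ (words [:: false; true] n) F) //.
- rewrite -(@sum_words_prod _ [:: false; true] false (fun k a => 2^-1 * (`[< B k a >])%:R)).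
  rewrite -sumEFin; apply: eq_big_seq => y; rewrite mem_words => /andP[/eqP sy _].
  rewrite big_split /= prodr_const card_ord.
  have [Dy|Dy] := pselect (forall k, (k < n)%N -> B k (nth false y k)).
    rewrite big1 ?mulr1; last by move=> k _; rewrite asboolT //; exact: Dy.
    rewrite (_ : D `&` F y = F y) ?(FP y).2 /fair ?sy //.
    apply/seteqP; split=> [u []//|u uy]; split=> // k kn.
    by move: (Dy k kn); rewrite -[in X in X -> _]uy nth_mkseq ?sy.
  rewrite (_ : D `&` F y = set0) ?measure0.
    move/existsNP: Dy => [k /not_implyP[kn Bk]].
    by rewrite (bigD1 (Ordinal kn)) //= asboolF // mul0r mulr0.
  apply/seteqP; split => // u [Du uy]; apply: Dy => k kn.
  by move: (Du k kn); rewrite -[in X in _ -> X]uy nth_mkseq ?sy.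
- exact: words_uniq.
- by move=> y; exact: (FP y).1.
- move=> x y t; rewrite !mem_words => /andP[/eqP sx _] /andP[/eqP sy _].
  by rewrite /F /= sx sy => -> ->.
move=> t _; exists (mkseq (binary_digit^~ t) n); last by rewrite /F /mkset size_mkseq.
by rewrite mem_words size_mkseq eqxx; apply/allP => -[].
Qed.

Lemma half_massT : half_mass setT = 1.
Proof. by rewrite /half_mass !big_cons big_nil !asboolT // /=; lra. Qed.

Lemma binary_digit_law n B : unit_prob R (binary_digit n @^-1` B) = (half_mass B)%:E.
Proof.
have := binary_cylinder n.+1 (fun k => if k == n then B else setT).
rewrite big_ord_recr /= eqxx big1 ?mul1r => [<-|k _]; last first.
  by rewrite ltn_eqF // half_massT.
congr (unit_prob R _); apply/seteqP; split => u Bu.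
  by move=> k _; case: eqVneq => // ->.
by have := Bu n (ltnSn n); rewrite eqxx.
Qed.

Lemma binary_digit_independent : independent (unit_prob R) binary_digit.
Proof.
move=> J B uJ _; pose n := (\max_(k <- J) k).+1.
have Jn k : k \in J -> (k < n)%N by move=> kJ; rewrite ltnS (leq_bigmax_seq (F := id)).
have -> : cylinder binary_digit J B = [set u | forall k, (k < n)%N ->
    (if k \in J then B k else setT) (binary_digit k u)].
  apply/seteqP; split => [t tJ k _|t tn k kJ]; first by case: ifP => // /tJ.
  by have := tn k (Jn k kJ); rewrite kJ.
apply: etrans (binary_cylinder n (fun k => if k \in J then B k else setT)) _.
rewrite [RHS](eq_bigr (fun k => (half_mass (B k))%:E)); last first.
  by move=> k _; rewrite binary_digit_law.
rewrite prodEFin; congr (_%:E).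
rewrite -(big_mkord xpredT (fun k => half_mass (if k \in J then B k else setT))).
rewrite (bigID (mem J)) /= [X in _ * X]big1 ?mulr1; last first.
  by move=> k /negbTE ->; exact: half_massT.
rewrite (eq_bigr (fun k => half_mass (B k))); last by move=> k ->.
rewrite -big_filter; apply: perm_big; apply: uniq_perm => //.
  by rewrite filter_uniq // iota_uniq.
move=> k; rewrite mem_filter mem_index_iota /=; case: (boolP (k \in J)) => // kJ.
by rewrite Jn.
Qed.

End FairBits.

(** * Uniform variables from fair bits *)

Section RealOfBits.
Variable R : realType.

Definition partial_real (b : nat -> bool) (n : nat) : R :=
  \sum_(j < n) (b j)%:R * 2^-1 ^+ j.+1.

Definition real_of_bits (b : nat -> bool) : R := limn (partial_real b).

Lemma partial_realS b n :
  partial_real b n.+1 = partial_real b n + (b n)%:R * 2^-1 ^+ n.+1.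
Proof. by rewrite /partial_real big_ord_recr. Qed.

Lemma partial_real_cvg b : partial_real b @ \oo --> real_of_bits b.
Proof.
apply: nondecreasing_is_cvgn.
  apply/nondecreasing_seqP => n; rewrite partial_realS lerDl.
  by rewrite mulr_ge0 // exprn_ge0 // invr_ge0.
exists 1 => _ [n _ <-].
suff : partial_real b n <= 1 - 2^-1 ^+ n.
  by have : 0 <= 2^-1 ^+ n :> R by [rewrite exprn_ge0 // invr_ge0]; lra.
elim: n => [|n IH]; first by rewrite /partial_real big_ord0 expr0 subrr.
have : 0 <= 2^-1 ^+ n :> R by rewrite exprn_ge0 // invr_ge0.
rewrite partial_realS exprS; move: IH; set y := _ ^+ n.
by case: (b n) => /=; lra.
Qed.

Lemma real_of_bits_measurable (d : measure_display) (T : measurableType d)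
    (b : nat -> T -> bool) :
  (forall n, measurable_fun setT (b n)) ->
  measurable_fun setT (fun t => real_of_bits (b ^~ t)).
Proof.
move=> mb; apply: (@measurable_fun_cvg _ _ _ setT (fun n t => partial_real (b ^~ t) n)).
  move=> n; rewrite /partial_real.
  apply: (@measurable_sum _ _ _ setT _ _ (fun (j : 'I_n) t => (b j t)%:R * 2^-1 ^+ j.+1)).
  move=> j; apply: measurable_funM => //.
  rewrite (_ : (fun t => _) = (fun t => if b j t then 1 else 0)); last first.
    by apply/funext => t; case: (b j t).
  by apply: measurable_fun_if => //; exact: measurable_funTS.
by move=> t _; exact: partial_real_cvg.
Qed.

Let fair (z : seq bool) : R := 2^-1 ^+ size z.

Lemma expansion_value m x v : 0 <= v < fair x ->
  let y := expansion [:: false; true] false fair m x v in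
  let S := \sum_(j < m) (nth false y j)%:R * 2^-1 ^+ (size x + j).+1 in
  S <= v < S + 2^-1 ^+ (size x + m).
Proof.
elim: m x v => [|m IH] x v v01 /=; first by rewrite big_ord0 add0r addn0.
set c := (if _ then _ else _); set a := c.1.
have [c0 c1] : 0 <= c.2 < fair (rcons x a) /\
    v = a%:R * 2^-1 ^+ (size x).+1 + c.2.
  move: v01; rewrite /a /c /fair !size_rcons exprS; set y := _ ^+ size x.
  case: ifP => /= [h|h]; first by move=> /andP[? ?]; split; [apply/andP; split|]; lra.
  case: ifP => /= h2; move=> /andP[? ?]; (split; [apply/andP; split|]); lra.
have := IH _ _ c0; rewrite big_ord_recl /= addn0 size_rcons addSnnS.
under eq_bigr do rewrite addSnnS.
set S := \sum_(j < m) _; set z := a%:R * _ in c1 *.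
by move=> /andP[? ?]; apply/andP; split; lra.
Qed.

(** The digits of the interval construction with weights 2^-n are the usual
    binary digits. *)
Lemma real_of_binary_digits u : 0 <= u < 1 ->
  real_of_bits (fun n => @binary_digit R n u) = u.
Proof.
move=> u01; apply: cvg_lim => //.
have bound n : u - 2^-1 ^+ n <= partial_real (fun n => @binary_digit R n u) n <= u.
  have u1 : 0 <= u < fair [::] by rewrite /fair expr0.
  have := expansion_value n u1 => /=.
  rewrite (_ : \sum_(j < n) _ = partial_real (fun n => @binary_digit R n u) n).
    by move=> /andP[? ?]; apply/andP; split; lra.
  apply: eq_bigr => j _; rewrite add0n; congr (_%:R * _).
  rewrite -(@digits_expansion R _ [:: false; true] false fair n u u01).
  by rewrite nth_mkseq.
apply: (@squeeze_cvgr _ _ _ _ (fun n => u - 2^-1 ^+ n) (fun=> u)).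
- by apply: nearW => n; exact: bound.
- rewrite -[X in _ --> X]subr0; apply: cvgB; first exact: cvg_cst.
  by apply: cvg_expr; rewrite ger0_norm ?invr_ge0 // invf_lt1 // ltr1n.
exact: cvg_cst.
Qed.

(** The law of the sum of the binary series depends only on the law of the
    bits, and for the binary digits of u the sum is u itself. *)
Lemma real_of_bits_uniform (d : measure_display) (T : measurableType d)
    (P : probability T R) (b : nat -> T -> bool) :
  (forall n, measurable_fun setT (b n)) -> independent P b ->
  (forall n B, P (b n @^-1` B) = unit_prob R (@binary_digit R n @^-1` B)) ->
  forall A, measurable A ->
    P [set t | A (real_of_bits (b ^~ t))] = unit_prob R A.
Proof.
move=> mb indb lawb A mA.
pose coord := fun (k : nat) (x : nat -> bool) => x k.
pose gens := \bigcup_(j in setT) preimage_set_system setT (coord j) (@measurable _ bool).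
pose W : measurableType _ := g_sigma_algebraType gens.
have mD : generated_by coord setT [set z | A (real_of_bits z)].
  have := @real_of_bits_measurable _ W coord.
  move=> /(_ _ measurableT A mA); rewrite setTI; apply => n _ B mB.
  by rewrite setTI; apply: generated_by_coordinate.
rewrite (@law_unique_cylinder R nat _ _ _ T (measurableTypeR R) bool P (unit_prob R)
   b (@binary_digit R) mb (@binary_digit_measurable R) _ _ mD); last first.
  move=> J B uJ mB; rewrite indb // binary_digit_independent //.
  by apply: eq_bigr => k _; exact: lawb.
have mA' : measurable [set t : measurableTypeR R | A (real_of_bits (@binary_digit R ^~ t))].
  have := @real_of_bits_measurable _ (measurableTypeR R) (@binary_digit R) (@binary_digit_measurable R).
  by move=> /(_ measurableT A mA); rewrite setTI.
rewrite unit_prob_restrict // [RHS]unit_prob_restrict //; congr (unit_prob R _).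
apply/seteqP; split => u [Au u01]; split=> //;
    have v01 : 0 <= u < 1 by move: u01; rewrite /= in_itv.
  by rewrite -(real_of_binary_digits v01).
by rewrite /mkset real_of_binary_digits.
Qed.

Lemma binary_digit_lawE n m B :
  unit_prob R (@binary_digit R n @^-1` B) = unit_prob R (@binary_digit R m @^-1` B).
Proof. by rewrite !binary_digit_law. Qed.

(** The integers are injected into nat to index the bits. *)
Definition fair_bit (i : int) : {RV (unit_prob R) >-> bool} :=
  mfun_Sub (mem_set (@binary_digit_measurable R (choice.pickle i))).

Lemma fair_bit_independent : independent (unit_prob R) (fun i => fair_bit i : _ -> _).
Proof.
apply: (independent_reindex (pcan_inj (@choice.pickleK int)) (@binary_digit_independent R)).
Qed.

Lemma iid_fair_bits_exist : iid_fair_bits fair_bit.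
Proof.
apply: independent_iid; first exact: fair_bit_independent.
move=> i A mA.
have := @eq_bernoulliV2 R (distribution (unit_prob R) (fair_bit i)).
rewrite /distribution /pushforward; apply.
rewrite /= !binary_digit_law !big_cons !big_nil.
rewrite (@asboolT (true = true)) // (@asboolT (false = false)) //.
by rewrite (@asboolF (true = false)) // (@asboolF (false = true)) //= !(mulr0, addr0, add0r).
Qed.

(** Each variable uses its own infinite block of bits. *)
Definition uniform_variable (i : int) (t : measurableTypeR R) : R :=
  real_of_bits (fun j => fair_bit (Posz (choice.pickle (i, j))) t).

Let block (i : int) : set int := [set k | exists j : nat, k = Posz (choice.pickle (i, j))].

Lemma uniform_variable_block i A : measurable A ->
  generated_by (fun k => fair_bit k : _ -> _) (block i) (uniform_variable i @^-1` A).
Proof.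
move=> mA.
pose gens := \bigcup_(j in block i)
  preimage_set_system setT (fair_bit j : measurableTypeR R -> bool) (@measurable _ bool).
pose W : measurableType _ := g_sigma_algebraType gens.
have := @real_of_bits_measurable _ W (fun j => fair_bit (Posz (choice.pickle (i, j)))).
move=> /(_ _ measurableT A mA); rewrite setTI; apply => n _ B mB.
rewrite setTI.
by apply: (generated_by_coordinate (X := fun k => fair_bit k : _ -> _)) => //; exists n.
Qed.

Lemma uniform_variable_measurable i : measurable_fun setT (uniform_variable i).
Proof. by apply: real_of_bits_measurable => n; exact: measurable_funPT. Qed.

Definition uniform_RV (i : int) : {RV (unit_prob R) >-> R} :=
  mfun_Sub (mem_set (uniform_variable_measurable i)).

Lemma iid_uniform01_exist : iid_uniform01 uniform_RV.
Proof.
have pinj : injective (fun ij : int * nat => Posz (choice.pickle ij)).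
  by move=> x y [] /(pcan_inj (@choice.pickleK _)).
apply: independent_iid.
  apply: (independent_blocks _ fair_bit_independent (block := block)).
  - by move=> k; exact: binary_digit_measurable.
  - by move=> i j k [m ->] [n] /pinj[->].
  - by move=> i A; exact: uniform_variable_block.
move=> i A mA.
apply: (real_of_bits_uniform (b := fun j => fair_bit (Posz (choice.pickle (i, j))))) => //.
- apply: (independent_reindex (c := fun j => Posz (choice.pickle (i, j))) _ fair_bit_independent).
  by move=> m n /pinj[].
by move=> n B; exact: binary_digit_lawE.
Qed.

End RealOfBits.

(** * Laws of 0/1 processes *)

Definition all_true (S : Type) (J : int -> S -> bool) (s : seq int) : set S :=
  [set t | all (J ^~ t) s].

Lemma all_true_nil S (J : int -> S -> bool) : all_true J [::] = setT.
Proof. by apply/seteqP; split. Qed.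

Lemma all_true_cat S (J : int -> S -> bool) s1 s2 :
  all_true J (s1 ++ s2) = all_true J s1 `&` all_true J s2.
Proof.
by apply/seteqP; split => t; rewrite /all_true /= all_cat => /andP.
Qed.

Lemma all_true_eq S (J : int -> S -> bool) s1 s2 :
  s1 =i s2 -> all_true J s1 = all_true J s2.
Proof. by move=> E; apply/seteqP; split => t; rewrite /all_true /= (eq_all_r E). Qed.

Lemma all_true_generated (K : Type) (S : pointedType) (e : measure_display) (E : measurableType e)
    (X : K -> S -> E) (I : set K) (J : int -> S -> bool) (s : seq int) :
  (forall i, i \in s -> generated_by X I [set t | J i t]) ->
  generated_by X I (all_true J s).
Proof.
elim: s => [|i s IH] sub.
  rewrite all_true_nil; exact: generated_by_setT.
rewrite -cat1s all_true_cat; apply: generated_by_setI.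
  rewrite (_ : all_true J [:: i] = [set t | J i t]).
    by apply: sub; rewrite mem_head.
  by apply/seteqP; split => t; rewrite /all_true /= andbT.
by apply: IH => j js; apply: sub; rewrite inE js orbT.
Qed.

Section BoolLaw.
Context (R : realType) (d d' : measure_display)
  (T : measurableType d) (T' : measurableType d').
Variables (P : probability T R) (P' : probability T' R).

(** Inclusion-exclusion in disguise: the events of being true on a finite set
    form a pi-system generating all events. *)
Lemma bool_law_unique (J : int -> T -> bool) (J' : int -> T' -> bool) :
  (forall i, measurable_fun setT (J i)) ->
  (forall i, measurable_fun setT (J' i)) ->
  (forall s, P (all_true J s) = P' (all_true J' s)) ->
  equal_in_law P J P' J'.
Proof.
move=> mJ mJ' PJ; pose coord := fun (k : int) (x : int -> bool) => x k.
pose G := [set C | exists s, C = all_true coord s].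
apply: (@law_unique R d d' T T' P P' int _ bool J J' G) => //.
- move=> _ [s ->]; apply: all_true_generated => i _.
  exact: (generated_by_coordinate (X := coord) (j := i) (C := [set true])).
- by move=> _ _ [s1 ->] [s2 ->]; exists (s1 ++ s2); rewrite all_true_cat.
- by exists [::]; rewrite all_true_nil.
- move=> k C _; set W := g_sigma_algebraType G.
  have mT : measurable ([set x : W | coord k x] : set W).
    apply: sub_sigma_algebra; exists [:: k]; apply/seteqP.
    by split => t; rewrite /all_true /= andbT.
  have [Ct|Ct] := pselect (C true); have [Cf|Cf] := pselect (C false).
  + rewrite (_ : _ @^-1` _ = setT); first exact: (@measurableT _ W).
    by apply/seteqP; split => x; rewrite /preimage /coord /=; case: (x k).
  + rewrite (_ : _ @^-1` _ = [set x | coord k x]) //.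
    by apply/seteqP; split => x; rewrite /preimage /coord /=; case: (x k).
  + rewrite (_ : _ @^-1` _ = ~` [set x | coord k x]); first exact: (@measurableC _ W).
    by apply/seteqP; split => x; rewrite /preimage /coord /=; case: (x k).
  + rewrite (_ : _ @^-1` _ = set0); first exact: (@measurable0 _ W).
    by apply/seteqP; split => x; rewrite /preimage /coord /=; case: (x k).
by move=> _ [s ->]; exact: PJ.
Qed.

(** The part of k-dependence that concerns the events of being true on
    finite sets. *)
Definition gap_independent (k : nat) (dd : measure_display) (S : measurableType dd)
    (Q : probability S R) (J : int -> S -> bool) :=
  forall (i : int) s1 s2, all (fun j => j < i) s1 -> all (fun j => i + k%:Z <= j) s2 ->
    Q (all_true J (s1 ++ s2)) = (Q (all_true J s1) * Q (all_true J s2))%E.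

(** Cutting a finite set wherever a gap exceeds k factors the probability on
    both sides. *)
Lemma cluster_law_unique (k : nat) (J : int -> T -> bool) (J' : int -> T' -> bool) :
  (forall i, measurable_fun setT (J i)) ->
  (forall i, measurable_fun setT (J' i)) ->
  gap_independent k P J -> gap_independent k P' J' ->
  (forall i s, path (fun x y => x < y <= x + k%:Z) i s ->
     P (all_true J (i :: s)) = P' (all_true J' (i :: s))) ->
  equal_in_law P J P' J'.
Proof.
move=> mJ mJ' indJ indJ' cl; apply: bool_law_unique => // s.
pose s' := sort <=%R (undup s).
have ss' : s' =i s by move=> x; rewrite mem_sort mem_undup.
rewrite -(all_true_eq J ss') -(all_true_eq J' ss').
have : sorted <%R s' by rewrite sort_lt_sorted undup_uniq.
move: s' ss' => {}s _; case: s => [|x s]; first by rewrite !all_true_nil !probability_setT.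
have clP C y : sorted (fun x y => x < y <= x + k%:Z) (rcons C y) ->
    P (all_true J (rcons C y)) = P' (all_true J' (rcons C y)).
  by case: C => [|c C]; [exact: cl|rewrite rcons_cons; exact: cl].
suff main C y : sorted (fun x y => x < y <= x + k%:Z) (rcons C y) ->
    sorted <%R (rcons C y) -> path <%R y s ->
    P (all_true J (rcons C y ++ s)) = P' (all_true J' (rcons C y ++ s)).
  by move=> /= xs; exact: (main [::] x).
elim: s C y => [|z s IH] C y Cy Cs /=; first by rewrite cats0 => _; exact: clP.
move=> /andP[yz zs]; have [zk|zk] := leP z (y + k%:Z).
  rewrite -cat_rcons; apply: IH => //.
    move: Cy; case: (C) => [|c C'] /=; first by rewrite yz zk.
    by rewrite !rcons_path last_rcons => ->; rewrite yz zk.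
  move: Cs; case: (C) => [|c C'] /=; first by rewrite yz.
  by rewrite !rcons_path last_rcons => ->; rewrite yz.
have lt1 : all (fun j => j < y + 1) (rcons C y).
  rewrite all_rcons ltrDl ltr01 /=; apply/allP => c cC.
  suff : c < y by lia.
  move: Cs; rewrite lt_sorted_pairwise -cats1 pairwise_cat => /and3P[/allrelP + _ _].
  by apply => //; rewrite inE.
have lt2 : all (fun j => y + 1 + k%:Z <= j) (z :: s).
  apply/allP => c; rewrite inE => /orP[/eqP ->|cs]; first by lia.
  suff : z < c by lia.
  by move: zs; rewrite lt_path_sortedE => /andP[/allP/(_ _ cs)].
rewrite (indJ (y + 1)) // (indJ' (y + 1)) //; congr (_ * _)%E; first exact: clP.
exact: (IH [::] z).
Qed.

End BoolLaw.

(** * Order patterns of independent uniform variables *)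

Definition decreasing_along (R : realType) (K S : Type) (X : K -> S -> R) (s : seq K) : set S :=
  [set t | sorted >%R [seq X k t | k <- s]].

Section Measurable.
Context (R : realType) (K : Type) (d : measure_display) (T : measurableType d).
Variable X : K -> T -> R.

Lemma measurable_gt (i j : K) : measurable_fun setT (X i) -> measurable_fun setT (X j) ->
  measurable [set t | X i t > X j t].
Proof.
move=> mi mj; have := @measurable_fun_ltr _ _ _ setT (X j) (X i) mj mi measurableT [set true] I.
by rewrite setTI.
Qed.

Lemma measurable_decreasing (s : seq K) : (forall k, measurable_fun setT (X k)) ->
  measurable (decreasing_along X s).
Proof.
move=> mX; case: s => [|k s].
  by rewrite (_ : decreasing_along X [::] = setT) //; apply/seteqP; split.
elim: s k => [|j s IH] k.
  by rewrite (_ : decreasing_along X [:: k] = setT) //; apply/seteqP; split.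
rewrite (_ : decreasing_along X [:: k, j & s] =
  [set t | X k t > X j t] `&` decreasing_along X (j :: s)).
  by apply: measurableI => //; exact: measurable_gt.
by apply/seteqP; split => t; rewrite /decreasing_along /= => /andP.
Qed.

End Measurable.

Lemma uniq_map_inj (A B : eqType) (f : A -> B) (s : seq A) :
  uniq (map f s) -> {in s &, injective f}.
Proof.
elim: s => [//|z s IH] /= /andP[zs us] x y; rewrite !inE.
move=> /predU1P[->|xs] /predU1P[->|ys] // e; last exact: IH.
  by move: zs; rewrite e map_f.
by move: zs; rewrite -e map_f.
Qed.

Section UniformOrder.
Context (R : realType) (d : measure_display) (T : measurableType d)
  (P : probability T R).
Variable U : int -> {RV P >-> R}.
Hypothesis iidU : iid_uniform01 U.

Let X (i : int) : T -> R := U i.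
Let mX i : measurable_fun setT (X i). Proof. exact: measurable_funPT. Qed.
Let indX : independent P X. Proof. exact: iid_independent iidU. Qed.
Let lawX i A : measurable A -> P (X i @^-1` A) = unit_prob R A.
Proof. by move=> mA; have [_ /(_ i A mA)] := iidU. Qed.

(** Both subfamilies are independent with the same marginals. *)
Lemma decreasing_along_exchangeable (s s' : seq int) :
  uniq s -> uniq s' -> size s = size s' ->
  P (decreasing_along X s) = P (decreasing_along X s').
Proof.
move=> us us' ss; pose n := size s.
have E (r : seq int) : size r = n -> decreasing_along X r =
    [set t | decreasing_along (fun (k : 'I_n) (x : 'I_n -> R) => x k) (enum 'I_n)
               ((fun k : 'I_n => X (nth 0 r k)) ^~ t)].
  move=> sr; apply/seteqP.
  have F t : [seq X k t | k <- r] = [seq X (nth 0 r (val k)) t | k <- enum 'I_n].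
    transitivity (map (X^~ t) (mkseq (nth 0 r) n)); first by rewrite -sr mkseq_nth.
    by rewrite /mkseq -val_enum_ord -!map_comp.
  by split => t; rewrite /decreasing_along /= F.
rewrite (E s) // (E s') //.
have inj (r : seq int) : size r = n -> uniq r -> injective (fun k : 'I_n => nth 0 r k).
  move=> sr ur i j /eqP; rewrite nth_uniq ?sr // => /eqP; exact: val_inj.
apply: (law_unique_cylinder (P := P) (P' := P) (K := 'I_n)).
- by move=> k; exact: mX.
- by move=> k; exact: mX.
- move=> J A uJ mA.
  rewrite (independent_reindex (inj s erefl us) indX) //.
  rewrite (independent_reindex (inj s' (esym ss) us') indX) //.
  by apply: eq_bigr => k _; rewrite !lawX.
pose coord := fun (k : 'I_n) (x : 'I_n -> R) => x k.
pose gens := \bigcup_(j in setT) preimage_set_system setT (coord j) (@measurable _ R).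
apply: (@measurable_decreasing R _ _ (g_sigma_algebraType gens) coord (enum 'I_n)) => k _ B mB.
by rewrite setTI; apply: generated_by_coordinate.
Qed.

(** Up to a null set, a tie puts both variables in the same one of N + 1 equal
    cells, which has probability 1 / (N + 1). *)
Lemma ties_null (i j : int) : i != j -> P [set t | X i t = X j t] = 0%E.
Proof.
move=> ij; set D := [set t | _].
have mD : measurable D.
  rewrite (_ : D = ~` ([set t | X i t > X j t] `|` [set t | X j t > X i t])).
    by apply: measurableC; apply: measurableU; exact: measurable_gt.
  apply/seteqP; split => [t /= tD [] /=|t /= nt]; rewrite ?tD ?ltxx //.
  apply/eqP; rewrite eq_le; apply/andP; split; rewrite leNgt; apply/negP => h;
    apply: nt; [by left|by right].
pose I : set R := `[0, 1[%classic.
have mI : measurable I by exact: measurable_itv.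
have PI : P (X i @^-1` I) = 1%E.
  rewrite lawX //; have := @unit_prob_itv R 0 1 (lexx _) ler01.
  by rewrite add0r => ->.
have step N : (P D <= (N.+1%:R^-1)%:E)%E.
  pose c : R := N.+1%:R^-1.
  have c0 : 0 < c by rewrite /c invr_gt0 ltr0n.
  have Nc : N.+1%:R * c = 1 by rewrite /c divff // pnatr_eq0.
  have kc k : k%:R * c + c = k.+1%:R * c by rewrite -natr1 mulrDl mul1r.
  pose B (k : nat) : set R := `[k%:R * c, (k%:R * c + c)[%classic.
  have mB k : measurable (B k) by exact: measurable_itv.
  have PB l k : (k < N.+1)%N -> P (X l @^-1` B k) = c%:E.
    move=> kN; rewrite lawX // unit_prob_itv //; [by rewrite mulr_ge0 // ltW|exact: ltW|].
    by rewrite kc -[leRHS]Nc ler_pM2r // ler_nat.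
  have mI' : measurable (X i @^-1` I) by rewrite -[_ @^-1` _]setTI; exact: mX.
  rewrite -(probability_setI_full mD mI' PI).
  rewrite (@measure_partition _ _ _ P _ (iota 0 N.+1) (fun k => X i @^-1` B k)) //.
  - apply: (@le_trans _ _ (\sum_(k <- iota 0 N.+1) (c * c)%:E)%E).
      rewrite big_seq [leRHS]big_seq; apply: lee_sum => k.
      rewrite mem_iota /= add0n => kN.
      have uij : uniq [:: i; j] by rewrite /= inE ij.
      have := @indX [:: i; j] (fun=> B k) uij (fun=> mB k).
      rewrite !big_cons big_nil mule1 !PB // -EFinM => <-.
      apply: le_measure; rewrite ?inE.
      + apply: measurableI; first exact: measurableI.
        by rewrite -[_ @^-1` _]setTI; exact: mX.
      + apply: (generated_by_measurable mX (I := setT)); exact: cylinder_generated.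
      + move=> t [[/= Dt _] Bt] l; rewrite !inE => /orP[]/eqP -> //.
        by rewrite -Dt.
    rewrite sumEFin lee_fin big_const_seq count_predT size_iota iter_addr_0.
    by rewrite -[leLHS]mulr_natl mulrA Nc mul1r.
  - exact: iota_uniq.
  - exact: measurableI.
  - by move=> k; rewrite -[_ @^-1` _]setTI; exact: mX.
  - move=> k l t _ _; rewrite /B /= !in_itv /= !kc => /andP[k1 k2] /andP[l1 l2].
    have := le_lt_trans k1 l2; have := le_lt_trans l1 k2.
    by rewrite !ltr_pM2r // !ltr_nat; lia.
  move=> t [_]; rewrite /I /= in_itv /= => /andP[t0 t1].
  have u0 : 0 <= X i t * N.+1%:R by rewrite mulr_ge0.
  have /andP[k1 k2] := truncn_itv u0.
  exists (Num.truncn (X i t * N.+1%:R)).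
    rewrite -[0%N :: iota 1 N]/(iota 0 N.+1) mem_iota add0n /= -(ltr_nat R) (le_lt_trans k1) //.
    by rewrite -[ltRHS]mul1r ltr_pM2r // ltr0n.
  have E : X i t = X i t * N.+1%:R * c by rewrite -mulrA Nc mulr1.
  rewrite /B /= in_itv /=; apply/andP; split; first by rewrite [leRHS]E ler_pM2r.
  by rewrite kc [ltLHS]E ltr_pM2r.
have Pfin : P D = (fine (P D))%:E by rewrite fineK // fin_num_measure.
rewrite Pfin; move: step; rewrite Pfin; set r := fine _ => step.
have : 0 <= r by rewrite /r fine_ge0.
rewrite le_eqVlt => /predU1P[<-//|r0].
have := step (Num.truncn r^-1); rewrite lee_fin leNgt => /negP[].
rewrite invf_plt ?posrE ?ltr0n //.
have ri : 0 <= r^-1 by rewrite invr_ge0 ltW.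
by have /andP[_] := truncn_itv ri.
Qed.

Definition distinct_along (s : seq int) : set T := [set t | uniq [seq X i t | i <- s]].

Lemma distinct_along_full (s : seq int) : uniq s ->
  measurable (distinct_along s) /\ P (distinct_along s) = 1%E.
Proof.
have mneq i j : measurable (~` [set t | X i t = X j t]).
  rewrite (_ : ~` _ = [set t | X i t > X j t] `|` [set t | X j t > X i t]).
    by apply: measurableU; exact: measurable_gt.
  apply/seteqP; split => [t /= /eqP|t /= []]; rewrite ?neq_lt.
  - by move=> /orP[]; [right|left].
  - by move=> h e; rewrite e ltxx in h.
  - by move=> h e; rewrite e ltxx in h.
elim: s => [_|i s IH /= /andP[is_ /IH[ms Ps]]].
  rewrite (_ : distinct_along [::] = setT); last by apply/seteqP; split.
  by split; [|rewrite probability_setT].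
pose N s := [set t | X i t \notin [seq X j t | j <- s]].
have NP r : {subset r <= s} -> measurable (N r) /\ P (N r) = 1%E.
  elim: r => [|j r IHr] sub.
    rewrite (_ : N [::] = setT); last by apply/seteqP; split.
    by split; [|rewrite probability_setT].
  have [|mr Pr] := IHr; first by move=> k kr; apply: sub; rewrite inE kr orbT.
  have ij : i != j by apply: contraNneq is_ => ->; apply: sub; rewrite mem_head.
  rewrite (_ : N (j :: r) = ~` [set t | X i t = X j t] `&` N r); last first.
    apply/seteqP; split => t; rewrite /N /= inE negb_or.
      by move=> /andP[/eqP ? ?].
    by move=> [/eqP -> ->].
  split; first exact: measurableI.
  rewrite probability_setI_full // probability_setC; first by rewrite ties_null // sube0.
  by rewrite -[X in measurable X]setCK; apply: measurableC; exact: mneq.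
have [mN PN] := NP s (fun _ => id).
rewrite (_ : distinct_along (i :: s) = N s `&` distinct_along s); last first.
  by apply/seteqP; split => t; rewrite /distinct_along /N /= => /andP.
by split; [exact: measurableI|rewrite probability_setI_full].
Qed.

Lemma sorted_along t (s : seq int) : decreasing_along X s t ->
  sorted (relpre (X^~ t) >%R) s.
Proof. by rewrite /decreasing_along /= sorted_map. Qed.

Lemma decreasing_along_partition (s : seq int) (D : set T) : uniq s -> measurable D ->
  P D = (\sum_(s' <- permutations s) P (D `&` decreasing_along X s'))%E.
Proof.
move=> us mD; have [ms Ps] := distinct_along_full us.
rewrite -(probability_setI_full mD ms Ps).
rewrite (@measure_partition _ _ _ P _ (permutations s) (decreasing_along X)).
- apply: eq_big_seq => s'; rewrite mem_permutations => ss'.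
  congr (P _); apply/seteqP; split => [t [[]]//|t [Dt s't]]; split => //; split => //.
  rewrite /distinct_along /= -(perm_uniq (perm_map (X^~ t) ss')).
  exact: (sorted_uniq (leT := >%R) (rev_trans lt_trans) ltxx).
- exact: permutations_uniq.
- exact: measurableI.
- by move=> s'; exact: measurable_decreasing.
- move=> s1 s2 t; rewrite !mem_permutations => p1 p2 /sorted_along d1 /sorted_along d2.
  apply: (irr_sorted_eq _ _ d1 d2).
  + by move=> x y z /= xy yz; exact: lt_trans yz xy.
  + by move=> x /=; exact: ltxx.
  by move=> x; rewrite (perm_mem p1) (perm_mem p2).
(* Without ties, sorting s by value gives the ordering that holds. *)
move=> t [_ ut]; set r := sort (relpre (X^~ t) <=%R) s.
have rs : perm_eq r s by rewrite /r perm_sort.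
exists (rev r); first by rewrite mem_permutations perm_rev.
rewrite /decreasing_along /= map_rev rev_sorted.
rewrite (_ : sorted _ _ = sorted <%R [seq X i t | i <- r]) // lt_sorted_uniq_le.
rewrite (perm_uniq (perm_map (X^~ t) rs)) ut /= sorted_map.
by apply: sort_sorted => x y /=; exact: le_total.
Qed.

(** The orderings of s are equally likely and, up to ties, partition the
    space. *)
Lemma probability_decreasing (s : seq int) : uniq s ->
  P (decreasing_along X s) = ((size s)`!%:R^-1)%:E.
Proof.
move=> us; pose p := fine (P (decreasing_along X s)).
have pE : P (decreasing_along X s) = p%:E.
  by rewrite /p fineK // fin_num_measure //; exact: measurable_decreasing.
have := decreasing_along_partition us (@measurableT _ T).
rewrite probability_setT; under eq_big_seq => s' ss'.
  rewrite setTI (@decreasing_along_exchangeable s' s) ?pE //; first over.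
  - by rewrite (perm_uniq (s2 := s)) // -mem_permutations.
  - by apply: perm_size; rewrite -mem_permutations.
rewrite sumEFin big_const_seq count_predT iter_addr_0 size_permutations // => -[E].
rewrite pE; congr (_%:E); rewrite -[LHS]mulr1 -[X in _ * X](mulfV (x := (size s)`!%:R)).
  by rewrite mulrA mulr_natr -E mul1r.
by rewrite pnatr_eq0 -lt0n fact_gt0.
Qed.

Definition order_determined (L : seq int) (A : set T) : Prop :=
  forall t t', (forall i j, i \in L -> j \in L -> (X i t < X j t) = (X i t' < X j t')) ->
    A t -> A t'.

(** Up to ties A is a union of complete orderings of L, each of probability
    1 / n!; adding w on top of such an ordering gives an ordering of n + 1 variables. *)
Lemma probability_order_max (L : seq int) (w : int) (A : set T) :
  uniq L -> w \notin L -> measurable A -> order_determined L A ->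
  P (A `&` [set t | forall i, i \in L -> X i t < X w t]) =
  ((size L).+1%:R^-1%:E * P A)%E.
Proof.
move=> uL wL mA detA; set M := [set t | _].
have mM : measurable M.
  rewrite (_ : M = \bigcap_(i in [set` L]) [set t | X i t < X w t]).
    by apply: fin_bigcap_measurable => // i _; exact: measurable_gt.
  by apply/seteqP; split => t tM i; exact: tM.
rewrite (decreasing_along_partition uL mA).
rewrite (decreasing_along_partition uL (measurableI _ _ mA mM)).
rewrite ge0_sume_distrr; last by move=> s _; exact: measure_ge0.
apply: eq_big_seq => s; rewrite mem_permutations => sL.
have us : uniq s by rewrite (perm_uniq sL).
have [[t0 [At0 st0]]|no] := pselect (exists t, A t /\ decreasing_along X s t); last first.
  rewrite (_ : A `&` decreasing_along X s = set0); last first.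
    by apply/seteqP; split => // t [At st]; apply: no; exists t.
  rewrite (_ : A `&` M `&` decreasing_along X s = set0) ?measure0 ?mule0 //.
  by apply/seteqP; split => // t [[At _] st]; apply: no; exists t.
have sA t : decreasing_along X s t -> A t.
  move=> st; apply: detA At0 => i j; rewrite -!(perm_mem sL) => is_ js.
  have dec u : decreasing_along X s u ->
      forall x y, x \in s -> y \in s -> (index x s < index y s)%N -> X y u < X x u.
    move=> /sorted_along su x y xs ys.
    apply: (sorted_ltn_index _ su) => // a b c /= ab bc; exact: lt_trans bc ab.
  have [h|h|h] := ltngtP (index i s) (index j s).
  - by rewrite !ltNge !ltW //; exact: dec.
  - by rewrite !dec.
  - have -> : i = j by rewrite -(nth_index 0 is_) h nth_index.
    by rewrite !ltxx.
rewrite (_ : A `&` decreasing_along X s = decreasing_along X s); last first.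
  by apply/seteqP; split => [t []//|t st]; split => //; exact: sA.
rewrite (_ : A `&` M `&` decreasing_along X s = decreasing_along X (w :: s)); last first.
  apply/seteqP; split => [t [[At Mt] st]|t].
    move: st; rewrite /decreasing_along /=; case: (s) sL => [//|x s'] sL /= ->.
    by rewrite andbT; apply: Mt; rewrite -(perm_mem sL) mem_head.
  rewrite /decreasing_along /= (path_sortedE (leT := >%R)); last first.
    by move=> x y z xy yz; exact: lt_trans yz xy.
  move=> /andP[/allP ws st]; split=> //; split; first exact: sA.
  move=> i; rewrite -(perm_mem sL) => is_; apply: ws; exact: map_f.
rewrite !probability_decreasing //=; last by rewrite us (perm_mem sL) wL.
rewrite (perm_size sL) factS natrM invfM -EFinM; congr (_%:E).
Qed.

(** Peaks at a + 1, a + 3, ..., a + 2k - 1. *)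
Definition zigzag (a : int) (k : nat) : set T :=
  [set t | forall j : nat, (j < k)%N ->
     X (a + j.*2%:Z) t < X (a + j.*2.+1%:Z) t /\
     X (a + j.*2.+2%:Z) t < X (a + j.*2.+1%:Z) t].

Lemma zigzag_generated (a : int) (k : nat) :
  generated_by X [set i | a <= i <= a + k.*2%:Z] (zigzag a k).
Proof.
pose gens := \bigcup_(j in [set i | a <= i <= a + k.*2%:Z])
  preimage_set_system setT (X j) (@measurable _ R).
pose W : measurableType _ := g_sigma_algebraType gens.
have mXW i : a <= i <= a + k.*2%:Z -> measurable_fun setT (X i : W -> R).
  by move=> ik _ B mB; rewrite setTI; apply: generated_by_coordinate.
change (measurable (zigzag a k : set W)).
rewrite (_ : zigzag a k = \bigcap_(j in `I_k)
   ([set t | X (a + j.*2%:Z) t < X (a + j.*2.+1%:Z) t] `&`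
    [set t | X (a + j.*2.+2%:Z) t < X (a + j.*2.+1%:Z) t])) //.
apply: fin_bigcap_measurable => // j /= jk.
by apply: measurableI; apply: (@measurable_gt R int _ W X); apply: mXW; lia.
Qed.

Lemma zigzag_measurable a k : measurable (zigzag a k).
Proof. by apply: (generated_by_measurable mX); exact: zigzag_generated. Qed.

(** Around the largest variable the two inequalities are automatic, which
    decouples the left and the right part. *)
Lemma zigzag_split_at_max (a : int) (k j : nat) (L : seq int) (w := a + j.*2.+1%:Z)
    (M := [set t | forall i, i \in L -> X i t < X w t]) :
  (j <= k)%N ->
  (forall i, (i \in L) = (a <= i <= a + k.+1.*2%:Z) && (i != w)) ->
  zigzag a k.+1 `&` M = zigzag a j `&` zigzag (w + 1) (k - j) `&` M.
Proof.
move=> jk LE; apply/seteqP; split => [t [zt Mt]|t [[zl zr] Mt]]; split => //.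
  split=> i ik; first by apply: zt; lia.
  have e0 : w + 1 + i.*2%:Z = a + (j + i.+1).*2%:Z by rewrite /w; lia.
  have e1 : w + 1 + i.*2.+1%:Z = a + (j + i.+1).*2.+1%:Z by rewrite /w; lia.
  have e2 : w + 1 + i.*2.+2%:Z = a + (j + i.+1).*2.+2%:Z by rewrite /w; lia.
  by rewrite e0 e1 e2; apply: zt; lia.
move=> i ik; have [ij|ij|->] := ltngtP i j.
- exact: zl.
- have e0 : a + i.*2%:Z = w + 1 + (i - j.+1).*2%:Z by rewrite /w; lia.
  have e1 : a + i.*2.+1%:Z = w + 1 + (i - j.+1).*2.+1%:Z by rewrite /w; lia.
  have e2 : a + i.*2.+2%:Z = w + 1 + (i - j.+1).*2.+2%:Z by rewrite /w; lia.
  by rewrite e0 e1 e2; apply: zr; lia.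
by split; apply: Mt; rewrite LE /w; lia.
Qed.

(** Decomposition according to the position of the maximum, which is
    necessarily one of the k + 1 peaks. *)
Lemma probability_zigzagS (a : int) (k : nat) :
  P (zigzag a k.+1) = (\sum_(j < k.+1) (2 * k.+1 + 1)%:R^-1%:E *
     (P (zigzag a j) * P (zigzag (a + j.*2.+2%:Z) (k - j))))%E.
Proof.
pose win := [seq a + i%:Z | i <- iota 0 k.+1.*2.+1].
have winE i : (i \in win) = (a <= i <= a + k.+1.*2%:Z).
  apply/mapP/idP => [[n]|ik]; first by rewrite mem_iota => nk ->; lia.
  by exists (absz (i - a)); rewrite ?mem_iota; lia.
have uwin : uniq win.
  by rewrite map_inj_uniq ?iota_uniq // => m n; lia.
pose w (j : nat) := a + j.*2.+1%:Z.
pose L j := rem (w j) win.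
have LE j i : (i \in L j) = (a <= i <= a + k.+1.*2%:Z) && (i != w j).
  by rewrite /L (rem_filter _ uwin) mem_filter /= andbC winE.
pose M (j : nat) := [set t | forall i, i \in L j -> X i t < X (w j) t].
have mM j : measurable (M j).
  rewrite (_ : M j = \bigcap_(i in [set` L j]) [set t | X i t < X (w j) t]).
    by apply: fin_bigcap_measurable => // i _; exact: measurable_gt.
  by apply/seteqP; split => t tM i; exact: tM.
have [mD PD] := distinct_along_full uwin.
have mz := zigzag_measurable.
rewrite -(probability_setI_full (mz a k.+1) mD PD).
rewrite (@measure_partition _ _ _ P _ (iota 0 k.+1) M) ?iota_uniq //; first last.
- move=> t [zt Dt].
  (* The maximum over the window is at a peak: a site at even distance from a has
     a larger neighbour. *)
  have : exists2 i, i \in win & forall i', i' \in win -> X i' t <= X i t.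
    have : win != [::] by rewrite -size_eq0 size_map size_iota.
    elim: (win) => [//|i s IH] _; case: s IH => [|i2 s] IH.
      by exists i; rewrite ?mem_head // => i'; rewrite inE => /eqP ->.
    have [//|i0 i0s max0] := IH; have [h|h] := leP (X i t) (X i0 t).
      exists i0; first by rewrite inE i0s orbT.
      by move=> i'; rewrite inE => /orP[/eqP -> //|]; exact: max0.
    exists i; first exact: mem_head.
    move=> i'; rewrite inE => /orP[/eqP -> //|/max0]; move=> h'.
    exact: le_trans h' (ltW h).
  move=> [i iw imax].
  have [n [nk iE]] : exists n, (n <= k.+1.*2)%N /\ i = a + n%:Z.
    by move: iw; rewrite winE => ik; exists (absz (i - a)); lia.
  have not_even m : n = m.*2 -> False.
    move=> nm; have [mk|mk] := ltnP m k.+1.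
      have [h _] := zt m mk; have := imax (a + m.*2.+1%:Z).
      by rewrite winE iE nm => /(_ ltac:(lia)); rewrite leNgt h.
    have [_ h] := zt k (ltnSn k); have := imax (a + k.*2.+1%:Z).
    rewrite winE iE (_ : n = k.*2.+2); last lia.
    by move=> /(_ ltac:(lia)); rewrite leNgt h.
  have nE : n = (n./2).*2.+1.
    have := odd_double_half n; case: (odd n) => /= E; first by lia.
    by exfalso; apply: (not_even n./2); lia.
  exists n./2; first by rewrite mem_iota; lia.
  move=> i'; rewrite LE -winE => /andP[i'w i'n].
  have wE : w n./2 = i by rewrite /w iE -nE.
  rewrite wE in i'n *; rewrite lt_neqAle imax // andbT; apply: contraNneq i'n => e.
  by rewrite (uniq_map_inj Dt i'w iw e).
- move=> i j t; rewrite !mem_iota => ik jk Mi Mj; apply: contrapT => ij.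
  have wij : w i != w j by apply/eqP => /addrI []; lia.
  have iL : w i \in L j by rewrite LE wij andbT /w; lia.
  have jL : w j \in L i by rewrite LE eq_sym wij andbT /w; lia.
  by have := lt_trans (Mj _ iL) (Mi _ jL); rewrite ltxx.
- exact: measurableI.
rewrite -(big_mkord xpredT (fun j => (2 * k.+1 + 1)%:R^-1%:E *
     (P (zigzag a j) * P (zigzag (a + j.*2.+2%:Z) (k - j))))%E).
rewrite /index_iota subn0; apply: eq_big_seq => j; rewrite mem_iota add0n => jk.
rewrite setIAC (probability_setI_full _ mD PD); last exact: measurableI.
rewrite (@zigzag_split_at_max a k j (L j)) //.
have w1 : w j + 1 = a + j.*2.+2%:Z by rewrite /w; lia.
rewrite probability_order_max.
- congr (_ * _)%E.
    by congr (_%:R^-1%:E); rewrite size_rem ?size_map ?size_iota ?winE /w; lia.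
  rewrite -w1; apply: (indep_cylinder mX indX
    (I1 := [set i | i < w j]) (I2 := [set i | i > w j])).
  + by move=> i /= h1 h2; lia.
  + by move: (@zigzag_generated a j); apply: generated_by_subset => i /=; rewrite /w; lia.
  + by move: (@zigzag_generated (w j + 1) (k - j)); apply: generated_by_subset => i /=; lia.
- exact: rem_uniq.
- by rewrite LE eqxx andbF.
- exact: measurableI.
move=> t t' tt' [zl zr].
have cmp i i' : a <= i <= a + k.+1.*2%:Z -> a <= i' <= a + k.+1.*2%:Z -> i != w j -> i' != w j ->
    X i t < X i' t -> X i t' < X i' t'.
  by move=> ik ik' iw iw'; rewrite tt' // LE ?iw ?iw' ?ik ?ik'.
split => i ik.
  by have [h1 h2] := zl i ik; split; apply: cmp => //; rewrite /w; lia.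
by have [h1 h2] := zr i ik; split; apply: cmp => //; rewrite /w; lia.
Qed.

Lemma probability_zigzag (a : int) (k : nat) :
  P (zigzag a k) = (peak_weight R k)%:E.
Proof.
have [n] := ubnP k; elim: n a k => // n IH a [|k] kn.
  rewrite (_ : zigzag a 0 = setT) ?probability_setT //.
  by apply/seteqP; split => // t _ [].
have n0 : (2 * k.+1 + 1)%:R != 0 :> R by rewrite pnatr_eq0; lia.
rewrite probability_zigzagS.
have -> : peak_weight R k.+1 = (2 * k.+1 + 1)%:R^-1 *
    \sum_(j < k.+1) (peak_weight R j * peak_weight R (k - j)).
  by rewrite -peak_weightS mulrA mulVf // mul1r.
rewrite mulr_sumr -sumEFin; apply: eq_bigr => j _.
rewrite !IH -?EFinM //; have := ltn_ord j; lia.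
Qed.

End UniformOrder.

(** * The coloring processes *)

Lemma mem_letters (q a : nat) : (a \in letters q) = (1 <= a <= q)%N.
Proof. by rewrite mem_iota; lia. Qed.

Lemma map_inj_on (A B : eqType) (D : seq A) (f : A -> B) (x y : seq A) :
  {in D &, injective f} -> all (mem D) x -> all (mem D) y ->
  map f x = map f y -> x = y.
Proof.
move=> fI; elim: x y => [|a x IH] [|b y] //= /andP[aD xD] /andP[bD yD] [fab fxy].
by rewrite (fI a b) // (IH y).
Qed.

Lemma measurable_nat_comp (d e : measure_display) (T : measurableType d)
    (E : measurableType e) (X : T -> nat) (f : nat -> E) :
  measurable_fun setT X -> measurable_fun setT (fun t => f (X t)).
Proof.
by move=> mX mT B mB; apply: (mX mT (f @^-1` B)).
Qed.

Lemma coloring_process_exists (R : realType) (q : nat) : (2 <= q)%N ->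
  exists X : int -> {RV (unit_prob R) >-> nat},
    (forall i t, X i t \in letters q) /\ word_law (weight R q) (unit_prob R) X.
Proof.
move=> q2; apply: (@word_law_exists R (letters q) 1%N).
- exact: letters_uniq.
- by rewrite mem_letters; lia.
- exact: weight_ge0.
- exact: weight_nil.
- by move=> x; exact: sum_weight_rcons.
- by move=> x; exact: sum_weight_cons.
- exact: weight_outside.
Qed.

Section WeightLaw.
Context (R : realType) (d : measure_display) (T : measurableType d)
  (P : probability T R) (q : nat) (X : int -> {RV P >-> nat}).
Hypothesis q_ge2 : (2 <= q)%N.
Hypothesis X_letters : forall i t, X i t \in letters q.
Hypothesis lawX : word_law (weight R q) P X.

Let mX i : measurable_fun setT (X i). Proof. exact: measurable_funPT. Qed.

Lemma weight_law_stationary : stationary X.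
Proof.
apply: word_law_unique lawX _ => //.
move=> a x; rewrite -(lawX (a + 1) x); congr (P _).
have E t : factor (fun i => X (i + 1)) a (size x) t = factor X (a + 1) (size x) t.
  by apply: eq_map => k; rewrite addrAC.
by apply/seteqP; split => t; rewrite /reads /= E.
Qed.

Lemma weight_law_reversible : reversible X.
Proof.
apply: word_law_unique lawX _ => //.
move=> a x; rewrite -weight_rev -(lawX (1 - a - (size x)%:Z)).
have E t : factor X (1 - a - (size x)%:Z) (size x) t =
    rev (factor (fun i => X (- i)) a (size x) t).
  apply: (@eq_from_nth _ 0%N); rewrite ?size_rev ?size_factor // => k kx.
  rewrite nth_factor // nth_rev ?size_factor // nth_factor; last lia.
  by congr (X _ t); lia.
congr (P _); apply/seteqP; split => t; rewrite /reads /= size_rev E.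
  by move=> ->.
by move=> /(congr1 rev); rewrite !revK.
Qed.

(** A bijection of the palette merely renames the letters of a word. *)
Lemma weight_law_symmetric : color_symmetric q X.
Proof.
move=> s [sfun sinj ssurj].
have sq : {in letters q, forall a, s a \in letters q}.
  by move=> a; rewrite !mem_letters; exact: sfun.
have sI : {in letters q &, injective s}.
  move=> a b; rewrite !mem_letters => aq bq; apply: sinj; exact: mem_set.
apply: word_law_unique lawX _ => //.
  by move=> i; apply: measurable_nat_comp; exact: mX.
move=> a x; have [xq|xq] := boolP (all (mem (letters q)) x); last first.
  rewrite weight_outside // (@reads_outside _ (letters q)) // => i t.
  exact: sq.
have [y yq <-] : exists2 y, all (mem (letters q)) y & map s y = x.
  elim: x xq => [|c x IH] /=; first by exists [::].
  move=> /andP[cq /IH[y yq <-]].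
  have [|b /= bq bc] := ssurj c; first by rewrite /palette /= -mem_letters.
  by exists (b :: y); rewrite /= ?bc // yq mem_letters bq.
rewrite weight_map // -(lawX a); congr (P _).
have E t : factor (fun i t => s (X i t)) a (size y) t = map s (factor X a (size y) t).
  by rewrite /factor /mkseq -map_comp.
apply/seteqP; split => t; rewrite /reads /= size_map E; last by move=> ->.
apply: (map_inj_on sI) => //.
by apply/allP => c; rewrite /factor => /mapP[k _ ->]; exact: X_letters.
Qed.

(** Improper words have weight zero. *)
Lemma weight_law_repeat (i : int) : measurable [set t | X i t = X (i + 1) t] /\
  P [set t | X i t = X (i + 1) t] = 0%E.
Proof.
pose Q (x : seq nat) := nth 0%N x 0 == nth 0%N x 1.
have [mQ PQ] := probability_factor (letters_uniq q) mX X_letters (a := i) (n := 2)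
  Q (fun x _ => lawX i x).
have <- : [set t | Q (factor X i 2 t)] = [set t | X i t = X (i + 1) t].
  by apply/seteqP; split => t; rewrite /Q /= addr0 => /eqP.
split=> //; rewrite PQ big1_seq // => x /andP[+ ].
move=> /eqP x01; rewrite mem_words => /andP[/eqP + _]; move: x01.
case: x => [|a [|b [|c x]]] //= -> _; exact: (weight_repeat R q [::]).
Qed.

Lemma weight_law_coloring : coloring q X.
Proof.
split=> [i t|]; first by rewrite /palette /= -mem_letters.
pose F (n : nat) : set T := if @choice.unpickle int n is Some i
  then [set t | X i t = X (i + 1) t] else set0.
apply: (@negligibleS _ _ _ P (\bigcup_n F n)).
  move=> t /= /existsNP[i /contrapT e]; exists (choice.pickle i) => //.
  by rewrite /F choice.pickleK.
apply: negligible_bigcup => n; rewrite /F; case: choice.unpickle => [i|]; last exact: negligible_set0.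
have [mE PE] := weight_law_repeat i.
exact/negligibleP.
Qed.

Lemma weight_law_k_dependent (k : nat) :
  (forall x y, \sum_(z <- words (letters q) k) weight R q (x ++ z ++ y) =
     weight R q x * weight R q y) ->
  k_dependent k X.
Proof.
move=> gap i A B sA sB.
exact: (word_law_k_dependent (letters_uniq q) mX X_letters lawX gap sA sB).
Qed.

End WeightLaw.

Lemma weight4_gap1 (R : realType) x y :
  \sum_(z <- words (letters 4) 1) weight R 4 (x ++ z ++ y) = weight R 4 x * weight R 4 y.
Proof. by rewrite sum_wordsS -sum_weight_gap1; apply: eq_bigr => a _; rewrite sum_words0. Qed.

Lemma weight3_gap2 (R : realType) x y :
  \sum_(z <- words (letters 3) 2) weight R 3 (x ++ z ++ y) = weight R 3 x * weight R 3 y.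
Proof.
rewrite sum_wordsS -sum_weight_gap2; apply: eq_bigr => a _.
by rewrite sum_wordsS; apply: eq_bigr => b _; rewrite sum_words0.
Qed.

(** * Gaps and densities *)

Lemma measurable_fun_indicator (d : measure_display) (T : measurableType d) (J : T -> bool) :
  measurable [set t | J t] -> measurable_fun setT J.
Proof.
move=> mJ; apply: (@measurable_fun_bool _ _ setT J true).
rewrite setTI (_ : _ @^-1` _ = [set t | J t]) //.
Qed.

Section GapIndependent.
Context (R : realType) (d e : measure_display) (T : measurableType d)
  (E : measurableType e) (P : probability T R).

Lemma independent_gap (X : int -> T -> E) (J : int -> T -> bool) (a b : nat) :
  (forall i, measurable_fun setT (X i)) -> independent P X ->
  (forall i, generated_by X [set j | i - a%:Z <= j <= i + b%:Z] [set t | J i t]) ->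
  gap_independent (a + b) P J.
Proof.
move=> mX indX JX i s1 s2 /allP i1 /allP i2; rewrite all_true_cat.
apply: (indep_cylinder mX indX (I1 := [set j | j < i + b%:Z]) (I2 := [set j | i + b%:Z <= j])).
- by move=> j /= h1 h2; lia.
- apply: all_true_generated => j /i1 ji.
  by move: (JX j); apply: generated_by_subset => l /=; lia.
- apply: all_true_generated => j /i2 ji.
  by move: (JX j); apply: generated_by_subset => l /=; lia.
Qed.

Lemma k_dependent_gap (X : int -> {RV P >-> E}) (J : int -> T -> bool) (k : nat) :
  k_dependent k X ->
  (forall i, generated_by (fun i => X i : T -> E) [set i] [set t | J i t]) ->
  gap_independent k P J.
Proof.
move=> depX JX i s1 s2 /allP i1 /allP i2; rewrite all_true_cat.
apply: (depX i).
- apply: (@all_true_generated _ _ _ _ (fun i => X i : T -> E) [set j | j < i]) => j /i1 ji.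
  by move: (JX j); apply: generated_by_subset => l /= ->.
- apply: (@all_true_generated _ _ _ _ (fun i => X i : T -> E) [set j | i + k%:Z <= j]) => j /i2 ji.
  by move: (JX j); apply: generated_by_subset => l /= ->.
Qed.

End GapIndependent.

(** If p = 1/4 + dl, the ratio r of consecutive terms satisfies
    1 - p / r <= r - dl, because r^2 - r + 1/4 >= 0; the ratio would thus become
    negative after finitely many steps. *)
Lemma two_term_recursion_bound (R : realType) (p : R) (u : nat -> R) :
  (forall n, 0 <= u n) -> u 0%N = 1 -> u 1%N = 1 - p -> 0 <= p ->
  (forall n, u n.+2 = u n.+1 - p * u n) -> p <= 4^-1.
Proof.
move=> u0 uE0 uE1 p0 uS; rewrite leNgt; apply/negP => p4.
(* If u (n + 1) vanished, then u (n + 2) = - p u n would be negative. *)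
have pos n : 0 < u n.+1.
  elim: n => [|n IH]; rewrite lt_def u0 andbT; apply/eqP => e.
    have := u0 2%N; rewrite uS e uE0 sub0r mulr1 oppr_ge0 => ple.
    by move: e; rewrite uE1; lra.
  have := u0 n.+3; rewrite uS e sub0r oppr_ge0.
  by rewrite leNgt mulr_gt0 //; lra.
pose dl := p - 4^-1.
have dl0 : 0 < dl by rewrite /dl subr_gt0.
(* The ratio of consecutive terms loses at least dl at each step. *)
have decay n : u n.+1 <= (1 - n%:R * dl) * u n.
  elim: n => [|n IH]; first by rewrite uE1 uE0 mul0r; lra.
  set r := 1 - n%:R * dl in IH.
  have un : 0 < u n by case: (n) => [|m]; rewrite ?uE0.
  have r0 : 0 < r by rewrite -(pmulr_lgt0 _ un); exact: lt_le_trans IH.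
  have r1 : r <= 1 by rewrite /r gerBl mulr_ge0 // ltW.
  have -> : 1 - n.+1%:R * dl = r - dl by rewrite /r -natr1; ring.
  rewrite -(ler_pM2l r0) uS.
  have h1 : p * u n.+1 <= p * (r * u n) by rewrite ler_wpM2l.
  have h2 : 0 <= (r ^+ 2 - r + 4^-1) * u n.+1.
    rewrite mulr_ge0 // (_ : _ + _ = (r - 2^-1) ^+ 2) ?sqr_ge0 //.
    by field.
  have h3 : 0 <= dl * (1 - r) * u n.+1 by rewrite !mulr_ge0 //; lra.
  have e1 : r * (u n.+1 - p * u n) = r * u n.+1 - p * (r * u n) by ring.
  have e2 : r * ((r - dl) * u n.+1) = r * u n.+1 - p * u n.+1 +
     (r ^+ 2 - r + 4^-1) * u n.+1 + dl * (1 - r) * u n.+1 by rewrite /dl; ring.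
  by rewrite e1 e2; lra.
pose n := (Num.truncn dl^-1).+1.
have /andP[_ h] : (Num.truncn dl^-1)%:R <= dl^-1 < n%:R.
  by apply: truncn_itv; rewrite invr_ge0 ltW.
have : 1 < n%:R * dl by rewrite -[ltLHS](mulVf (lt0r_neq0 dl0)) ltr_pM2r.
move=> h1; have := decay n; have := pos n; have := pos n.-1; rewrite /=.
set v := u n; set v' := u n.+1 => v0 v0'.
have : (1 - n%:R * dl) * v < 0 by rewrite nmulr_rlt0 //; lra.
lra.
Qed.

Section Density.
Context (R : realType) (d : measure_display) (T : measurableType d)
  (P : probability T R) (J : int -> T -> bool) (p : R).
Hypothesis mJ : forall i, measurable_fun setT (J i).
Hypothesis PJ : forall i, P [set t | J i t] = p%:E.
Hypothesis JJ : forall i, P [set t | J i t && J (i + 1) t] = 0%E.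
Hypothesis indJ : forall i A B,
  generated_by J [set j | j < i] A -> generated_by J [set j | i + 1 <= j] B ->
  P (A `&` B) = (P A * P B)%E.

Let none (n : nat) : set T := [set t | forall k : nat, (k < n)%N -> ~~ J k%:Z t].

Let mJs i : measurable [set t | J i t].
Proof. by have := mJ i measurableT (Y := [set true]) I; rewrite setTI. Qed.

Let noneE n : none n = cylinder J [seq k%:Z | k <- iota 0 n] (fun=> [set false]).
Proof.
apply/seteqP; split => [t tn i /mapP[k]|t tc k kn].
  by rewrite mem_iota add0n => kn -> /=; apply/negbTE/tn.
by apply/negbT/tc; apply/mapP; exists k; rewrite ?mem_iota.
Qed.

Let none_measurable n : measurable (none n).
Proof.
by rewrite noneE; apply: (generated_by_measurable mJ (I := setT)); exact: cylinder_generated.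
Qed.

Let noneS n : none n.+1 = none n `\` [set t | J n%:Z t].
Proof.
apply/seteqP; split => [t tn|t [tn /= /negP Jn] k]; rewrite ?ltnS.
  by split; [move=> k kn; apply: tn; lia|apply/negP; apply: tn].
by rewrite leq_eqVlt => /predU1P[->//|]; exact: tn.
Qed.

(** u n is the probability of no J among n consecutive sites.  A site with J
    excludes J at the previous site, which can therefore be left out of the
    condition; then 1-dependence applies and gives the two-term recursion. *)
Lemma density_le_quarter : p <= 4^-1.
Proof.
pose u n := fine (P (none n)).
have uE n : P (none n) = (u n)%:E by rewrite /u fineK // fin_num_measure.
have step n (A := none n `&` [set t | J n%:Z t]) : u n.+1 = u n - fine (P A).
  rewrite /u noneS measureD //; last by rewrite ltey_eq fin_num_measure.
  by rewrite fineB // fin_num_measure //; exact: measurableI.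
have P0 : P (none 0 `&` [set t | J 0 t]) = p%:E.
  by rewrite (_ : none 0 = setT) ?setTI //; apply/seteqP; split.
apply: (@two_term_recursion_bound R p u).
- by move=> n; rewrite /u fine_ge0.
- by rewrite /u (_ : none 0 = setT) ?probability_setT //; apply/seteqP; split.
- rewrite step P0 /= /u (_ : none 0 = setT) ?probability_setT //.
  by apply/seteqP; split.
- by rewrite -lee_fin -(PJ 0).
move=> n; rewrite step; congr (_ - _).
suff -> : P (none n.+1 `&` [set t | J n.+1%:Z t]) = (u n * p)%:E by rewrite mulrC.
rewrite EFinM -uE -(PJ n.+1%:Z) -(@indJ n%:Z); first last.
- have -> : [set t | J n.+1%:Z t] = J n.+1%:Z @^-1` [set true] by apply/seteqP; split.
  by apply: generated_by_coordinate => //=; lia.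
- rewrite noneE; apply: cylinder_generated => // i /mapP[k]; rewrite mem_iota add0n => kn -> /=.
  lia.
set C := [set t | J n.+1%:Z t].
have mC : measurable C by exact: mJs.
have mNC m : measurable (none m `&` C) by exact: measurableI.
have mNCJ : measurable (none n `&` C `&` [set t | J n%:Z t]).
  by apply: measurableI; [exact: mNC|exact: mJs].
(* Given J at n + 1, the condition at n excludes only a null set. *)
have E1 : none n `&` C = (none n.+1 `&` C) `|` (none n `&` C `&` [set t | J n%:Z t]).
  rewrite noneS; apply/seteqP; split => [t [tn tC]|t [[[tn _] tC]//|[]//]].
  by case: (boolP (J n%:Z t)) => h; [right|left; split => //; split => //; apply/negP].
rewrite E1 measureU; first last.
- by rewrite noneS; apply/seteqP; split => // t [[[_ nJ] _] [_ /nJ]].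
- exact: mNCJ.
- exact: mNC.
rewrite [X in (_ + X)%E](_ : _ = 0%E) ?adde0 //.
apply/eqP; rewrite -measure_le0 -(JJ n%:Z); apply: le_measure; rewrite ?inE.
- exact: mNCJ.
- rewrite (_ : [set t | _] = [set t | J n%:Z t] `&` [set t | J (n%:Z + 1) t]).
    exact: measurableI.
  by apply/seteqP; split => t /= => [/andP|[-> ->]].
- move=> t [[_ tC] /= ->] /=; move: tC; rewrite /C /=.
  by rewrite (_ : n.+1%:Z = n%:Z + 1) //; lia.
Qed.

End Density.

(** * One color of a 1-dependent 4-coloring *)

Section BitDescents.
Variable R : realType.
Notation B := (@fair_bit R).
Notation bit := (fun i : int => B i : measurableTypeR R -> bool).

Definition bit_descent (i : int) (t : measurableTypeR R) : bool := (B i t > B (i + 1)%R t)%N.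

Lemma bit_descent_andb i t : bit_descent i t = B i t && ~~ B (i + 1) t.
Proof. by rewrite /bit_descent; case: (B i t) (B (i + 1) t) => -[]. Qed.

Lemma bit_descentE i : [set t | bit_descent i t] =
  cylinder bit [:: i; i + 1] (fun j => if j == i then [set true] else [set false]).
Proof.
have i1 : (i + 1 == i) = false by apply/eqP; lia.
rewrite !cylinder_cons cylinder_nil setIT eqxx i1.
apply/seteqP; split => t; rewrite {1}/mkset bit_descent_andb.
  by case/andP => bi /negbTE bi1; split.
by case => -> ->.
Qed.

Lemma bit_descent_generated i :
  generated_by bit [set j | i - 0%:Z <= j <= i + 1%:Z] [set t | bit_descent i t].
Proof.
rewrite bit_descentE; apply: cylinder_generated => [j|j]; first by case: ifP.
by rewrite !inE => /orP[]/eqP -> /=; lia.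
Qed.

Lemma bit_measurable i : measurable_fun setT (bit i).
Proof. exact: measurable_funPT. Qed.

Lemma bit_descent_measurable i : measurable_fun setT (bit_descent i).
Proof.
apply: measurable_fun_indicator.
by apply: (generated_by_measurable bit_measurable); exact: bit_descent_generated.
Qed.

Lemma bit_descent_gap : gap_independent 1 (unit_prob R) bit_descent.
Proof.
apply: (@independent_gap R _ _ _ _ (unit_prob R) bit bit_descent 0 1).
- exact: bit_measurable.
- exact: fair_bit_independent.
exact: bit_descent_generated.
Qed.

Lemma fair_bit_law i b : unit_prob R (bit i @^-1` [set b]) = (2^-1)%:E.
Proof.
have [_ /(_ i [set b] I)] := iid_fair_bits_exist R.
rewrite /distribution /pushforward => ->.
rewrite bernoulli_probE; last by apply/andP; split; lra.
have in1 (a : bool) : (a \in [set a]) = true by apply: mem_set.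
have in0 (a : bool) : (~~ a \in [set a]) = false by apply: memNset; case: a.
case: b; rewrite !diracE in1 ?(in0 true) ?(in0 false) mule0 mule1 ?adde0 ?add0e //.
by change ((1 - 2^-1)%:E = (2^-1)%:E :> \bar R); congr (_%:E); lra.
Qed.

Lemma bit_descent_probability i : unit_prob R [set t | bit_descent i t] = (4^-1)%:E.
Proof.
rewrite bit_descentE fair_bit_independent; first last.
- by move=> j; case: ifP.
- by rewrite /= inE andbT; apply/eqP; lia.
have i1 : (i + 1 == i) = false by apply/eqP; lia.
rewrite !big_cons big_nil mule1 eqxx i1 !fair_bit_law -EFinM; congr (_%:E); lra.
Qed.

Lemma bit_descent_adjacent i t : bit_descent i t -> bit_descent (i + 1) t -> False.
Proof.
by rewrite !bit_descent_andb => /andP[_ /negbTE ->].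
Qed.

End BitDescents.

Section StationaryColoring.
Context (R : realType) (d : measure_display) (T : measurableType d)
  (P : probability T R) (X : int -> {RV P >-> nat}).

Let mX i : measurable_fun setT (X i). Proof. exact: measurable_funPT. Qed.

Lemma stationary_marginal (i : int) (c : nat) : stationary X ->
  P [set t | X i t = c] = P [set t | X 0 t = c].
Proof.
move=> statX; have step j : P [set t | X j t = c] = P [set t | X (j + 1) t = c].
  apply: (statX [set x | x j = c]).
  by apply: (@generated_by_coordinate int (int -> nat) _ nat (fun k x => x k) setT j [set c]).
have up (n : nat) j : P [set t | X (j + n%:Z) t = c] = P [set t | X j t = c].
  by elim: n => [|n IH]; [rewrite addr0|rewrite -IH (step (j + n%:Z)) -addn1 PoszD addrA].
have [i0|i0] := leP 0 i.
  have e : 0 + (absz i)%:Z = i by lia.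
  by rewrite -[in LHS]e up.
have e : i + (absz i)%:Z = 0 by lia.
by rewrite -(up (absz i) i) e.
Qed.

Lemma coloring_repeat_measurable (i : int) : measurable [set t | X i t = X (i + 1) t].
Proof.
pose F c : set T := [set t | X i t = c] `&` [set t | X (i + 1) t = c].
rewrite (_ : [set t | _] = \bigcup_c F c).
  apply: bigcupT_measurable => c; apply: measurableI.
    by have := mX i measurableT (Y := [set c]) I; rewrite setTI.
  by have := mX (i + 1) measurableT (Y := [set c]) I; rewrite setTI.
apply/seteqP; split => [t /= e|t [c _ [/= -> ->]]//].
by exists (X (i + 1) t).
Qed.

Lemma coloring_repeat_null (q : nat) (i : int) : coloring q X ->
  P [set t | X i t = X (i + 1) t] = 0%E.
Proof.
move=> [_ colX]; apply: measure_negligible; first exact: coloring_repeat_measurable.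
by apply: negligibleS colX => t /= e; move=> /(_ i).
Qed.

Lemma color_generated (f : pred nat) (i : int) :
  generated_by (fun i => X i : T -> nat) [set i] [set t | f (X i t)].
Proof.
exact: (@generated_by_coordinate _ _ _ _ (fun i => X i : T -> nat) [set i] i [set c | f c]).
Qed.

Lemma color_indicator_measurable (f : pred nat) (i : int) :
  measurable_fun setT (fun t => f (X i t)).
Proof. by apply: measurable_nat_comp; exact: mX. Qed.

(** All four densities are at most 1/4 and they add up to 1. *)
Lemma color_density : stationary X -> k_dependent 1 X -> coloring 4 X ->
  forall i, P [set t | X i t == 1%N] = (4^-1)%:E.
Proof.
move=> statX depX colX.
pose p c := fine (P [set t | X 0 t = c]).
have mc i c : measurable [set t | X i t = c].
  by have := mX i measurableT (Y := [set c]) I; rewrite setTI.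
have pE i c : P [set t | X i t = c] = (p c)%:E.
  by rewrite (stationary_marginal i c statX) /p fineK // fin_num_measure.
have eqE i c : [set t | X i t == c] = [set t | X i t = c].
  by apply/seteqP; split => t /= /eqP.
have p4 c : p c <= 4^-1.
  apply: (@density_le_quarter R d T P (fun i t => X i t == c)).
  - by move=> i; apply: (color_indicator_measurable (fun a => a == c)).
  - by move=> i; rewrite eqE.
  - move=> i; apply/eqP; rewrite -measure_le0 -(coloring_repeat_null i colX).
    apply: le_measure; rewrite ?inE.
    + rewrite (_ : [set t | _] = [set t | X i t = c] `&` [set t | X (i + 1) t = c]).
        exact: measurableI.
      by apply/seteqP; split => t /= => [/andP[/eqP ? /eqP ?]|[-> ->]]; rewrite ?eqxx.
    + exact: coloring_repeat_measurable.
    + by move=> t /= /andP[/eqP -> /eqP ->].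
  - move=> i A C sA sC; apply: (depX i).
      move: sA; apply: generated_by_sub; first exact: smallest_sigma_algebra.
      move=> j D ji _.
      exact: (@generated_by_coordinate _ _ _ _ (fun i => X i : T -> nat) _ j [set a | D (a == c)]).
    move: sC; apply: generated_by_sub; first exact: smallest_sigma_algebra.
    move=> j D ji _.
    exact: (@generated_by_coordinate _ _ _ _ (fun i => X i : T -> nat) _ j [set a | D (a == c)]).
have sum1 : \sum_(c <- letters 4) p c = 1.
  have := @measure_partition R d T P _ (letters 4) (fun c => [set t | X 0 t = c]) setT.
  rewrite probability_setT => /(_ (letters_uniq 4) measurableT (mc 0)) h.
  apply: EFin_inj; rewrite h; first last.
  - by move=> t _; exists (X 0 t) => //; rewrite mem_letters; exact: colX.1.
  - by move=> c c' t _ _ /= -> ->.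
  by rewrite -sumEFin; apply: eq_bigr => c _; rewrite setTI pE.
move=> i; rewrite eqE pE; congr (_%:E).
move: sum1; rewrite /letters /= !big_cons big_nil.
have := p4 1%N; have := p4 2; have := p4 3; have := p4 4%N; lra.
Qed.

(** Clusters are single sites of density 1/4 or contain two adjacent sites,
    which has probability zero for both processes. *)
Lemma one_color_bit_law : stationary X -> k_dependent 1 X -> coloring 4 X ->
  equal_in_law P (fun i t => X i t == 1%N) (unit_prob R) (@bit_descent R).
Proof.
move=> statX depX colX.
have dens := color_density statX depX colX.
apply: (@cluster_law_unique R _ _ _ _ P (unit_prob R) 1).
- by move=> i; apply: (color_indicator_measurable (fun a => a == 1%N)).
- exact: bit_descent_measurable.
- apply: (k_dependent_gap depX) => i; exact: (color_generated (fun a => a == 1%N)).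
- exact: bit_descent_gap.
move=> i [_|j s /= /andP[ij _]].
  rewrite (_ : all_true _ [:: i] = [set t | X i t == 1%N]); last first.
    by apply/seteqP; split => t; rewrite /all_true /= andbT.
  rewrite (_ : all_true (@bit_descent R) [:: i] = [set t | bit_descent i t]); last first.
    by apply/seteqP; split => t; rewrite /all_true /= andbT.
  by rewrite dens bit_descent_probability.
have -> : j = i + 1 by lia.
rewrite (_ : all_true (@bit_descent R) _ = set0) ?measure0; last first.
  apply/seteqP; split => // t; rewrite /all_true /= => /and3P[h1 h2 _].
  exact: bit_descent_adjacent h1 h2.
apply/eqP; rewrite -measure_le0 -(coloring_repeat_null i colX).
apply: le_measure; rewrite ?inE.
- apply: (generated_by_measurable mX (I := setT)).
  apply: all_true_generated => l _.
  by move: (@color_generated (fun a => a == 1%N) l); apply: generated_by_subset.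
- exact: coloring_repeat_measurable.
by move=> t; rewrite /all_true /= => /and3P[/eqP -> /eqP ->].
Qed.

End StationaryColoring.

(** * Descents, peaks and conditioning *)

Lemma sum_words_sub (V : nmodType) (p q n : nat) (f : seq nat -> V) (Q : pred (seq nat)) :
  (p <= q)%N ->
  \sum_(x <- words (letters q) n | all (mem (letters p)) x && Q x) f x =
  \sum_(x <- words (letters p) n | Q x) f x.
Proof.
move=> pq; rewrite -[LHS]big_filter -[RHS]big_filter; apply: perm_big; apply: uniq_perm.
- by rewrite filter_uniq // words_uniq // letters_uniq.
- by rewrite filter_uniq // words_uniq // letters_uniq.
move=> x; rewrite !mem_filter !mem_words.
case: (boolP (all (mem (letters p)) x)) => xp; rewrite ?andbF //=.
have -> : all (mem (letters q)) x by apply: sub_all xp => a; exact: letters_sub.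
by [].
Qed.

Section UniformIndicators.
Context (R : realType) (d : measure_display) (T : measurableType d)
  (P : probability T R) (U : int -> {RV P >-> R}).
Hypothesis iidU : iid_uniform01 U.

Let X (i : int) : T -> R := U i.
Let mX i : measurable_fun setT (X i). Proof. exact: measurable_funPT. Qed.
Let indX : independent P X. Proof. exact: iid_independent iidU. Qed.

Lemma comparison_generated (I : set int) (i j : int) : I i -> I j ->
  generated_by X I [set t | X i t > X j t].
Proof.
move=> Ii Ij.
pose gens := \bigcup_(k in I) preimage_set_system setT (X k) (@measurable _ R).
apply: (@measurable_gt R int _ (g_sigma_algebraType gens) X) => _ B mB;
  by rewrite setTI; apply: generated_by_coordinate.
Qed.

Definition descent (i : int) (t : T) : bool := X i t > X (i + 1) t.

Definition peak (i : int) (t : T) : bool :=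
  (X (i - 1) t < X i t) && (X i t > X (i + 1) t).

Lemma descent_generated i :
  generated_by X [set j | i - 0%:Z <= j <= i + 1%:Z] [set t | descent i t].
Proof. by apply: comparison_generated => /=; lia. Qed.

Lemma peak_generated i :
  generated_by X [set j | i - 1%:Z <= j <= i + 1%:Z] [set t | peak i t].
Proof.
rewrite (_ : [set t | _] = [set t | X i t > X (i - 1) t] `&` [set t | X i t > X (i + 1) t]).
  by apply: generated_by_setI; apply: comparison_generated => /=; lia.
by apply/seteqP; split => t /= => [/andP|[? ?]]; last apply/andP.
Qed.

Lemma descent_measurable i : measurable_fun setT (descent i).
Proof.
apply: measurable_fun_indicator.
by apply: (generated_by_measurable mX); exact: descent_generated.
Qed.

Lemma peak_measurable i : measurable_fun setT (peak i).
Proof.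
apply: measurable_fun_indicator.
by apply: (generated_by_measurable mX); exact: peak_generated.
Qed.

Lemma descent_gap : gap_independent 1 P descent.
Proof.
exact: (@independent_gap R _ _ _ _ P X descent 0 1 mX indX descent_generated).
Qed.

Lemma peak_gap : gap_independent 2 P peak.
Proof.
exact: (@independent_gap R _ _ _ _ P X peak 1 1 mX indX peak_generated).
Qed.

Lemma descent_run (i : int) (n : nat) :
  P (all_true descent [seq i + k%:Z | k <- iota 0 n]) = ((n.+1)`!%:R^-1)%:E.
Proof.
pose s := [seq i + k%:Z | k <- iota 0 n.+1].
have us : uniq s by rewrite map_inj_uniq ?iota_uniq // => a b; lia.
have nthE t k : (k < n.+1)%N -> nth 0 [seq X j t | j <- s] k = X (i + k%:Z) t.
  by move=> kn; rewrite /s -map_comp (nth_map 0%N) ?size_iota // nth_iota.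
have <- : decreasing_along X s = all_true descent [seq i + k%:Z | k <- iota 0 n].
  have sz t : size [seq X j t | j <- s] = n.+1 by rewrite /s !size_map size_iota.
  have e (k : nat) : i + k.+1%:Z = i + k%:Z + 1 by lia.
  apply/seteqP; split => t; rewrite /decreasing_along /all_true /mkset.
    move=> /(sortedP 0) h; apply/allP => _ /mapP[k + ->]; rewrite mem_iota add0n => kn.
    by have := h k; rewrite sz ltnS => /(_ kn); rewrite !nthE ?e //; exact: ltnW.
  move=> /allP h; apply/(sortedP 0) => k; rewrite sz ltnS => kn.
  rewrite !nthE //; last exact: ltnW.
  by rewrite e; apply: h; apply/mapP; exists k; rewrite ?mem_iota.
by rewrite (probability_decreasing iidU us) size_map size_iota.
Qed.

Lemma peak_run (i : int) (m : nat) :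
  P (all_true peak [seq i + (k.*2)%:Z | k <- iota 0 m]) = (peak_weight R m)%:E.
Proof.
rewrite -(probability_zigzag iidU (i - 1) m); congr (P _).
have e0 (j : nat) : i - 1 + j.*2%:Z = i + j.*2%:Z - 1 by lia.
have e1 (j : nat) : i - 1 + j.*2.+1%:Z = i + j.*2%:Z by lia.
have e2 (j : nat) : i - 1 + j.*2.+2%:Z = i + j.*2%:Z + 1 by lia.
apply/seteqP; split => t.
  rewrite /all_true /= => /allP h j jm; rewrite e0 e1 e2.
  have /h /andP[] : i + j.*2%:Z \in [seq i + (k.*2)%:Z | k <- iota 0 m].
    by apply/mapP; exists j; rewrite ?mem_iota.
  by [].
move=> h; apply/allP => _ /mapP[j + ->]; rewrite mem_iota add0n => jm.
by have := h j jm; rewrite e0 e1 e2 /peak => -[-> ->].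
Qed.

Lemma peak_adjacent i t : peak i t -> peak (i + 1) t -> False.
Proof.
by rewrite /peak addrK => /andP[_ h1] /andP[h2 _]; have := lt_trans h1 h2; rewrite ltxx.
Qed.

End UniformIndicators.

Lemma path_gap1 (i : int) (s : seq int) :
  path (fun x y => x < y <= x + 1%:Z) i s ->
  i :: s = [seq i + k%:Z | k <- iota 0 (size s).+1].
Proof.
elim: s i => [|j s IH] i; first by rewrite /= addr0.
rewrite [path _ _ _]/= => /andP[ij /IH E].
rewrite -[(size (j :: s)).+1]/(1 + (size s).+1)%N iotaD map_cat (iotaDl 1 0) -map_comp.
rewrite [iota 0 1]/= [map _ [:: 0%N]]/= cat1s addr0 E; congr (_ :: _).
by apply: eq_map => k; rewrite /comp PoszD addrA; congr (_ + _); lia.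
Qed.

(** A cluster with gaps 1 and 2 that has some gap 1 contains adjacent sites. *)
Lemma path_gap2 (i : int) (s : seq int) :
  path (fun x y => x < y <= x + 2%:Z) i s ->
  i :: s = [seq i + k.*2%:Z | k <- iota 0 (size s).+1] \/
  exists2 j, j \in i :: s & j + 1 \in i :: s.
Proof.
elim: s i => [|j s IH] i; first by left; rewrite /= addr0.
rewrite [path _ _ _]/= => /andP[ij /IH [E|[l l1 l2]]]; last first.
  by right; exists l; rewrite inE ?l1 ?l2 orbT.
have [e|e] := eqVneq j (i + 1).
  by right; exists i; rewrite ?mem_head // -e inE mem_head orbT.
left; rewrite -[(size (j :: s)).+1]/(1 + (size s).+1)%N iotaD map_cat (iotaDl 1 0) -map_comp.
rewrite [iota 0 1]/= [map _ [:: 0%N]]/= cat1s addr0 E; congr (_ :: _).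
by apply: eq_map => k; rewrite /comp doubleD PoszD addrA; congr (_ + _); lia.
Qed.

Section ColorIndicators.
Context (R : realType).

Lemma two_colors_descent_law (d d' : measure_display) (T : measurableType d)
    (T' : measurableType d') (P : probability T R) (P' : probability T' R)
    (X : int -> {RV P >-> nat}) (U : int -> {RV P' >-> R}) :
  (forall i t, X i t \in letters 4) -> word_law (weight R 4) P X ->
  k_dependent 1 X -> iid_uniform01 U ->
  equal_in_law P (fun i t => X i t \in [:: 1%N; 2%N]) P' (descent U).
Proof.
move=> X4 lawX depX iidU.
have mX i : measurable_fun setT (X i : T -> nat) by exact: measurable_funPT.
apply: (@cluster_law_unique R _ _ _ _ P P' 1).
- by move=> i; apply: (color_indicator_measurable X (fun a => a \in [:: 1%N; 2%N])).
- exact: descent_measurable.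
- apply: (k_dependent_gap depX) => i.
  exact: (@color_generated _ _ _ _ X (fun a => a \in [:: 1%N; 2%N])).
- exact: descent_gap.
move=> i s /path_gap1 ->; rewrite descent_run //; set n := (size s).+1.
pose Q (x : seq nat) := all (mem [:: 1%N; 2%N]) x.
have [_] := probability_factor (letters_uniq 4) mX X4 (a := i) (n := n) Q (fun x _ => lawX i x).
rewrite -(sum_weight_two_letters R n).
have -> : \sum_(x <- words (letters 4) n | Q x) weight R 4 x =
          \sum_(x <- words (letters 2) n) weight R 4 x.
  have := @sum_words_sub _ 2 4 n (weight R 4) xpredT isT => <-.
  by apply: eq_bigl => x; rewrite andbT.
move=> <-; congr (P _).
by apply/seteqP; split => t; rewrite /all_true /Q /factor /mkseq /mkset !all_map.
Qed.

Lemma one_color_peak_law (d d' : measure_display) (T : measurableType d)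
    (T' : measurableType d') (P : probability T R) (P' : probability T' R)
    (Y : int -> {RV P >-> nat}) (U : int -> {RV P' >-> R}) :
  (forall i t, Y i t \in letters 3) -> word_law (weight R 3) P Y ->
  k_dependent 2 Y -> iid_uniform01 U ->
  equal_in_law P (fun i t => Y i t == 1%N) P' (peak U).
Proof.
move=> Y3 lawY depY iidU.
have mY i : measurable_fun setT (Y i : T -> nat) by exact: measurable_funPT.
apply: (@cluster_law_unique R _ _ _ _ P P' 2).
- by move=> i; apply: (color_indicator_measurable Y (fun a => a == 1%N)).
- exact: peak_measurable.
- apply: (k_dependent_gap depY) => i; exact: (@color_generated _ _ _ _ Y (fun a => a == 1%N)).
- exact: peak_gap.
move=> i s /path_gap2[->|[j js j1s]]; last first.
  rewrite (_ : all_true (peak U) _ = set0) ?measure0; last first.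
    apply/seteqP; split => // t; rewrite /all_true /mkset => /allP h.
    exact: (peak_adjacent (h _ js) (h _ j1s)).
  have [mr PE] := weight_law_repeat Y3 lawY j.
  apply/eqP; rewrite -measure_le0 -PE; apply: le_measure; rewrite ?inE //.
    apply: (generated_by_measurable mY (I := setT)); apply: all_true_generated => l _.
    by move: (@color_generated _ _ _ _ Y (fun a => a == 1%N) l); apply: generated_by_subset.
  by move=> t; rewrite /all_true /mkset => /allP h; rewrite (eqP (h _ js)) (eqP (h _ j1s)).
rewrite peak_run //.
pose Q (x : seq nat) := all (fun j => nth 0%N x j.*2 == 1%N) (iota 0 (size s).+1).
have [_] := probability_factor (letters_uniq 3) mY Y3 (a := i) (n := (size s).*2.+1) Q
  (fun x _ => lawY i x).
rewrite /Q (sum_weight_peaks R (size s) [::]) -/(peak_weight R (size s).+1) => <-.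
have nthE t k : k \in iota 0 (size s).+1 ->
    nth 0%N (factor (fun i => Y i : T -> nat) i (size s).*2.+1 t) k.*2 = Y (i + k.*2%:Z) t.
  by rewrite mem_iota => ks; rewrite nth_factor //; lia.
congr (P _); apply/seteqP; split => t; rewrite /all_true /mkset all_map => /allP h;
  by apply/allP => k ks; have := h k ks; rewrite /preim /= nthE.
Qed.

Lemma sum_weight_conditional (n : nat) (Q : pred (seq nat)) :
  \sum_(x <- words (letters 4) n | all (mem (letters 3)) x && Q x) weight R 4 x =
  (total_buildings 3 n)%:R / (total_buildings 4 n)%:R *
    \sum_(x <- words (letters 3) n | Q x) weight R 3 x.
Proof.
rewrite sum_words_sub // mulr_sumr [LHS]big_seq_cond [RHS]big_seq_cond.
apply: eq_bigr => x; rewrite mem_words => /andP[/andP[/eqP sx x3] _].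
by rewrite (@weight_change _ 3) ?sx.
Qed.

(** Avoiding the color 4 on the window means reading a word over three
    letters; the length-dependent factor between the two weights is P C. *)
Lemma conditional_window_law (d d' : measure_display) (T : measurableType d)
    (T' : measurableType d') (P : probability T R) (P' : probability T' R)
    (X : int -> {RV P >-> nat}) (Y : int -> {RV P' >-> nat}) (n : nat)
    (C := [set t | forall i : int, 1 <= i <= n%:Z -> X i t <> 4%N]) :
  (forall i t, X i t \in letters 4) -> word_law (weight R 4) P X ->
  (forall i t, Y i t \in letters 3) -> word_law (weight R 3) P' Y ->
  (0 < P C)%E /\
  forall A : set (n.-tuple nat), measurable A ->
    P' [set t | A (window Y n t)] = cond_prob P C [set t | A (window X n t)].
Proof.
move=> X4 lawX Y3 lawY.
have mX i : measurable_fun setT (X i : T -> nat) by exact: measurable_funPT.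
have mY i : measurable_fun setT (Y i : T' -> nat) by exact: measurable_funPT.
have windowE d1 (S : measurableType d1) (Q : probability S R) (Z : int -> {RV Q >-> nat}) t :
    tval (window Z n t) = factor (fun i => Z i : S -> nat) 1 n t.
  apply: (@eq_from_nth _ 0%N); rewrite size_tuple ?size_factor // => k kn.
  rewrite nth_factor // -[k]/(val (Ordinal kn)) -tnth_nth tnth_mktuple /=.
  by congr (Z _ t); lia.
have CE : C = [set t | all (mem (letters 3)) (factor (fun i => X i : T -> nat) 1 n t)].
  apply/seteqP; split => t tC.
    apply/allP => _ /mapP[k + ->]; rewrite mem_iota => kn.
    change (X (1 + k%:Z) t \in letters 3).
    have := tC (1 + k%:Z) ltac:(lia); have := X4 (1 + k%:Z) t.
    by rewrite !mem_letters; set c := X _ t; lia.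
  move=> i i1n X4i; have : X i t \in factor (fun i => X i : T -> nat) 1 n t.
    by apply/mapP; exists (absz (i - 1)); rewrite ?mem_iota; [lia|congr (X _ t); lia].
  by move/(allP tC); rewrite X4i.
pose r : R := (total_buildings 3 n)%:R / (total_buildings 4 n)%:R.
have r0 : 0 < r by rewrite divr_gt0 // ltr0n total_buildings_gt0.
have joint (Q : pred (seq nat)) :
  P [set t | all (mem (letters 3)) (factor (fun i => X i : T -> nat) 1 n t) &&
             Q (factor (fun i => X i : T -> nat) 1 n t)] =
  (r * \sum_(x <- words (letters 3) n | Q x) weight R 3 x)%:E.
  have [_ ->] := probability_factor (letters_uniq 4) mX X4 (a := 1) (n := n)
    (fun x => all (mem (letters 3)) x && Q x) (fun x _ => lawX 1 x).
  by rewrite sum_weight_conditional.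
have PC : P C = r%:E.
  have := joint xpredT; rewrite sum_weight_words // mulr1 => <-.
  by rewrite CE; congr (P _); apply/seteqP; split => t; rewrite /mkset andbT.
split=> [|A _]; first by rewrite PC lte_fin.
(* The event A, transported from tuples to sequences. *)
pose Q (x : seq nat) : bool := `[< exists2 y : n.-tuple nat, tval y = x & A y >].
have QE d1 (S : measurableType d1) (P1 : probability S R) (Z : int -> {RV P1 >-> nat}) t :
    Q (factor (fun i => Z i : S -> nat) 1 n t) <-> A (window Z n t).
  rewrite /Q -windowE; split => [/asboolP[y /val_inj -> //]|Aw].
  by apply/asboolP; exists (window Z n t).
rewrite /cond_prob PC (_ : _ `&` C = [set t |
    all (mem (letters 3)) (factor (fun i => X i : T -> nat) 1 n t) &&
    Q (factor (fun i => X i : T -> nat) 1 n t)]); last first.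
  rewrite CE; apply/seteqP; split => t.
    by move=> [Aw al]; apply/andP; split; [exact: al|exact/QE].
  by move=> /andP[al /QE Aw].
rewrite joint (_ : [set t | A (window Y n t)] =
   [set t | Q (factor (fun i => Y i : T' -> nat) 1 n t)]); last first.
  by apply/seteqP; split => t /QE.
have [_ ->] := probability_factor (letters_uniq 3) mY Y3 (a := 1) (n := n) Q
  (fun x _ => lawY 1 x).
rewrite inver gt_eqF // -EFinM; congr (_%:E); field.
by rewrite gt_eqF.
Qed.

End ColorIndicators.

Theorem theorem4 (R : realType) :
  (exists (d : measure_display) (T : measurableType d) (P : probability T R)
      (X : int -> {RV P >-> nat})
      (d' : measure_display) (T' : measurableType d') (P' : probability T' R)
      (Y : int -> {RV P' >-> nat}),
    [/\ stationary X, k_dependent 1 X & coloring 4 X] /\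
    [/\ stationary Y, k_dependent 2 Y & coloring 3 Y] /\
    (* (i) *)
    [/\ reversible X, color_symmetric 4 X, reversible Y
      & color_symmetric 3 Y] /\
    (* (ii) *)
    (exists (d1 : measure_display) (T1 : measurableType d1)
        (P1 : probability T1 R) (B : int -> {RV P1 >-> bool}),
      iid_fair_bits B /\
      equal_in_law P (fun i t => X i t == 1%N)
                   P1 (fun i t => (B i t > B (i + 1)%R t)%N)) /\
    (* (iii) *)
    (exists (d1 : measure_display) (T1 : measurableType d1)
        (P1 : probability T1 R) (U : int -> {RV P1 >-> R}),
      iid_uniform01 U /\
      equal_in_law P (fun i t => X i t \in [:: 1%N; 2%N])
                   P1 (fun i t => U i t > U (i + 1) t)) /\
    (* (iv) *)
    (exists (d1 : measure_display) (T1 : measurableType d1)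
        (P1 : probability T1 R) (U : int -> {RV P1 >-> R}),
      iid_uniform01 U /\
      equal_in_law P' (fun i t => Y i t == 1%N)
                   P1 (fun i t => (U (i - 1) t < U i t) &&
                                  (U i t > U (i + 1) t))) /\
    (* (v) *)
    (forall n : nat, (1 <= n)%N ->
      let C := [set t | forall i : int, 1 <= i <= n%:Z -> X i t <> 4%N] in
      (0 < P C)%E /\
      forall A : set (n.-tuple nat), measurable A ->
        P' [set t | A (window Y n t)] =
        cond_prob P C [set t | A (window X n t)])) /\
  (forall (d : measure_display) (T : measurableType d) (P : probability T R)
      (X : int -> {RV P >-> nat}),
    stationary X -> k_dependent 1 X -> coloring 4 X ->
    exists (d1 : measure_display) (T1 : measurableType d1)
        (P1 : probability T1 R) (B : int -> {RV P1 >-> bool}),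
      iid_fair_bits B /\
      equal_in_law P (fun i t => X i t == 1%N)
                   P1 (fun i t => (B i t > B (i + 1)%R t)%N)).
Proof.
split; last first.
  move=> d T P X statX depX colX.
  exists _, (measurableTypeR R), (unit_prob R), (@fair_bit R); split.
    exact: iid_fair_bits_exist.
  exact: one_color_bit_law.
have [X [X4 lawX]] := @coloring_process_exists R 4 isT.
have [Y [Y3 lawY]] := @coloring_process_exists R 3 isT.
have statX := weight_law_stationary lawX.
have depX := weight_law_k_dependent X4 lawX (@weight4_gap1 R).
have colX := weight_law_coloring X4 lawX.
have depY := weight_law_k_dependent Y3 lawY (@weight3_gap2 R).
have iidU := iid_uniform01_exist R.
exists _, (measurableTypeR R), (unit_prob R), X.
exists _, (measurableTypeR R), (unit_prob R), Y.
split; first by [].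
split.
  split; [exact: weight_law_stationary lawY|by []|exact: weight_law_coloring Y3 lawY].
split.
  split.
  - exact: weight_law_reversible lawX.
  - exact: weight_law_symmetric X4 lawX.
  - exact: weight_law_reversible lawY.
  - exact: weight_law_symmetric Y3 lawY.
split.
  exists _, (measurableTypeR R), (unit_prob R), (@fair_bit R); split.
    exact: iid_fair_bits_exist.
  exact: one_color_bit_law.
split.
  exists _, (measurableTypeR R), (unit_prob R), (@uniform_RV R); split => //.
  exact: two_colors_descent_law.
split.
  exists _, (measurableTypeR R), (unit_prob R), (@uniform_RV R); split => //.
  exact: one_color_peak_law.
move=> n _ C; exact: conditional_window_law.
Qed.
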